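(* Let $\beta\in(0,1)$, let $n\ge 0$ be an integer, and let $u_\beta,v_\beta$ be solutions of $$u(x)=1+\int_0^\infty\frac{K(t)u(t)\,dt}{t+x},\qquad v(x)=1-\int_0^\infty\frac{K(t)v(t)\,dt}{t+x},\qquad x\in(0,\infty),$$ respectively, with $u_\beta-1,\ v_\beta-1\in L_2[0,\infty)$, and denote by the same symbols their analytic continuations to $\arg z\in(-\infty,\infty)$, $z\neq 0$. Put $$L_\beta(z)=\tfrac12\bigl(u_\beta(z)+v_\beta(z)\bigr),\qquad U_\beta(z)=\tfrac12\bigl(u_\beta(z)-v_\beta(z)\bigr),\qquad \arg z\in(-\infty,\infty),\ z\ne 0.$$ Then the piecewise analytic function $$L(s)=\begin{cases}\begin{pmatrix}L_\beta(s)&(-1)^nU_\beta(se^{-\pi i})\\(-1)^nU_\beta(s)&L_\beta(se^{-\pi i})\end{pmatrix},&0<\arg s<\pi,\\[3mm]\begin{pmatrix}L_\beta(s)&(-1)^nU_\beta(se^{\pi i})\\(-1)^nU_\beta(s)&L_\beta(se^{\pi i})\end{pmatrix},&-\pi<\arg s<0,\end{cases}$$ solves the following Riemann-Hilbert problem: (1) $L:\mathbb{C}\setminus\mathbb{R}\to\mathbb{C}^{2\times2}$ is analytic; (2) $L_+(s)=L_-(s)\,v_L(s)$ for $s\in\mathbb{R}\setminus\{0\}$, where $$v_L(s)=\begin{pmatrix}1&-\eta_L(s)\\ \eta_L(-s)&1\end{pmatrix};$$ (3) $L(s)=O(\epsilon_\beta(s))$ as $s\to0$; (4) $L(s)\to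 I$ as $s\to\infty$.
   Context: For $t\in[0,\infty)$, $$K(t)=\frac1\pi\exp\Bigl(-t^\beta\sin\frac{\pi\beta}2\Bigr)\sin\Bigl(t^\beta\cos\frac{\pi\beta}2\Bigr)=\frac1{2\pi i}\Bigl[\exp\bigl(e^{(\frac\pi2+\frac{\beta\pi}2)i}t^\beta\bigr)-\exp\bigl(e^{-(\frac\pi2+\frac{\beta\pi}2)i}t^\beta\bigr)\Bigr],$$ and the second expression extends $K$ analytically to all $t\ne0$ with $\arg t\in(-\infty,\infty)$. The function in the jump matrix is, for $s\in\mathbb{R}$, $$\eta_L(s)=2i(-1)^{n+1}e^{-|s|^\beta\sin(\pi\beta/2)}\sin\Bigl(|s|^\beta\cos\frac{\pi\beta}2\Bigr)\mathbf 1_{[0,\infty)}(s),$$ so that $\eta_L(t)=2\pi i(-1)^{n+1}K(t)$ for $t\ge0$. The local behaviour function is $\epsilon_\beta(s)=1$ if $1/2<\beta<1$; $\epsilon_\beta(s)=\ln|s|$ if $\beta=1/2$; $\epsilon_\beta(s)=|s|^{\beta-1/2}$ if $0<\beta<1/2$. The solutions $u_\beta,v_\beta$ on $(0,\infty)$ extend analytically to $\mathbb{C}\setminus(-\infty,0]$ through the integral equations (replace $x$ by $z$), and from there to the whole Riemann surface of the logarithm ($z\neq0$, $\arg z\in\mathbb{R}$), by rotating the path of integration and by means of the connection formulas $$u(ze^{-\pi i})-u(ze^{\pi i})=2\pi iK(z)u(z),\qquad v(ze^{-\pi i})-v(ze^{\pi i})=-2\pi iK(z)v(z).$$ $L_+(s)$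 and $L_-(s)$ denote the limiting values of $L$ at $s\in\mathbb{R}$ from the upper and lower half plane, respectively; $I$ is the $2\times2$ identity matrix; $O$ of a matrix is entrywise. *)

(* Defs.v *)
From HB Require Import structures.
From mathcomp Require Import all_boot all_order all_algebra.
From mathcomp Require Import complex.
From mathcomp Require Import all_classical all_reals all_analysis.

Set Implicit Arguments.
Unset Strict Implicit.
Unset Printing Implicit Defensive.

Import Order.TTheory GRing.Theory Num.Theory.
Import numFieldNormedType.Exports.
Import ComplexField.Normc.

Local Open Scope classical_set_scope.
Local Open Scope complex_scope.
Local Open Scope ring_scope.

(* R[i]^o is R[i] with its norm topology and derivatives over the field R[i]. *)
Notation Cplx R := (complex R)^o.

(* Lebesgue integral over D of a complex-valued function. *)
Definition Cintegral (R : realType) (D : set R) (f : R -> Cplx R) : Cplx R :=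
  (\int[lebesgue_measure]_(t in D) complex.Re (f t))
  +i* (\int[lebesgue_measure]_(t in D) complex.Im (f t)).

(* A complex-valued f is in L_2(D) iff Re f and Im f, extended by 0 outside D,
   are in the real L_2 (measurability included). *)
Definition in_L2 (R : realType) (D : set R) (f : R -> Cplx R) : Prop :=
  (fun t => complex.Re (f t)) \_ D \in Lfun (@lebesgue_measure R) 2%:E /\
  (fun t => complex.Im (f t)) \_ D \in Lfun (@lebesgue_measure R) 2%:E.

Definition kernelK (R : realType) (beta t : R) : R :=
  pi^-1 * (expR (- (t `^ beta * sin (pi * beta / 2)))
           * sin (t `^ beta * cos (pi * beta / 2))).

(* For open D. *)
Definition holomorphic_on (R : realType) (D : set (Cplx R))
  (f : Cplx R -> Cplx R) : Prop := forall z, D z -> derivable f z 1.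

(* A function on the Riemann surface of the logarithm is a function f of the
   modulus r > 0 and of the (unrestricted) argument theta; the value at
   z e^{i a} is f r (theta + a).  The logarithm w = ln r + i theta is a global
   chart of this surface, so f is analytic on it iff it is entire in w.  The
   values f r theta with r <= 0 play no role. *)
Definition log_surface_analytic (R : realType) (f : R -> R -> Cplx R) : Prop :=
  holomorphic_on setT (fun w => f (expR (complex.Re w)) (complex.Im w)).

(* By the identity theorem a given u has at most one such f (on r > 0). *)
Definition analytic_continuation (R : realType) (u : R -> Cplx R)
    (f : R -> R -> Cplx R) : Prop :=
  log_surface_analytic f /\ forall x, 0 < x -> f x 0 = u x.

(* Principal argument, in ]-pi, pi] for s != 0. *)
Definition Arg (R : realType) (s : Cplx R) : R :=
  if 0 <= complex.Im s then acos (complex.Re s / normc s)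
  else - acos (complex.Re s / normc s).

Lemma ArgE (R : realType) (s : Cplx R) : s != 0 ->
  s = (normc s * cos (Arg s)) +i* (normc s * sin (Arg s)).
Proof.
case: s => a b; rewrite eq_complex /= negb_and => ab0.
pose r := Num.sqrt (a ^+ 2 + b ^+ 2).
have r20 : 0 < a ^+ 2 + b ^+ 2.
  case/orP: ab0 => h; [apply: ltr_pwDl|apply: ltr_wpDl];
  by rewrite ?sqr_ge0// lt_def sqr_ge0 sqrf_eq0 h.
have r0 : 0 < r by rewrite sqrtr_gt0.
have rE : r ^+ 2 = a ^+ 2 + b ^+ 2 by rewrite sqr_sqrtr// ltW.
have q2 : (a / r) ^+ 2 <= 1.
  by rewrite expr_div_n ler_pdivrMr ?exprn_gt0// mul1r rE lerDl sqr_ge0.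
have q1 : -1 <= a / r <= 1 by rewrite -ler_norml -(expr_le1 (n := 2))// real_normK// num_real.
have sE : r * sin (acos (a / r)) = `|b|.
  rewrite sin_acos// -[X in X * _](ger0_norm (ltW r0)) -sqrtr_sqr -sqrtrM ?sqr_ge0//.
  rewrite mulrBr mulr1 expr_div_n mulrCA divff ?mulr1 ?gt_eqF ?exprn_gt0//.
  by rewrite rE addrAC subrr add0r sqrtr_sqr.
rewrite /Arg /= -/r; congr (_ +i* _).
  by case: ifP => _; rewrite ?cosN acosK ?in_itv// mulrC divfK// gt_eqF.
case: ifPn => [b0|]; first by rewrite sE ger0_norm.
by rewrite -ltNge => b0; rewrite sinN mulrN sE ltr0_norm ?opprK.
Qed.

Definition mx22 (T : Type) (a b c d : T) : 'M[T]_2 :=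
  \matrix_(i < 2, j < 2)
    if i == ord0 then (if j == ord0 then a else b)
    else (if j == ord0 then c else d).

Definition Lbeta (R : realType) (u v : R -> R -> Cplx R) (r theta : R) : Cplx R :=
  2^-1 * (u r theta + v r theta).

Definition Ubeta (R : realType) (u v : R -> R -> Cplx R) (r theta : R) : Cplx R :=
  2^-1 * (u r theta - v r theta).

(* u and v live on the Riemann surface of the logarithm.  The first case is
   0 < arg s < pi, the second one -pi < arg s < 0; the value for real s is
   irrelevant. *)
Definition Lmx (R : realType) (n : nat) (u v : R -> R -> Cplx R) (s : Cplx R) :
    'M[Cplx R]_2 :=
  let r := normc s in let theta := Arg s in
  if 0 < complex.Im s then
    mx22 (Lbeta u v r theta) ((-1) ^+ n * Ubeta u v r (theta - pi))
         ((-1) ^+ n * Ubeta u v r theta) (Lbeta u v r (theta - pi))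
  else
    mx22 (Lbeta u v r theta) ((-1) ^+ n * Ubeta u v r (theta + pi))
         ((-1) ^+ n * Ubeta u v r theta) (Lbeta u v r (theta + pi)).

Definition etaL (R : realType) (beta : R) (n : nat) (s : R) : Cplx R :=
  2 * 'i%C * (-1) ^+ n.+1
  * (expR (- (`|s| `^ beta * sin (pi * beta / 2)))
     * sin (`|s| `^ beta * cos (pi * beta / 2)) * \1_(`[0, +oo[) s)%:C.

Definition jumpL (R : realType) (beta : R) (n : nat) (s : R) : 'M[Cplx R]_2 :=
  mx22 1 (- etaL beta n s) (etaL beta n (- s)) 1.

Definition epsbeta (R : realType) (beta : R) (s : Cplx R) : R :=
  if 2^-1 < beta then 1
  else if beta == 2^-1 then ln (normc s)
  else normc s `^ (beta - 2^-1).

Definition upper_half (R : realType) : set (Cplx R) := [set s | 0 < complex.Im s].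
Definition lower_half (R : realType) : set (Cplx R) := [set s | complex.Im s < 0].
Definition nonreal (R : realType) : set (Cplx R) := [set s | complex.Im s != 0].

(* Neighbourhoods of the point at infinity of the complex plane. *)
Definition Cinfty_nbhs (R : realType) : set_system (Cplx R) :=
  [set A | exists M : R, forall s, M < normc s -> A s].
Arguments Cinfty_nbhs R : clear implicits.
Arguments upper_half R : clear implicits.
Arguments lower_half R : clear implicits.
Arguments nonreal R : clear implicits.

(* Main.v *)
(* Write S for the Stieltjes transform of the density K u on ]0, +oo[, so that
   u = 1 + S on ]0, +oo[.  The function w |-> 1 + S(e^w) is holomorphic on
   |Im w| < pi and agrees with the entire function w |-> u(e^w) on R, hence, by
   Cauchy's theorem (Goursat) and a Gaussian peaked at the point, on the whole
   strip.  The entries of L are thus explicit combinations of S(s) and S(-s), for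
   u and for v (whose kernel is -K).
   The jump only involves the continuations at arguments 0 and +-pi, where it is
   the Plemelj formula u(r e^(-i pi)) - u(r e^(i pi)) = 2 pi i K(r) u(r).
   The growth of S is controlled by B(r) = int |K u| / (t + r): away from the cut
   trivially, and close to the cut because K u is Lipschitz at scale r with
   constant O(1 + B(r)) / r, which again follows from the integral equation.  No
   rotation of the contour is needed.  Near 0, B(r) = O(eps_beta(r)) since
   u - 1 is in L_2 and K(t) = O(t^beta); at infinity, B(r) <= |K u|_1 / r. *)

Require Import Defs.
From mathcomp Require Import all_boot all_order all_algebra.
From mathcomp Require Import complex.
From mathcomp Require Import all_classical all_reals all_analysis.
From mathcomp Require Import measurable_realfun.
From mathcomp Require Import ring lra.
Import Order.TTheory GRing.Theory Num.Theory.
Import numFieldNormedType.Exports.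
Import ComplexField.Normc.
Local Open Scope classical_set_scope.
Local Open Scope complex_scope.
Local Open Scope ring_scope.
Local Notation Re := complex.Re.
Local Notation Im := complex.Im.

(** Off the real axis, [Lmx] evaluates the continuations only at [Arg z] and at [Arg z - pi] (upper
    half plane) or [Arg z + pi] (lower), which is [Arg (- z)]. All of these lie strictly between -pi
    and pi, so the strip is enough, and (1), (3), (4) become statements about S at z and -z. The
    arguments +-pi themselves are not reached by S: there the limits exist because the continuation
    is continuous, and only their difference is computed. Both equations are handled by one
    development over an abstract kernel [k], used with K and with -K, which asks for decay like (1 +
    t)^-2, size t^beta at the origin and a Lipschitz bound at scale a. The obstacle is uniformity:
    (3) and (4) need bounds on S that hold up to the cut, where 1/(t + z) is unbounded and
    estimating the integrand by its absolute value fails. The thresholds of eps_beta come from the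
    L_2 part u - 1: pairing it with K/(t + r) brings in the integral of (t + r)^(2 beta - 2) over
    [0, 1], which is bounded, logarithmic or of order r^(2 beta - 1) according to the position of
    beta relative to 1/2. *)

Ltac complex_ring := apply/eqP; rewrite eq_complex /=; apply/andP; split; apply/eqP; ring.

Set Implicit Arguments.
Unset Strict Implicit.
Unset Printing Implicit Defensive.

(** * Complex differentiability and the exponential *)

Section complex_toolkit.
Context {R : realType}.
Local Notation C := (Cplx R).
Implicit Types (z w h : C) (x y r e d : R) (f g : C -> C).

Lemma normrE z : `|z| = (normc z)%:C.
Proof. by []. Qed.

Lemma normc_ge0 z : 0 <= normc z.
Proof. by case: z => a b /=; exact: sqrtr_ge0. Qed.

Lemma normcD_le z w : normc (z + w) <= normc z + normc w.
Proof. exact: le_normcD. Qed.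

Lemma normc_eq0 z : (normc z == 0) = (z == 0).
Proof. by apply/eqP/eqP => [/eq0_normc//|->]; exact: normc0. Qed.

Lemma normc_gt0 z : (0 < normc z) = (z != 0).
Proof. by rewrite lt_def normc_ge0 andbT normc_eq0. Qed.

Lemma normcBC z w : normc (z - w) = normc (w - z).
Proof. by rewrite -opprB normcN. Qed.

Lemma normc_Cr x : normc (x%:C : C) = `|x|.
Proof. by rewrite /= expr0n /= addr0 sqrtr_sqr. Qed.

Lemma ReB z w : Re (z - w) = Re z - Re w.
Proof. by case: z => ? ?; case: w => ? ?. Qed.

Lemma ImB z w : Im (z - w) = Im z - Im w.
Proof. by case: z => ? ?; case: w => ? ?. Qed.

Lemma ReD z w : Re (z + w) = Re z + Re w.
Proof. by case: z => ? ?; case: w => ? ?. Qed.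

Lemma ImD z w : Im (z + w) = Im z + Im w.
Proof. by case: z => ? ?; case: w => ? ?. Qed.

Lemma normc_sqr z : normc z ^+ 2 = Re z ^+ 2 + Im z ^+ 2.
Proof. by case: z => a b /=; rewrite sqr_sqrtr// addr_ge0// sqr_ge0. Qed.

Lemma Re_le_normc z : `|Re z| <= normc z.
Proof.
by case: z => a b /=; rewrite -sqrtr_sqr ler_wsqrtr// lerDl sqr_ge0.
Qed.

Lemma Im_le_normc z : `|Im z| <= normc z.
Proof.
by case: z => a b /=; rewrite -sqrtr_sqr ler_wsqrtr// lerDr sqr_ge0.
Qed.

Lemma normc_le_ReIm z : normc z <= `|Re z| + `|Im z|.
Proof.
rewrite -(@ler_pXn2r _ 2)// ?nnegrE ?normc_ge0 ?addr_ge0//.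
rewrite normc_sqr sqrrD !real_normK ?num_real//.
by rewrite -addrA lerD2l lerDr mulrn_wge0// mulr_ge0.
Qed.

(** Balls of [Cplx R] have radii in [R[i]]; a positive element there has imaginary part 0, so real
    radii suffice. *)
Lemma nbhsCP z (A : set C) :
  nbhs z A <-> exists2 d, 0 < d & forall w, normc (w - z) < d -> A w.
Proof.
split.
  case/nbhs_ballP => -[d d'] /=; rewrite ltcE /= => /andP[/eqP d'0 d0] zA.
  exists d => // w wz; apply: zA; rewrite -ball_normE /= d'0.
  by rewrite normrE normcBC; move: wz; rewrite -ltcR.
move=> [d d0 zA]; apply/nbhs_ballP; exists d%:C => /=; first by rewrite ltcR.
move=> w; rewrite -ball_normE /= => wz; apply: zA.
by move: wz; rewrite normrE normcBC ltcR.
Qed.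

(** This division-free form admits h = 0 and is the affine approximation that the Goursat estimate
    consumes. *)
Lemma derivableCP f z : derivable f z 1 <-> exists D : C, forall e, 0 < e ->
  exists2 d, 0 < d & forall h, normc h < d ->
    normc (f (z + h) - f z - h * D) <= e * normc h.
Proof.
split.
  move=> df; exists ('D_1 f z) => e e0.
  have : (fun h => h^-1 *: (f (h *: 1 + z) - f z)) @ 0^' --> 'D_1 f z by exact: df.
  move=> /cvgrPdist_le /(_ e%:C); rewrite ltcR => /(_ e0).
  move=> /nbhsCP[d d0 H]; exists d => // h hd.
  have [->|h0] := eqVneq h 0.
    by rewrite addr0 mul0r subr0 subrr normc0 mulr0.
  have := H h; rewrite subr0 => /(_ hd h0).
  rewrite normrE lecR => H1.
  have -> : f (z + h) - f z - h * 'D_1 f z =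
     - (h * ('D_1 f z - h^-1 *: (f (h *: 1 + z) - f z))).
    rewrite mulrBr /GRing.scale/= mulrA divff// mul1r mulr1 [h + z]addrC.
    by rewrite !opprB.
  by rewrite normcN normcM mulrC ler_wpM2r// normc_ge0.
move=> [D HD]; apply/cvg_ex; exists D; apply/cvgrPdist_le => -[e e'].
rewrite ltcE /= => /andP[/eqP-> e0].
have [d d0 H] := HD e e0.
apply/nbhsCP; exists d => // h; rewrite subr0 => hd h0.
rewrite normrE complexr0 lecR.
have -> : D - h^-1 *: (f (h *: 1 + z) - f z) =
   - (h^-1 * (f (z + h) - f z - h * D)).
  rewrite mulrBr /GRing.scale/= mulrA mulVf// mul1r mulr1 [h + z]addrC.
  by rewrite opprB.
rewrite normcN normcM normcV ler_pdivrMl ?normc_gt0// [X in _ <= X]mulrC.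
exact: H.
Qed.

Lemma continuousCP f z : {for z, continuous f} <-> forall e, 0 < e ->
  exists2 d, 0 < d & forall w, normc (w - z) < d -> normc (f w - f z) < e.
Proof.
split.
  move=> cf e e0.
  have /nbhsCP[d d0 H] : nbhs z (f @^-1` [set w | normc (w - f z) < e]).
    by apply: cf; apply/nbhsCP; exists e.
  by exists d.
move=> H A /nbhsCP[e e0 HA]; have [d d0 Hd] := H e e0.
by apply/nbhsCP; exists d => // w /Hd; exact: HA.
Qed.

Lemma cdiff_continuous f z : derivable f z 1 -> {for z, continuous f}.
Proof. by move=> /derivable1_diffP; exact: differentiable_continuous. Qed.

Lemma cdiff_comp f g z : derivable f z 1 -> derivable g (f z) 1 ->
  derivable (g \o f) z 1.
Proof.
by move=> /derivable1_diffP df /derivable1_diffP dg;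
  apply/derivable1_diffP/differentiable_comp.
Qed.

Lemma cdiffM f g z : derivable f z 1 -> derivable g z 1 ->
  derivable (fun w => f w * g w) z 1.
Proof. by move=> df dg; exact: (@derivableM _ _ f g z 1 df dg). Qed.

Lemma cdiffD f g z : derivable f z 1 -> derivable g z 1 ->
  derivable (fun w => f w + g w) z 1.
Proof. exact: derivableD. Qed.

Lemma cdiffB f g z : derivable f z 1 -> derivable g z 1 ->
  derivable (fun w => f w - g w) z 1.
Proof. exact: derivableB. Qed.

Lemma cdiffN f z : derivable f z 1 -> derivable (fun w => - f w) z 1.
Proof. exact: derivableN. Qed.

Lemma cdiff_cst z w : derivable (fun=> w : C) z 1.
Proof. exact: derivable_cst. Qed.

Lemma cdiff_id z : derivable (fun w : C => w) z 1.
Proof. exact: derivable_id. Qed.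

Lemma cdiff_near f g z : (\near z, f z = g z) -> derivable f z 1 ->
  derivable g z 1.
Proof.
move=> /nbhsCP[d d0 fg] /derivableCP[D HD]; apply/derivableCP; exists D => e e0.
have [d1 d10 H] := HD e e0; exists (Num.min d d1); first by rewrite lt_min d0.
move=> h; rewrite lt_min => /andP[hd hd1]; rewrite -!fg ?subrr ?normc0//.
  exact: H.
by rewrite addrC addKr.
Qed.

(** The exponential in real coordinates. It leads from the logarithmic chart of the surface back to
    the punctured plane. *)
Definition cexp z : C := (expR (Re z) * cos (Im z)) +i* (expR (Re z) * sin (Im z)).

Lemma cexpD z w : cexp (z + w) = cexp z * cexp w.
Proof.
case: z w => a b [c d]; rewrite /cexp /= expRD cosD sinD.
by apply/eqP; rewrite eq_complex /=; apply/andP; split; apply/eqP; ring.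
Qed.

Lemma normc_cexp z : normc (cexp z) = expR (Re z).
Proof.
rewrite /cexp /= !exprMn -mulrDr cos2Dsin2 mulr1 sqrtr_sqr ger0_norm//.
Qed.

Lemma derivable1_approx (p : R -> R) x (D : R) : is_derive x 1 p D ->
  forall e, 0 < e -> exists2 d, 0 < d & forall a, `|a| < d ->
    `|p (x + a) - p x - a * D| <= e * `|a|.
Proof.
move=> [dp pD] e e0.
have /cvgrPdist_le /(_ e e0) : (fun a : R => a^-1 *: (p (a *: (1 : R) + x) - p x)) @ 0^' --> D.
  by rewrite -pD; exact: dp.
move=> [d /= d0 H]; exists d => // a ad.
have [->|a0] := eqVneq a 0.
  by rewrite addr0 subrr mul0r subr0 normr0 mulr0.
have := H a; rewrite /= sub0r normrN => /(_ ad a0) {}H.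
have -> : p (x + a) - p x - a * D =
     - (a * (D - a^-1 *: (p (a *: (1 : R) + x) - p x))).
  rewrite mulrBr /GRing.scale/= mulrA divff// mul1r mulr1 [a + x]addrC.
  by rewrite !opprB.
by rewrite normrN normrM mulrC ler_wpM2r.
Qed.

(** By [cexpD] only the behaviour at 0 matters, where exp h - 1 - h reduces to the real first-order
    expansions of exp, cos and sin. *)
Lemma derivable_cexp z : derivable cexp z 1.
Proof.
apply/derivableCP; exists (cexp z) => e e0.
have n0 : 0 < expR (Re z) by exact: expR_gt0.
(* The 7 counts the terms, each at most [e1 * normc h], into which exp h - 1 - h is cut below: three
   in the real part, four in the imaginary part. *)
pose e1 : R := e / (7 * expR (Re z)).
have e10 : 0 < e1 by rewrite divr_gt0// mulr_gt0.
have [d1 d10 H1] := derivable1_approx (is_derive_expR 0) e10.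
have [d2 d20 H2] := derivable1_approx (is_derive_cos 0) e10.
have [d3 d30 H3] := derivable1_approx (is_derive_sin 0) e10.
exists (Num.min (Num.min d1 d2) (Num.min d3 (Num.min 1 e1))).
  by rewrite !lt_min d10 d20 d30 ltr01.
move=> h; rewrite !lt_min => /andP[/andP[hd1 hd2] /and3P[hd3 h1 he1]].
have ah := Re_le_normc h; have bh := Im_le_normc h.
have := H1 _ (le_lt_trans ah hd1); have := H2 _ (le_lt_trans bh hd2).
have := H3 _ (le_lt_trans bh hd3).
rewrite !add0r expR0 cos0 sin0 !mulr1 !subr0 oppr0 mulr0 subr0.
have -> : cexp (z + h) - cexp z - h * cexp z = cexp z * (cexp h - 1 - h).
  by rewrite cexpD; ring.
rewrite normcM normc_cexp.
move=> Hs Hc He.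
suff : normc (cexp h - 1 - h) <= 7 * e1 * normc h.
  have -> : e * normc h = expR (Re z) * (7 * e1 * normc h).
    by rewrite /e1; field; rewrite gt_eqF.
  by move=> ?; rewrite ler_pM2l.
apply: (le_trans (normc_le_ReIm _)); rewrite !ReB !ImB /= subr0.
move: (Re h) (Im h) (normc h) (normc_ge0 h) h1 he1 Hs Hc He ah bh {hd1 hd2 hd3}.
move=> a b N N0 h1 he1.
set A := expR a - 1 - a; set B := cos b - 1; set D := sin b - b => Hs Hc He ah bh.
have -> : expR a * cos b - 1 - a = A * cos b + (1 + a) * B by rewrite /A /B; ring.
have -> : expR a * sin b - b = A * sin b + (1 + a) * D + a * b.
  by rewrite /A /D; ring.
have bnd (X Y : R) : `|X| <= e1 * N -> `|Y| <= 1 -> `|X * Y| <= e1 * N.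
  by move=> hX hY; rewrite normrM -[leRHS]mulr1 ler_pM.
have hA : `|A| <= e1 * N by apply: le_trans He _; rewrite ler_pM2l.
have hB : `|B| <= e1 * N by apply: le_trans Hc _; rewrite ler_pM2l.
have hD : `|D| <= e1 * N by apply: le_trans Hs _; rewrite ler_pM2l.
have c1 : `|cos b| <= 1 by rewrite ler_norml cos_geN1 cos_le1.
have s1 : `|sin b| <= 1 by rewrite ler_norml sin_geN1 sin_le1.
have a1 : `|a| <= 1 by apply: le_trans ah _; exact: ltW.
have hab : `|a * b| <= e1 * N.
  by rewrite normrM ler_pM// (le_trans ah)// ltW.
have h1A := bnd _ _ hA c1; have h2A := bnd _ _ hA s1.
have h1B := bnd _ _ hB a1; have h1D := bnd _ _ hD a1.
have -> : (1 + a) * B = B + B * a by ring.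
have -> : (1 + a) * D = D + D * a by ring.
have -> : 7 * e1 * N = (e1 * N + (e1 * N + e1 * N)) + (e1 * N + (e1 * N + e1 * N) + e1 * N).
  by ring.
apply: lerD.
  by apply: le_trans (ler_normD _ _) (lerD _ (le_trans (ler_normD _ _) (lerD _ _))).
apply: le_trans (ler_normD _ _) (lerD _ _) => //.
by apply: le_trans (ler_normD _ _) (lerD _ (le_trans (ler_normD _ _) (lerD _ _))).
Qed.

End complex_toolkit.

(** * Integrals of complex-valued functions *)

Section complex_integral.
Context {R : realType}.
Local Notation C := (Cplx R).
Local Notation mu := (@lebesgue_measure R).
Implicit Types (D : set R) (f g : R -> C) (p q : R -> R) (z w c : C).

Definition Cmeasurable D f :=
  measurable_fun D (fun t => Re (f t)) /\ measurable_fun D (fun t => Im (f t)).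

Definition Cintegrable D f :=
  mu.-integrable D (EFin \o (fun t => Re (f t))) /\
  mu.-integrable D (EFin \o (fun t => Im (f t))).

Lemma CmeasurableD D f g : Cmeasurable D f -> Cmeasurable D g ->
  Cmeasurable D (fun t => f t + g t).
Proof.
move=> [f1 f2] [g1 g2]; split.
  by under eq_fun do rewrite raddfD/=; exact: measurable_funD.
by under eq_fun do rewrite raddfD/=; exact: measurable_funD.
Qed.

Lemma CmeasurableM D f g : Cmeasurable D f -> Cmeasurable D g ->
  Cmeasurable D (fun t => f t * g t).
Proof.
have RM (z w : C) : Re (z * w) = Re z * Re w - Im z * Im w.
  by case: z => ? ?; case: w.
have IM (z w : C) : Im (z * w) = Re z * Im w + Im z * Re w.
  by case: z => ? ?; case: w.
move=> [f1 f2] [g1 g2]; split.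
  by under eq_fun do rewrite RM; apply: measurable_funB; exact: measurable_funM.
by under eq_fun do rewrite IM; apply: measurable_funD; exact: measurable_funM.
Qed.

Lemma Cmeasurable_cst D c : Cmeasurable D (fun=> c).
Proof. by split; exact: measurable_cst. Qed.

Lemma Cmeasurable_real D p : measurable_fun D p ->
  Cmeasurable D (fun t => (p t)%:C).
Proof. by move=> mp; split => //=; exact: measurable_cst. Qed.

Lemma CmeasurableV D f : Cmeasurable D f -> Cmeasurable D (fun t => (f t)^-1).
Proof.
move=> [f1 f2].
have mV : measurable_fun D (fun t => (Re (f t) ^+ 2 + Im (f t) ^+ 2)^-1).
  have -> : (fun t => (Re (f t) ^+ 2 + Im (f t) ^+ 2)^-1) =
     (fun t => (Re (f t) ^+ 2 + Im (f t) ^+ 2) `^ (-1)).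
    by apply/funext => t; rewrite powR_inv1// addr_ge0 ?sqr_ge0.
  apply: (measurableT_comp (measurable_powR _)).
  by apply: measurable_funD; exact: measurable_funX.
have -> : (fun t => (f t)^-1) = (fun t => ((Re (f t) ^+ 2 + Im (f t) ^+ 2)^-1)%:C
     * ((Re (f t)) -i* Im (f t))).
  apply/funext => t; case: (f t) => a b /=.
  by apply/eqP; rewrite eq_complex /= !mul0r subr0 addr0 ![_ * _^-1]mulrC mulrN !eqxx.
apply: CmeasurableM; first exact: Cmeasurable_real.
by split => //=; exact: measurable_funN.
Qed.

Lemma measurable_normc D f : Cmeasurable D f -> measurable_fun D (fun t => normc (f t)).
Proof.
move=> [f1 f2].
have -> : (fun t => normc (f t)) = (fun t => (Re (f t) ^+ 2 + Im (f t) ^+ 2) `^ (2^-1)).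
  apply/funext => t /=; rewrite powR12_sqrt ?addr_ge0 ?sqr_ge0//.
  by case: (f t).
apply: (measurableT_comp (measurable_powR _)).
by apply: measurable_funD; exact: measurable_funX.
Qed.

Lemma Cintegrable_measurable D f : Cintegrable D f -> Cmeasurable D f.
Proof.
by move=> [/measurable_int/measurable_EFinP f1 /measurable_int/measurable_EFinP f2].
Qed.

Lemma le_integrableR D p q : measurable D -> measurable_fun D p ->
  (forall t, D t -> `|p t| <= q t) -> mu.-integrable D (EFin \o q) ->
  mu.-integrable D (EFin \o p).
Proof.
move=> mD mp pq iq; apply: le_integrable iq => //.
  exact/measurable_EFinP.
by move=> t Dt; rewrite /= lee_fin (le_trans (pq _ Dt))//; exact: ler_norm.
Qed.

Lemma integrableDR D p q : measurable D -> mu.-integrable D (EFin \o p) ->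
  mu.-integrable D (EFin \o q) -> mu.-integrable D (EFin \o (fun t => p t + q t)).
Proof.
by move=> mD ip iq; exact: (@integrableD _ _ _ mu D mD (EFin \o p) (EFin \o q)).
Qed.

Lemma integrableZR D p (k : R) : measurable D -> mu.-integrable D (EFin \o p) ->
  mu.-integrable D (EFin \o (fun t => k * p t)).
Proof.
by move=> mD ip; exact: (@integrableZl _ _ _ mu D mD k (EFin \o p)).
Qed.

Lemma integrable_normR D p : mu.-integrable D (EFin \o p) ->
  mu.-integrable D (EFin \o (fun t => `|p t|)).
Proof. by move=> ip; exact: integrable_norm. Qed.

Lemma Cintegrable_le D f p : measurable D -> Cmeasurable D f ->
  (forall t, D t -> normc (f t) <= p t) -> mu.-integrable D (EFin \o p) ->
  Cintegrable D f.
Proof.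
move=> mD [f1 f2] fp ip; split; apply: le_integrableR ip => // t Dt;
  apply: le_trans (fp _ Dt); [exact: Re_le_normc|exact: Im_le_normc].
Qed.

Lemma integrable_normc D f : measurable D -> Cintegrable D f ->
  mu.-integrable D (EFin \o (fun t => normc (f t))).
Proof.
move=> mD fi; have [f1 f2] := fi.
have := integrableDR mD (integrable_normR f1) (integrable_normR f2).
apply: le_integrableR => //.
  by apply: measurable_normc; exact: Cintegrable_measurable.
by move=> t Dt /=; rewrite ger0_norm ?normc_ge0//; exact: normc_le_ReIm.
Qed.

Lemma CintegralD D f g : measurable D -> Cintegrable D f -> Cintegrable D g ->
  Cintegral D (fun t => f t + g t) = Cintegral D f + Cintegral D g.
Proof.
move=> mD [f1 f2] [g1 g2]; rewrite /Cintegral.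
under eq_Rintegral do rewrite raddfD/=.
under [X in _ +i* X]eq_Rintegral do rewrite raddfD/=.
by rewrite !RintegralD.
Qed.

Lemma CintegrableD D f g : measurable D -> Cintegrable D f -> Cintegrable D g ->
  Cintegrable D (fun t => f t + g t).
Proof.
move=> mD fi gi.
have := integrableDR mD (integrable_normc mD fi) (integrable_normc mD gi).
apply: Cintegrable_le => //.
  by apply: CmeasurableD; exact: Cintegrable_measurable.
by move=> t _; exact: le_normcD.
Qed.

Lemma CintegrableZl D f c : measurable D -> Cintegrable D f ->
  Cintegrable D (fun t => c * f t).
Proof.
move=> mD fi; have := integrableZR (normc c) mD (integrable_normc mD fi).
apply: Cintegrable_le => //.
  by apply: CmeasurableM; [exact: Cmeasurable_cst|exact: Cintegrable_measurable].
by move=> t _; rewrite normcM.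
Qed.

Lemma CintegralZl D f c : measurable D -> Cintegrable D f ->
  Cintegral D (fun t => c * f t) = c * Cintegral D f.
Proof.
move=> mD [f1 f2]; case: c => a b; rewrite /Cintegral.
under eq_Rintegral.
  move=> t _; rewrite (_ : Re _ = a * Re (f t) - b * Im (f t)); last by case: (f t).
  over.
under [X in _ +i* X]eq_Rintegral.
  move=> t _; rewrite (_ : Im _ = a * Im (f t) + b * Re (f t)); last by case: (f t).
  over.
rewrite RintegralB//; [|exact: integrableZR|exact: integrableZR].
rewrite RintegralD//; [|exact: integrableZR|exact: integrableZR].
by rewrite !RintegralZl.
Qed.

Lemma eq_Cintegral D f g : {in D, f =1 g} -> Cintegral D f = Cintegral D g.
Proof.
by move=> fg; rewrite /Cintegral; congr (_ +i* _);
  apply: eq_Rintegral => t /fg ->.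
Qed.

Lemma eq_Cintegrable D f g : measurable D -> {in D, f =1 g} ->
  Cintegrable D f -> Cintegrable D g.
Proof.
by move=> mD fg [f1 f2]; split; [apply: eq_integrable f1|apply: eq_integrable f2];
  rewrite // => t /fg /= ->.
Qed.

Lemma CintegralB D f g : measurable D -> Cintegrable D f -> Cintegrable D g ->
  Cintegral D (fun t => f t - g t) = Cintegral D f - Cintegral D g.
Proof.
move=> mD fi gi.
rewrite (@eq_Cintegral _ _ (fun t => f t + (-1) * g t)); last first.
  by move=> t _; rewrite mulN1r.
by rewrite CintegralD// ?CintegralZl ?mulN1r//; exact: CintegrableZl.
Qed.

Lemma CintegrableB D f g : measurable D -> Cintegrable D f -> Cintegrable D g ->
  Cintegrable D (fun t => f t - g t).
Proof.
move=> mD fi gi.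
apply: (@eq_Cintegrable _ (fun t => f t + (-1) * g t)) => //.
  by move=> t _; rewrite mulN1r.
by apply: CintegrableD => //; exact: CintegrableZl.
Qed.

(* The factor 2 comes from bounding the real and imaginary parts separately. *)
Lemma normc_Cintegral D f p : measurable D -> Cmeasurable D f ->
  (forall t, D t -> normc (f t) <= p t) -> mu.-integrable D (EFin \o p) ->
  normc (Cintegral D f) <= 2 * \int[mu]_(t in D) p t.
Proof.
move=> mD mf fp ip; have [f1 f2] := Cintegrable_le mD mf fp ip.
apply: (le_trans (normc_le_ReIm _)); rewrite /= mulr2n mulrDl mul1r.
have le1 q : mu.-integrable D (EFin \o q) -> (forall t, D t -> `|q t| <= p t) ->
    `|\int[mu]_(t in D) q t| <= \int[mu]_(t in D) p t.
  move=> iq qp; apply: (le_trans (@le_normr_Rintegral _ _ _ mu D q mD iq)).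
  by apply: le_Rintegral => //; exact: integrable_normR.
by apply: lerD; apply: le1 => // t Dt; apply: le_trans (fp _ Dt);
  [exact: Re_le_normc|exact: Im_le_normc].
Qed.

End complex_integral.

(** * The Stieltjes transform *)

Section stieltjes.
Context {R : realType}.
Local Notation C := (Cplx R).
Local Notation mu := (@lebesgue_measure R).
Implicit Types (f : R -> C) (p q : R -> R) (z w c : C).

Definition stieltjes f z : C := Cintegral `]0, +oo[ (fun t => f t / (t%:C + z)).

(* The plane slit along ]-oo, 0]. *)
Definition offcut z := 0 < Re z \/ Im z != 0.

Lemma measurable_itv0y : measurable (`]0, +oo[%classic : set R).
Proof. exact: measurable_itv. Qed.

Lemma itv0yP (t : R) : `]0, +oo[%classic t <-> 0 < t.
Proof. by rewrite /= in_itv /= andbT. Qed.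

Lemma offcut_dist z : offcut z ->
  exists2 d, 0 < d & forall t : R, 0 < t -> d <= normc (t%:C + z).
Proof.
case=> [z0|z0].
  exists (Re z) => // t t0; apply: le_trans (Re_le_normc _).
  by rewrite raddfD /=; apply: le_trans (ler_norm _); lra.
exists `|Im z|; first by rewrite normr_gt0.
move=> t t0; apply: le_trans (Im_le_normc _).
by rewrite raddfD /= add0r.
Qed.

Lemma Cmeasurable_inv_shift (D : set R) z :
  Cmeasurable D (fun t => (t%:C + z)^-1).
Proof.
apply: CmeasurableV; apply: CmeasurableD; last exact: Cmeasurable_cst.
by apply: (@Cmeasurable_real _ _ id); exact: measurable_id.
Qed.

Lemma Cmeasurable_stieltjes f z : Cmeasurable `]0, +oo[ f ->
  Cmeasurable `]0, +oo[ (fun t => f t / (t%:C + z)).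
Proof.
by move=> mf; apply: CmeasurableM => //; exact: Cmeasurable_inv_shift.
Qed.

Lemma normc_divr (z w : C) : normc (z / w) = normc z / normc w.
Proof. by rewrite normcM normcV. Qed.

Lemma Cintegrable_stieltjes f z : Cintegrable `]0, +oo[ f -> offcut z ->
  Cintegrable `]0, +oo[ (fun t => f t / (t%:C + z)).
Proof.
move=> fi /offcut_dist[d d0 zd].
have := integrableZR d^-1 measurable_itv0y (integrable_normc measurable_itv0y fi).
apply: Cintegrable_le => //.
  by apply: Cmeasurable_stieltjes; exact: Cintegrable_measurable.
move=> t /itv0yP t0; rewrite normc_divr mulrC ler_wpM2r ?normc_ge0//.
by rewrite lef_pV2 ?posrE ?zd// (lt_le_trans d0)// zd.
Qed.

(** Differentiation under the integral sign with an explicit remainder: 1/(t+z+h) - 1/(t+z) +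
    h/(t+z)^2 = h^2 / ((t+z+h)(t+z)^2), where the denominator has modulus at least [d / 2 * d ^+ 2]
    once |h| < d/2. *)
Lemma derivable_stieltjes f z : Cintegrable `]0, +oo[ f -> offcut z ->
  derivable (stieltjes f) z 1.
Proof.
move=> fi zc; have [d d0 zd] := offcut_dist zc.
have nfi := integrable_normc measurable_itv0y fi.
have zn0 t : 0 < t -> t%:C + z != 0.
  by move=> t0; rewrite -normc_gt0 (lt_le_trans d0)// zd.
have d3 : 0 < d / 2 * d ^+ 2 by rewrite !mulr_gt0// exprn_gt0.
have gi : Cintegrable `]0, +oo[ (fun t => f t / (t%:C + z) ^+ 2).
  have := integrableZR (d ^+ 2)^-1 measurable_itv0y nfi.
  apply: Cintegrable_le => //.
    rewrite (_ : (fun t => _) = (fun t => f t * ((t%:C + z)^-1 * (t%:C + z)^-1))).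
      apply: CmeasurableM; first exact: Cintegrable_measurable.
      by apply: CmeasurableM; exact: Cmeasurable_inv_shift.
    by apply/funext => t; rewrite -invfM -expr2.
  move=> t /itv0yP t0; rewrite normc_divr mulrC ler_wpM2r ?normc_ge0// expr2 normcM.
  have nd : 0 < normc (t%:C + z) by rewrite (lt_le_trans d0)// zd.
  by rewrite lef_pV2 ?posrE ?mulr_gt0// -?expr2 ?exprn_gt0// ler_pM ?zd ?ltW.
apply/derivableCP; exists (- Cintegral `]0, +oo[ (fun t => f t / (t%:C + z) ^+ 2)) => e e0.
pose F := \int[mu]_(t in `]0, +oo[) normc (f t).
have F0 : 0 <= F by apply: Rintegral_ge0 => t _; exact: normc_ge0.
pose K := 2 * ((d / 2 * d ^+ 2)^-1 * F).
have K0 : 0 <= K by rewrite !mulr_ge0// invr_ge0 ltW.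
exists (Num.min (d / 2) (e / (K + 1))).
  by rewrite lt_min !divr_gt0// ltr_wpDl.
move=> h; rewrite lt_min => /andP[hd he].
have hn t : 0 < t -> d / 2 <= normc (t%:C + (z + h)).
  move=> t0; have := zd _ t0.
  have -> : t%:C + z = (t%:C + (z + h)) + (- h) by rewrite addrA addrK.
  by move=> /le_trans/(_ (le_normcD _ _)); rewrite normcN; move: hd; lra.
have zhn0 t : 0 < t -> t%:C + (z + h) != 0.
  by move=> t0; rewrite -normc_gt0 (lt_le_trans _ (hn _ t0))// divr_gt0.
have zhc : Cintegrable `]0, +oo[ (fun t => f t / (t%:C + (z + h))).
  have := integrableZR (d / 2)^-1 measurable_itv0y nfi.
  apply: Cintegrable_le => //.
    by apply: Cmeasurable_stieltjes; exact: Cintegrable_measurable.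
  move=> t /itv0yP t0; rewrite normc_divr mulrC ler_wpM2r ?normc_ge0//.
  by rewrite lef_pV2 ?posrE ?hn ?divr_gt0// (lt_le_trans _ (hn _ t0))// divr_gt0.
have zi := Cintegrable_stieltjes fi zc.
rewrite mulrN opprK -CintegralZl//.
rewrite -CintegralB//.
rewrite -CintegralD//; [|by apply: CintegrableB|by apply: CintegrableZl].
rewrite (@eq_Cintegral _ _ _ (fun t => h ^+ 2 * (f t / ((t%:C + (z + h)) * (t%:C + z) ^+ 2)))); last first.
  move=> t /set_mem/itv0yP t0; field.
  by rewrite zn0// zhn0.
apply: (@le_trans _ _ (K * normc h ^+ 2)).
  have -> : K * normc h ^+ 2 = 2 * (\int[mu]_(t in `]0, +oo[)
      ((normc h ^+ 2 * (d / 2 * d ^+ 2)^-1) * normc (f t))).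
    rewrite RintegralZl//.
    by rewrite /K -/F; ring.
  apply: normc_Cintegral => //.
  - apply: CmeasurableM; first exact: Cmeasurable_cst.
    apply: CmeasurableM; first exact: Cintegrable_measurable.
    rewrite (_ : (fun t => _) = (fun t => (t%:C + (z + h))^-1 * ((t%:C + z)^-1 * (t%:C + z)^-1))).
      by do 2!(apply: CmeasurableM; first exact: Cmeasurable_inv_shift);
        exact: Cmeasurable_inv_shift.
    by apply/funext => t; rewrite -!invfM -expr2.
  - move=> t /itv0yP t0.
    rewrite expr2 !normcM -expr2 normcV normcM expr2 normcM -expr2 mulrCA mulrC.
    rewrite ler_wpM2r ?normc_ge0// ler_wpM2l ?exprn_ge0 ?normc_ge0//.
    have nd : 0 < normc (t%:C + z) by rewrite (lt_le_trans d0)// zd.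
    have nd2 : 0 < normc (t%:C + (z + h)).
      by rewrite (lt_le_trans _ (hn _ t0))// divr_gt0.
    rewrite lef_pV2 ?posrE// ?mulr_gt0// -?expr2.
    apply: ler_pM; [by rewrite ltW ?divr_gt0|by rewrite ltW ?exprn_gt0|exact: hn|].
    by rewrite ler_pXn2r ?nnegrE ?zd ?ltW.
  - exact: integrableZR.
rewrite expr2 mulrA ler_wpM2r ?normc_ge0//.
move: he; rewrite ltr_pdivlMr ?ltr_wpDl// => he.
by rewrite mulrC; apply/ltW/(le_lt_trans _ he); rewrite ler_wpM2l ?normc_ge0// lerDl.
Qed.

End stieltjes.

(** * Cauchy's theorem on rectangles *)

Section goursat.
Context {R : realType}.
Local Notation C := (Cplx R).
Local Notation mu := (@lebesgue_measure R).
Implicit Types (a b c d x y e : R) (g : R -> C) (h : C -> C) (w : C).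

(** Spelled out with real epsilons because the parameter is real and the value complex. It is
    two-sided, also at the end points of the segment in [pcontinuous]. *)
Definition pcontinuous_at g x := forall e, 0 < e ->
  exists2 d, 0 < d & forall y, `|y - x| < d -> normc (g y - g x) < e.

Definition pcontinuous a b g := forall x, a <= x <= b -> pcontinuous_at g x.

Lemma pcontinuous_real (p : C -> R) g x :
  (forall z w : C, `|p z - p w| <= normc (z - w)) ->
  pcontinuous_at g x -> {for x, continuous (fun t => p (g t))}.
Proof.
move=> pl cg; apply/cvgrPdist_lt => e e0; have [d d0 H] := cg e e0.
exists d => //= y xy; rewrite distrC; apply: le_lt_trans (pl _ _) _.
by apply: H; rewrite distrC.
Qed.

Lemma Re_lip (z w : C) : `|Re z - Re w| <= normc (z - w).
Proof. by rewrite -ReB; exact: Re_le_normc. Qed.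

Lemma Im_lip (z w : C) : `|Im z - Im w| <= normc (z - w).
Proof. by rewrite -ImB; exact: Im_le_normc. Qed.

Lemma normc_lip (z w : C) : `|normc z - normc w| <= normc (z - w).
Proof.
have H (u v : C) : normc u - normc v <= normc (u - v).
  by rewrite lerBlDr -{1}(subrK v u); exact: le_normcD.
by rewrite ler_norml H andbT lerNl opprB normcBC H.
Qed.

Lemma pcontinuous_within (p : C -> R) a b g :
  (forall z w : C, `|p z - p w| <= normc (z - w)) ->
  pcontinuous a b g -> {within `[a, b], continuous (fun t => p (g t))}.
Proof.
move=> pl cg; apply: continuous_in_subspaceT => x /set_mem /=.
by rewrite in_itv /= => /cg; exact: pcontinuous_real.
Qed.

Lemma pcontinuous_Cintegrable a b g : pcontinuous a b g ->
  Cintegrable `[a, b] g.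
Proof.
move=> cg; split; apply: continuous_compact_integrable.
- exact: segment_compact.
- exact: (pcontinuous_within Re_lip cg).
- exact: segment_compact.
- exact: (pcontinuous_within Im_lip cg).
Qed.

Lemma pcontinuous_bounded a b g : a <= b -> pcontinuous a b g ->
  exists M, forall x, a <= x <= b -> normc (g x) <= M.
Proof.
move=> ab /(pcontinuous_within normc_lip) /(EVT_max ab)[c _ H].
by exists (normc (g c)) => x xab; apply: H; rewrite in_itv.
Qed.

Lemma pcontinuousB a b g1 g2 : pcontinuous a b g1 -> pcontinuous a b g2 ->
  pcontinuous a b (fun t => g1 t - g2 t).
Proof.
move=> c1 c2 x xab e e0; have e20 : 0 < e / 2 by rewrite divr_gt0.
have [d1 d10 H1] := c1 x xab _ e20; have [d2 d20 H2] := c2 x xab _ e20.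
exists (Num.min d1 d2); first by rewrite lt_min d10.
move=> y; rewrite lt_min => /andP[/H1 h1 /H2 h2].
have -> : g1 y - g2 y - (g1 x - g2 x) = (g1 y - g1 x) + - (g2 y - g2 x) by ring.
by apply: le_lt_trans (le_normcD _ _) _; rewrite normcN; move: h1 h2; lra.
Qed.

Lemma Rintegral_itv_split (p : R -> R) a m b : a <= m <= b ->
  mu.-integrable `[a, b] (EFin \o p) ->
  \int[mu]_(t in `[a, b]) p t =
  \int[mu]_(t in `[a, m]) p t + \int[mu]_(t in `[m, b]) p t.
Proof.
move=> /andP[am mb] ip.
have := @Rintegral_itvB _ p (BLeft a) (BRight b) m ip.
rewrite !bnd_simp => /(_ am mb).
rewrite Rintegral_itv_obnd_cbnd; first by move=> /eqP; rewrite subr_eq addrC => /eqP.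
apply: integrableS ip => // t /=; rewrite !in_itv /= => /andP[mt ->].
by rewrite andbT (le_trans am)// ltW.
Qed.

Lemma Cintegral_itv_split g a m b : a <= m <= b -> Cintegrable `[a, b] g ->
  Cintegral `[a, b] g = Cintegral `[a, m] g + Cintegral `[m, b] g.
Proof.
by move=> amb [g1 g2]; rewrite /Cintegral (Rintegral_itv_split amb g1)
  (Rintegral_itv_split amb g2).
Qed.

Lemma Rintegral_itv_cst a b (k : R) : a <= b ->
  \int[mu]_(t in `[a, b]) k = k * (b - a).
Proof.
move=> ab; rewrite Rintegral_cst//= lebesgue_measure_itv /= lte_fin.
by case: ltgtP ab => // -> _; rewrite /= subrr mulr0 ?mulr0.
Qed.

Lemma integrable_itv_cst a b (k : R) : mu.-integrable `[a, b] (EFin \o (fun=> k)).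
Proof.
apply: continuous_compact_integrable; first exact: segment_compact.
by apply: continuous_subspaceT => x; exact: cvg_cst.
Qed.

Lemma normc_Cintegral_itv g a b (M : R) : a <= b -> Cintegrable `[a, b] g ->
  (forall x, a <= x <= b -> normc (g x) <= M) ->
  normc (Cintegral `[a, b] g) <= 2 * (M * (b - a)).
Proof.
move=> ab gi gM; rewrite -Rintegral_itv_cst//.
apply: normc_Cintegral => //; first exact: Cintegrable_measurable.
exact: integrable_itv_cst.
Qed.

(** The counterclockwise boundary integral, with parallel sides paired: a constant h cancels inside
    each integrand, and an affine h leaves a constant there. *)
Definition rectint h a b c d : C :=
  Cintegral `[a, b] (fun x => h (x +i* c) - h (x +i* d)) +
  'i%C * Cintegral `[c, d] (fun y => h (b +i* y) - h (a +i* y)).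

Definition on_rect a b c d (P : C -> Prop) :=
  forall x y, a <= x <= b -> c <= y <= d -> P (x +i* y).

Lemma pcontinuous_horiz h a b y :
  (forall x, a <= x <= b -> {for (x +i* y : C), continuous h}) ->
  pcontinuous a b (fun x => h (x +i* y)).
Proof.
move=> H x /H /continuousCP ch e /ch[d d0 Hd]; exists d => // t tx; apply: Hd.
have -> : (t +i* y : C) - (x +i* y) = (t - x)%:C.
  complex_ring.
by rewrite normc_Cr.
Qed.

Lemma pcontinuous_vert h c d x :
  (forall y, c <= y <= d -> {for (x +i* y : C), continuous h}) ->
  pcontinuous c d (fun y => h (x +i* y)).
Proof.
move=> H y /H /continuousCP ch e /ch[r r0 Hr]; exists r => // t ty; apply: Hr.
have -> : (x +i* t : C) - (x +i* y) = 'i%C * (t - y)%:C.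
  complex_ring.
by rewrite normcM normc_Cr /= expr0n expr1n add0r sqrtr1 mul1r.
Qed.

Lemma rectint_integrable h a b c d : a <= b -> c <= d ->
  on_rect a b c d (fun w => {for w, continuous h}) ->
  (forall y, c <= y <= d -> pcontinuous a b (fun x => h (x +i* y))) /\
  (forall x, a <= x <= b -> pcontinuous c d (fun y => h (x +i* y))).
Proof.
move=> ab cd H; split=> [y cyd|x axb].
  by apply: pcontinuous_horiz => x axb; exact: H.
by apply: pcontinuous_vert => y cyd; exact: H.
Qed.

Lemma rectint_splitl h a m b c d : a <= m <= b -> c <= d ->
  on_rect a b c d (fun w => {for w, continuous h}) ->
  rectint h a b c d = rectint h a m c d + rectint h m b c d.
Proof.
move=> amb cd H; have /andP[am mb] := amb; have ab := le_trans am mb.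
have [H1 H2] := rectint_integrable ab cd H.
have cc : c <= c <= d by rewrite lexx.
have dd : c <= d <= d by rewrite lexx andbT.
have aa : a <= a <= b by rewrite lexx.
have bb : a <= b <= b by rewrite lexx andbT.
rewrite /rectint (Cintegral_itv_split amb); last first.
  by apply: pcontinuous_Cintegrable; apply: pcontinuousB; exact: H1.
rewrite [X in 'i%C * X](_ : _ =
    Cintegral `[c, d] (fun y => h (b +i* y) - h (m +i* y)) +
    Cintegral `[c, d] (fun y => h (m +i* y) - h (a +i* y))); last first.
  rewrite -CintegralD//; last 2 first.
  - by apply: pcontinuous_Cintegrable; apply: pcontinuousB; exact: H2.
  - by apply: pcontinuous_Cintegrable; apply: pcontinuousB; exact: H2.
  by apply: eq_Cintegral => y _; ring.
by ring.
Qed.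

Lemma rectint_splitr h a b c m d : a <= b -> c <= m <= d ->
  on_rect a b c d (fun w => {for w, continuous h}) ->
  rectint h a b c d = rectint h a b c m + rectint h a b m d.
Proof.
move=> ab cmd H; have /andP[cm md] := cmd; have cd := le_trans cm md.
have [H1 H2] := rectint_integrable ab cd H.
have cc : c <= c <= d by rewrite lexx.
have dd : c <= d <= d by rewrite lexx andbT.
have aa : a <= a <= b by rewrite lexx.
have bb : a <= b <= b by rewrite lexx andbT.
rewrite /rectint (Cintegral_itv_split cmd); last first.
  by apply: pcontinuous_Cintegrable; apply: pcontinuousB; exact: H2.
rewrite [X in X + _](_ : _ =
    Cintegral `[a, b] (fun x => h (x +i* c) - h (x +i* m)) +
    Cintegral `[a, b] (fun x => h (x +i* m) - h (x +i* d))); last first.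
  rewrite -CintegralD//; last 2 first.
  - by apply: pcontinuous_Cintegrable; apply: pcontinuousB; exact: H1.
  - by apply: pcontinuous_Cintegrable; apply: pcontinuousB; exact: H1.
  by apply: eq_Cintegral => y _; ring.
by ring.
Qed.

Lemma Cintegral_itv_cst a b (k : C) : a <= b ->
  Cintegral `[a, b] (fun=> k) = (b - a)%:C * k.
Proof.
move=> ab; rewrite /Cintegral !Rintegral_itv_cst//; case: k => k l /=.
complex_ring.
Qed.

(** The affine part al + (w - p) be integrates to 0: the two pairs of sides contribute (b - a)(c -
    d) i be and i (d - c)(b - a) be. Only the error remains. The 4 is 2 for two opposite sides times
    2 from [normc_Cintegral]. *)
Lemma rectint_affine_bound h a b c d (al be p : C) e : a <= b -> c <= d ->
  on_rect a b c d (fun w => {for w, continuous h}) ->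
  a <= Re p <= b -> c <= Im p <= d ->
  on_rect a b c d (fun w => normc (h w - al - (w - p) * be) <= e * normc (w - p)) ->
  0 <= e ->
  normc (rectint h a b c d) <= 4 * e * ((b - a) + (d - c)) ^+ 2.
Proof.
move=> ab cd H pa pc He e0.
have [H1 H2] := rectint_integrable ab cd H.
have cc : c <= c <= d by rewrite lexx.
have dd : c <= d <= d by rewrite lexx andbT.
have aa : a <= a <= b by rewrite lexx.
have bb : a <= b <= b by rewrite lexx andbT.
pose E w := h w - al - (w - p) * be.
set s := (b - a) + (d - c).
have Es : on_rect a b c d (fun w => normc (E w) <= e * s).
  move=> x y xab ycd; apply: le_trans (He _ _ xab ycd) _.
  rewrite ler_wpM2l//; apply: le_trans (normc_le_ReIm _) _.
  move: p pa pc {He E} => [p q] /= /andP[? ?] /andP[? ?].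
  move: xab ycd => /andP[? ?] /andP[? ?].
  by rewrite lerD// ler_norml; apply/andP; split; lra.
have cst_int (u v : R) (z : C) : Cintegrable `[u, v] (fun=> z).
  by split; exact: integrable_itv_cst.
have diff_bound (F G : R -> C) (u v : R) (k : C) : u <= v ->
    pcontinuous u v F -> pcontinuous u v G ->
    (forall t, u <= t <= v -> normc (F t - G t - k) <= 2 * (e * s)) ->
    normc (Cintegral `[u, v] (fun t => F t - G t) - (v - u)%:C * k) <=
      4 * e * s * (v - u).
  move=> uv cF cG FG.
  have FGi : Cintegrable `[u, v] (fun t => F t - G t).
    by apply: pcontinuous_Cintegrable; exact: pcontinuousB.
  rewrite -Cintegral_itv_cst// -CintegralB//.
  have -> : 4 * e * s * (v - u) = 2 * (2 * (e * s) * (v - u)) by ring.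
  by apply: normc_Cintegral_itv => //; exact: CintegrableB.
have K1 := diff_bound _ _ _ _ ((c - d)%:C * 'i%C * be) ab (H1 _ cc) (H1 _ dd).
have K2 := diff_bound _ _ _ _ ((b - a)%:C * be) cd (H2 _ bb) (H2 _ aa).
have -> : rectint h a b c d =
  (Cintegral `[a, b] (fun x => h (x +i* c) - h (x +i* d)) - (b - a)%:C * ((c - d)%:C * 'i%C * be)) +
  'i%C * (Cintegral `[c, d] (fun y => h (b +i* y) - h (a +i* y)) - (d - c)%:C * ((b - a)%:C * be)).
  by rewrite /rectint -(opprB d c) rmorphN /=; ring.
apply: le_trans (le_normcD _ _) _.
rewrite normcM [normc 'i]/= expr0n expr1n add0r sqrtr1 mul1r.
have -> : 4 * e * s ^+ 2 = 4 * e * s * (b - a) + 4 * e * s * (d - c).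
  by rewrite /s; ring.
have twoE (z w : C) : normc z <= e * s -> normc w <= e * s ->
    normc (z - w) <= 2 * (e * s).
  move=> ? ?; apply: le_trans (le_normcD _ _) _.
  by rewrite normcN mulr2n mulrDl mul1r lerD.
apply: lerD.
  apply: K1 => t tab.
  have -> : h (t +i* c) - h (t +i* d) - (c - d)%:C * 'i%C * be =
      E (t +i* c) - E (t +i* d).
    have -> : (c - d)%:C * 'i%C = (t +i* c : C) - (t +i* d).
      complex_ring.
    by rewrite /E; ring.
  by apply: twoE; exact: Es.
apply: K2 => t tcd.
have -> : h (b +i* t) - h (a +i* t) - (b - a)%:C * be =
    E (b +i* t) - E (a +i* t).
  have -> : (b - a)%:C = (b +i* t : C) - (a +i* t).
    complex_ring.
  by rewrite /E; ring.
by apply: twoE; exact: Es.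
Qed.

End goursat.

Arguments normc : simpl never.
Section identity_theorem.
Context {R : realType}.
Local Notation C := (Cplx R).
Local Notation mu := (@lebesgue_measure R).
Implicit Types (a b c d x y e : R) (g : R -> C) (h H : C -> C) (w : C).

(** The supremum of the left ends. Used once for each coordinate of the nested rectangles. *)
Lemma nested_point (a w : R ^nat) : (forall n, a n <= a n.+1) ->
  (forall n, a n.+1 + w n.+1 <= a n + w n) -> (forall n, 0 <= w n) ->
  exists p, forall n, a n <= p <= a n + w n.
Proof.
move=> a_incr aw_decr w0.
have amono m n : (m <= n)%N -> a m <= a n.
  by move=> mn; apply: (homo_leq lexx le_trans) mn; exact: a_incr.
have awmono m n : (m <= n)%N -> a n + w n <= a m + w m.
  move=> mn; apply: (@homo_leq _ (fun n => a n + w n) (fun x y => y <= x)) mn => //.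
  by move=> ? ? ? /[swap]; exact: le_trans.
have aaw m n : a m <= a n + w n.
  have [mn|nm] := leqP m n.
    by apply: le_trans (amono _ _ mn) _; rewrite lerDl.
  by apply: (le_trans _ (awmono _ _ (ltnW nm))); rewrite lerDl.
have sup_a : has_sup (range a).
  by split; [exists (a 0%N), 0%N|exists (a 0%N + w 0%N) => _ [n _ <-]].
exists (sup (range a)) => n; apply/andP; split.
  by apply: sup_upper_bound => //; exists n.
by apply: ge_sup => [|_ [m _ <-] //]; exists (a 0%N), 0%N.
Qed.

(* The squared half-perimeter is used in place of the area: it is also additive
   under the subdivision into quarters. *)
Lemma rectint_quarter h a b c d e : a <= b -> c <= d ->
  on_rect a b c d (fun w => {for w, continuous h}) ->
  e * ((b - a) + (d - c)) ^+ 2 < normc (rectint h a b c d) ->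
  exists i j : bool, let a' := if i then a else (a + b) / 2 in
    let c' := if j then c else (c + d) / 2 in
    e * (((b - a) / 2 + (d - c) / 2)) ^+ 2 <
      normc (rectint h a' (a' + (b - a) / 2) c' (c' + (d - c) / 2)).
Proof.
move=> ab cd hc; set m := (a + b) / 2; set n := (c + d) / 2.
have am : a <= m <= b by rewrite /m; lra.
have cn : c <= n <= d by rewrite /n; lra.
have /andP[? ?] := am; have /andP[? ?] := cn.
rewrite (rectint_splitl am cd hc) !(rectint_splitr _ cn)//; last 2 first.
- move=> x y /andP[? ?] ?; apply: hc => //; lra.
- move=> x y /andP[? ?] ?; apply: hc => //; lra.
have hm : a + (b - a) / 2 = m by rewrite /m; field.
have hm' : m + (b - a) / 2 = b by rewrite /m; field.
have hn : c + (d - c) / 2 = n by rewrite /n; field.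
have hn' : n + (d - c) / 2 = d by rewrite /n; field.
move=> lt_e; apply: contrapT => N.
have K (i j : bool) : normc (rectint h (if i then a else m) ((if i then a else m) + (b - a) / 2)
    (if j then c else n) ((if j then c else n) + (d - c) / 2)) <=
    e * ((b - a) / 2 + (d - c) / 2) ^+ 2.
  by rewrite leNgt; apply/negP => ?; apply: N; exists i, j.
have := K true true; have := K true false.
have := K false true; have := K false false; rewrite /= hm hm' hn hn'.
move: lt_e; set I1 := rectint h a m c n; set I2 := rectint h a m n d.
set I3 := rectint h m b c n; set I4 := rectint h m b n d => lt_e h4 h3 h2 h1.
have := normcD_le (I1 + I2) (I3 + I4); have := normcD_le I1 I2.
have := normcD_le I3 I4.
have E4 : e * (b - a + (d - c)) ^+ 2 = 4 * (e * ((b - a) / 2 + (d - c) / 2) ^+ 2).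
  by field.
move: lt_e; rewrite E4; move: h1 h2 h3 h4; set E := e * _; clear; lra.
Qed.

(** If the integral were not 0, repeated quartering would give nested rectangles whose integrals
    stay above e times the squared half-perimeter, against the smaller quadratic bound that
    differentiability forces at their common point. *)
Lemma goursat h a b c d : a <= b -> c <= d ->
  on_rect a b c d (fun w => derivable h w 1) -> rectint h a b c d = 0.
Proof.
move=> ab cd dh.
have ch : on_rect a b c d (fun w => {for w, continuous h}).
  by move=> x y xab ycd; apply: cdiff_continuous; exact: dh.
apply/eqP; rewrite -normc_eq0 eq_le normc_ge0 andbT; apply/ler_addgt0Pl => e0 e00.
rewrite addr0; have [//|bad0] := leP.
set s := (b - a) + (d - c); have s0 : 0 <= s by rewrite /s; lra.
(* Then e s^2 <= e0 < |integral|, so the initial rectangle is bad; the [+ 1] covers s = 0. *)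
pose e := e0 / (s ^+ 2 + 1).
have e_gt0 : 0 < e by rewrite divr_gt0// ltr_wpDl// sqr_ge0.
pose wd n := (b - a) / 2 ^+ n; pose hd n := (d - c) / 2 ^+ n.
pose P (n : nat) (p : R * R) := [/\ a <= p.1, p.1 + wd n <= b, c <= p.2,
  p.2 + hd n <= d &
  e * (wd n + hd n) ^+ 2 < normc (rectint h p.1 (p.1 + wd n) p.2 (p.2 + hd n))].
have wd0 n : 0 <= wd n by rewrite divr_ge0 ?exprn_ge0// subr_ge0.
have hd0 n : 0 <= hd n by rewrite divr_ge0 ?exprn_ge0// subr_ge0.
have wdS n : wd n.+1 = wd n / 2 by rewrite /wd exprS invfM mulrCA mulrC.
have hdS n : hd n.+1 = hd n / 2 by rewrite /hd exprS invfM mulrCA mulrC.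
have sub n p : P n p -> forall x y, p.1 <= x <= p.1 + wd n ->
    p.2 <= y <= p.2 + hd n -> a <= x <= b /\ c <= y <= d.
  by move=> [? ? ? ? _] x y /andP[? ?] /andP[? ?]; split; apply/andP; split; lra.
have P0 : P 0%N (a, c).
  have E1 : a + wd 0 = b by rewrite /wd expr0; field.
  have E2 : c + hd 0 = d by rewrite /hd expr0; field.
  split => /=; rewrite ?E1 ?E2//; apply: le_lt_trans bad0.
  have -> : wd 0 + hd 0 = s by rewrite /s /wd /hd expr0; field.
  rewrite /e mulrAC ler_pdivrMr ?ltr_wpDl ?sqr_ge0// ler_pM2l//.
  by rewrite lerDl.
pose step n (p q : R * R) := [/\ P n.+1 q, p.1 <= q.1,
  q.1 + wd n.+1 <= p.1 + wd n, p.2 <= q.2 & q.2 + hd n.+1 <= p.2 + hd n].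
have PS n p : P n p -> exists q, step n p q.
  move=> Pn; have [p1 p1' p2 p2' bad] := Pn.
  have [||||i [j]] := @rectint_quarter h p.1 (p.1 + wd n) p.2 (p.2 + hd n) e.
  - by rewrite lerDl.
  - by rewrite lerDl.
  - by move=> x y xp yp; have [? ?] := sub _ _ Pn _ _ xp yp; exact: ch.
  - by rewrite ![_ + _ - _]addrAC !subrr !add0r.
  rewrite ![_ + _ - _]addrAC !subrr !add0r -wdS -hdS /= => bad'.
  exists (if i then p.1 else (p.1 + (p.1 + wd n)) / 2,
          if j then p.2 else (p.2 + (p.2 + hd n)) / 2).
  have wn0 := wd0 n; have hn0 := hd0 n; have wnS := wdS n; have hnS := hdS n.
  rewrite /step; split => /=; [split => //=|..]; case: ifP => _;
    by clear -p1 p1' p2 p2' wn0 hn0 wnS hnS; lra.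
(* The choice depends on the proof of [P n p], so the recursion [Q] carries each corner together
   with its proof. *)
pose F n p (Pp : P n p) : sig (step n p) := cid (PS n p Pp).
pose Q : forall n, sig (P n) := fix Q n := match n with
  | 0%N => exist (P 0%N) (a, c) P0
  | m.+1 => let r := F m _ (svalP (Q m)) in exist (P m.+1) (sval r) (let: And5 Pr _ _ _ _ := svalP r in Pr)
  end.
pose q n := sval (Q n).
have qS n : step n (q n) (q n.+1) by rewrite /q /=; case: (F n _ _).
have qP n : P n (q n) by rewrite /q; case: (Q n).
have [p1 hp1] : exists p, forall n, (q n).1 <= p <= (q n).1 + wd n.
  by apply: nested_point => // n; have [] := qS n.
have [p2 hp2] : exists p, forall n, (q n).2 <= p <= (q n).2 + hd n.
  by apply: nested_point => // n; have [] := qS n.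
have [p1ab p2cd] := sub _ _ (qP 0%N) _ _ (hp1 0%N) (hp2 0%N).
have [D HD] := (derivableCP _ _).1 (dh _ _ p1ab p2cd).
(* With the 4 of [rectint_affine_bound], e/8 yields half of the lower bound. As [bad] is strict,
   this is a contradiction even if that bound is 0. *)
have e80 : 0 < e / 8 by rewrite divr_gt0.
have [r r0 Hr] := HD _ e80.
have [n nr] : exists n, wd n + hd n < r.
  have /cvgrPdist_lt/(_ r r0)[n _ /(_ n (leqnn n))] :
      (fun n => s * (2^-1) ^+ n) @ \oo --> s * (0 : R).
    by apply: cvgMr; apply: cvg_expr; rewrite ger0_norm ?invr_ge0// invf_lt1// ltr1n.
  rewrite mulr0 sub0r normrN /= => H; exists n; apply: le_lt_trans H.
  by apply: le_trans (ler_norm _); rewrite /wd /hd -mulrDl exprVn.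
have [q1 q1' q2 q2' bad] := qP n.
have : normc (rectint h (q n).1 ((q n).1 + wd n) (q n).2 ((q n).2 + hd n)) <=
    4 * (e / 8) * (((q n).1 + wd n - (q n).1) + ((q n).2 + hd n - (q n).2)) ^+ 2.
  apply: (@rectint_affine_bound _ _ _ _ _ _ (h (p1 +i* p2)) D (p1 +i* p2)).
  - by rewrite lerDl.
  - by rewrite lerDl.
  - by move=> x y xp yp; have [? ?] := sub _ _ (qP n) _ _ xp yp; exact: ch.
  - exact: hp1.
  - exact: hp2.
  - move=> x y xp yp.
    have := Hr ((x +i* y : C) - (p1 +i* p2)); rewrite (addrC (p1 +i* p2 : C)) subrK; apply.
    apply: le_lt_trans nr; apply: le_trans (normc_le_ReIm _) _ => /=.
    move: xp yp (hp1 n) (hp2 n) => /andP[+ +] /andP[+ +] /andP[+ +] /andP[+ +].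
    by clear; move=> *; apply: lerD; rewrite ler_norml; apply/andP; split; lra.
  - exact: ltW.
rewrite ![_ + _ - _]addrAC !subrr !add0r => small.
have := lt_le_trans bad small.
have : 0 <= e * (wd n + hd n) ^+ 2 by rewrite mulr_ge0 ?sqr_ge0// ltW.
have -> : 4 * (e / 8) * (wd n + hd n) ^+ 2 = e * (wd n + hd n) ^+ 2 / 2 by field.
lra.
Qed.

End identity_theorem.

(** * Identity theorem on a strip *)

Section strip_identity.
Context {R : realType}.
Local Notation C := (Cplx R).
Local Notation mu := (@lebesgue_measure R).
Implicit Types (a b c d x y e : R) (H : C -> C) (w : C).

Lemma normc_i : normc ('i%C : C) = 1.
Proof. by rewrite /normc /= expr0n expr1n add0r sqrtr1. Qed.

Lemma cexp_real x : cexp (x%:C : C) = (expR x)%:C.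
Proof. by rewrite /cexp /= cos0 sin0 mulr1 mulr0. Qed.

Lemma derivable_gauss H w (l : R) w1 : derivable H w 1 ->
  derivable (fun v => H v * cexp (- l%:C * (v - w1) ^+ 2)) w 1.
Proof.
move=> dH; apply: (cdiffM dH).
apply: (@cdiff_comp _ (fun v : C => - l%:C * (v - w1) ^+ 2)); last exact: derivable_cexp.
apply: cdiffM; first exact: cdiff_cst.
have dB : derivable (fun v : C => v - w1) w 1.
  by apply: cdiffB; [exact: cdiff_id|exact: cdiff_cst].
exact: cdiffM.
Qed.

Lemma Rintegral_itv_ge a b (p : R -> R) (k : R) : a <= b ->
  mu.-integrable `[a, b] (EFin \o p) -> (forall x, a <= x <= b -> k <= p x) ->
  k * (b - a) <= \int[mu]_(t in `[a, b]) p t.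
Proof.
move=> ab ip kp; rewrite -Rintegral_itv_cst//; apply: le_Rintegral => //.
  exact: integrable_itv_cst.
Qed.

(* Cauchy's theorem on [x - b - 1, x + b + 1] x [0, b] for H times the Gaussian
   exp (- l (w - w1)^2) peaked at w1 = x + ib: for large l the top side is
   dominated by a neighbourhood of w1, while the vertical sides are
   exponentially smaller and the bottom side vanishes. *)
Lemma upper_strip_eq0 H b x : 0 < b ->
  (forall w, 0 <= Im w <= b -> derivable H w 1) ->
  (forall t : R, H t%:C = 0) -> H (x +i* b) = 0.
Proof.
move=> b0 dH0 H0; apply: contrapT => /eqP q0.
set q := H (x +i* b) in q0.
pose G w := q^-1 * H w.
have G1 : G (x +i* b) = 1 by rewrite /G mulVf.
have G0 (t : R) : G t%:C = 0 by rewrite /G H0 mulr0.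
have dG w : 0 <= Im w <= b -> derivable G w 1.
  by move=> wb; apply: cdiffM; [exact: cdiff_cst|exact: dH0].
have cG w : 0 <= Im w <= b -> {for w, continuous G}.
  by move=> wb; apply: cdiff_continuous; exact: dG.
(* On the vertical sides Re (w - w1)^2 = A^2 - (t - b)^2 >= (b + 1)^2 - b^2 >= 1, hence the factor
   exp(-l) there. *)
pose A := b + 1; have A0 : 0 < A by rewrite addr_gt0.
have lohi : x - A <= x + A by lra.
have bb : 0 <= b <= b by rewrite lexx ltW.
have ctop : pcontinuous (x - A) (x + A) (fun t => G (t +i* b)).
  by apply: pcontinuous_horiz => t _; exact: cG.
have [M1 hM1] := pcontinuous_bounded lohi ctop.
have side (s : R) : pcontinuous 0 b (fun t => G (s +i* t)).
  by apply: pcontinuous_vert => t tb; exact: cG.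
have [M2 hM2] := pcontinuous_bounded (ltW b0) (side (x + A)).
have [M3 hM3] := pcontinuous_bounded (ltW b0) (side (x - A)).
pose M := `|M1| + `|M2| + `|M3|.
have M0 : 0 <= M by rewrite !addr_ge0.
have [M1M M2M M3M] : [/\ M1 <= M, M2 <= M & M3 <= M].
  have := normr_ge0 M1; have := normr_ge0 M2; have := normr_ge0 M3.
  have := ler_norm M1; have := ler_norm M2; have := ler_norm M3.
  by rewrite /M; split; lra.
have xlohi : x - A <= x <= x + A by apply/andP; split; lra.
have half0 : 0 < 2^-1 :> R by rewrite invr_gt0.
have [d0 d00 Hd0] := ctop x xlohi _ half0.
pose d := Num.min (d0 / 2) 1.
have dgt0 : 0 < d by rewrite lt_min ltr01 divr_gt0.
have d1 : d <= 1 by rewrite ge_min lexx orbT.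
have dd0 : d < d0 by apply: (@le_lt_trans _ _ (d0 / 2)); [rewrite ge_min lexx|lra].
have near_half t : `|t - x| <= d -> 2^-1 <= Re (G (t +i* b)).
  move=> td; have := Hd0 _ (le_lt_trans td dd0); rewrite G1.
  move=> /(le_lt_trans (Re_le_normc _)); rewrite ReB /= ltr_norml => /andP[? _].
  by lra.
(* The total weight that can oppose the peak: 2 A M from the top side away from x and 4 b M from the
   vertical sides. *)
pose K := (2 * A + 4 * b) * M.
have K0 : 0 <= K by rewrite mulr_ge0// addr_ge0 ?mulr_ge0 ?ltW.
(* The solution of l d^2 - l (d / 2)^2 = 2 K / d. In units of exp(- l d^2), the peak is then at
   least (d / 2) exp(2 K / d) >= d / 2 + K, while everything opposing it is at most K. *)
pose l := 4 / (3 * d ^+ 2) * (2 * K / d).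
have l0 : 0 <= l.
  have K2 : 0 <= 2 * K / d := divr_ge0 (mulr_ge0 (ler0n _ 2) K0) (ltW dgt0).
  apply: mulr_ge0 K2; apply: divr_ge0 => //; exact: mulr_ge0 (ler0n _ 3) (sqr_ge0 _).
pose F w := G w * cexp (- l%:C * (w - (x +i* b)) ^+ 2).
have dF w : 0 <= Im w <= b -> derivable F w 1.
  by move=> wb; apply: derivable_gauss; exact: dG.
have cF w : 0 <= Im w <= b -> {for w, continuous F}.
  by move=> wb; apply: cdiff_continuous; exact: dF.
have Ftop t : F (t +i* b) = G (t +i* b) * (expR (- l * (t - x) ^+ 2))%:C.
  rewrite /F -cexp_real; congr (_ * cexp _).
  have -> : (t +i* b : C) - (x +i* b) = (t - x)%:C by complex_ring.
  by rewrite !expr2; complex_ring.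
have Fbot (t : R) : F (t +i* 0) = 0 by rewrite /F complexr0 G0 mul0r.
have Fside s t : `|s - x| = A -> 0 <= t <= b -> normc (G (s +i* t)) <= M ->
    normc (F (s +i* t)) <= M * expR (- l).
  move=> sA /andP[t0 tb] GM; rewrite /F normcM normc_cexp.
  apply: ler_pM => //; rewrite ?normc_ge0 ?expR_ge0// ler_expR.
  have -> : - l%:C * ((s +i* t : C) - (x +i* b)) ^+ 2 =
     (- l * ((s - x) ^+ 2 - (t - b) ^+ 2)) +i* (- l * (2 * (s - x) * (t - b))).
    by rewrite !expr2; complex_ring.
  rewrite /= mulNr lerN2 ler_peMr//.
  have -> : (s - x) ^+ 2 = A ^+ 2 by rewrite -sA real_normK// num_real.
  have : 0 <= t * (2 * b - t) by rewrite mulr_ge0//; lra.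
  by rewrite /A; nra.
have : rectint F (x - A) (x + A) 0 b = 0.
  by apply: goursat => //; [exact: ltW|move=> u v _ vb; exact: dF].
rewrite /rectint (@eq_Cintegral _ _ _ (fun t => (-1) * F (t +i* b))); last first.
  by move=> t _; rewrite Fbot mulN1r sub0r.
have cFtop : pcontinuous (x - A) (x + A) (fun t => F (t +i* b)).
  by apply: pcontinuous_horiz => t _; exact: cF.
have iFtop := pcontinuous_Cintegrable cFtop.
have cFside (s : R) : pcontinuous 0 b (fun t => F (s +i* t)).
  by apply: pcontinuous_vert => t tb; exact: cF.
rewrite CintegralZl// mulN1r => /eqP; rewrite addrC subr_eq0 => /eqP topE.
have normA1 : `|x + A - x| = A by rewrite addrAC subrr add0r gtr0_norm.
have normA2 : `|x - A - x| = A by rewrite addrAC subrr sub0r normrN gtr0_norm.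
have side_le : normc (Cintegral `[0, b] (fun t => F ((x + A) +i* t) - F ((x - A) +i* t)))
    <= 2 * (2 * (M * expR (- l)) * (b - 0)).
  apply: normc_Cintegral_itv; first exact: ltW.
    by apply: pcontinuous_Cintegrable; exact: pcontinuousB.
  move=> t tb; apply: le_trans (normcD_le _ _) _; rewrite normcN mulr2n mulrDl mul1r.
  by apply: lerD; apply: Fside => //; [apply: le_trans (hM2 _ tb) _|apply: le_trans (hM3 _ tb) _].
have top_le : \int[mu]_(t in `[x - A, x + A]) Re (F (t +i* b)) <= 4 * b * M * expR (- l).
  have -> : \int[mu]_(t in `[x - A, x + A]) Re (F (t +i* b)) =
     Re (Cintegral `[x - A, x + A] (fun t => F (t +i* b))) by [].
  rewrite -topE; apply: le_trans (ler_norm _) _; apply: le_trans (Re_le_normc _) _.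
  by rewrite normcM normc_i mul1r; apply: le_trans side_le _; rewrite subr0; lra.
have [iF _] := iFtop.
have xd2 : x - A <= x - d / 2 <= x + A by apply/andP; split; rewrite /A; clear -b0 dgt0 d1; lra.
have xd2' : x - d / 2 <= x + d / 2 <= x + A by apply/andP; split; rewrite /A; clear -b0 dgt0 d1; lra.
have isub u v : x - A <= u -> v <= x + A ->
    mu.-integrable `[u, v] (EFin \o (fun t => Re (F (t +i* b)))).
  move=> lu vh; apply: integrableS iF => // t /=; rewrite !in_itv /= => /andP[ut tv].
  by rewrite (le_trans lu ut) (le_trans tv vh).
move: top_le; rewrite (Rintegral_itv_split xd2)// (Rintegral_itv_split xd2'); last first.
  by apply: isub; rewrite /A; clear -b0 dgt0 d1; lra.
have ReF t : Re (F (t +i* b)) = Re (G (t +i* b)) * expR (- l * (t - x) ^+ 2).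
  by rewrite Ftop; case: (G _) => u v; rewrite /= mulr0 subr0.
(* The belt d/2 <= |t - x| <= d contributes nonnegatively, so negative values occur only beyond d,
   while the peak is measured within d/2. The gap between the two radii produces the exponential
   gain. *)
have outer t : x - A <= t <= x + A -> d / 2 <= `|t - x| ->
    - (M * expR (- l * d ^+ 2)) <= Re (F (t +i* b)).
  move=> tA dt; rewrite ReF.
  have [td|td] := leP `|t - x| d.
    apply: (@le_trans _ _ 0).
      by rewrite lerNl oppr0 mulr_ge0// expR_ge0.
    rewrite mulr_ge0 ?expR_ge0//; apply: le_trans (near_half _ td).
    by rewrite ltW.
  have GM : - Re (G (t +i* b)) <= M.
    apply: le_trans (ler_norm _) _; rewrite normrN; apply: le_trans (Re_le_normc _) _.
    exact: le_trans (hM1 _ tA) _.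
  rewrite lerNl -mulNr; apply: (@le_trans _ _ (M * expR (- l * (t - x) ^+ 2))).
    by rewrite ler_wpM2r ?expR_ge0.
  rewrite ler_wpM2l// ler_expR !mulNr lerN2 ler_wpM2l//.
  by rewrite -(real_normK (num_real (t - x))) ler_pXn2r ?nnegrE// ltW.
have inner t : x - d / 2 <= t <= x + d / 2 ->
    2^-1 * expR (- l * (d / 2) ^+ 2) <= Re (F (t +i* b)).
  move=> /andP[t1 t2]; rewrite ReF.
  have td : `|t - x| <= d / 2 by rewrite ler_norml; apply/andP; clear -t1 t2; split; lra.
  apply: ler_pM; rewrite ?expR_ge0// ?invr_ge0//.
    by apply: near_half; apply: le_trans td _; clear -dgt0; lra.
  rewrite ler_expR !mulNr lerN2 ler_wpM2l//.
  by rewrite -(real_normK (num_real (t - x))) ler_pXn2r ?nnegrE//; clear -dgt0; lra.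
have J1 : - (M * expR (- l * d ^+ 2)) * (x - d / 2 - (x - A)) <=
    \int[mu]_(t in `[x - A, x - d / 2]) Re (F (t +i* b)).
  apply: Rintegral_itv_ge.
  - by rewrite /A; clear -b0 dgt0 d1; lra.
  - by apply: isub; rewrite /A; clear -b0 dgt0 d1; lra.
  move=> t /andP[t1 t2]; apply: outer; first by apply/andP; clear -t1 t2 dgt0 d1 b0 A0; rewrite /A in t1 t2 *; split; lra.
  by rewrite -normrN; apply: le_trans (ler_norm _); clear -t2; lra.
have J2 : 2^-1 * expR (- l * (d / 2) ^+ 2) * (x + d / 2 - (x - d / 2)) <=
    \int[mu]_(t in `[x - d / 2, x + d / 2]) Re (F (t +i* b)).
  apply: Rintegral_itv_ge => //; first by clear -dgt0; lra.
  by apply: isub; rewrite /A; clear -b0 dgt0 d1; lra.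
have J3 : - (M * expR (- l * d ^+ 2)) * (x + A - (x + d / 2)) <=
    \int[mu]_(t in `[x + d / 2, x + A]) Re (F (t +i* b)).
  apply: Rintegral_itv_ge.
  - by rewrite /A; clear -b0 dgt0 d1; lra.
  - by apply: isub; rewrite /A; clear -b0 dgt0 d1; lra.
  move=> t /andP[t1 t2]; apply: outer; first by apply/andP; clear -t1 t2 dgt0 d1 b0 A0; rewrite /A in t1 t2 *; split; lra.
  by apply: le_trans (ler_norm _); clear -t1; lra.
move=> top_le.
have el : expR (- l) <= expR (- l * d ^+ 2).
  by rewrite ler_expR mulNr lerN2 ler_piMr// expr_le1// ltW.
have e0 : 0 < expR (- l * d ^+ 2) by exact: expR_gt0.
have : d / 2 * expR (- l * (d / 2) ^+ 2) <= K * expR (- l * d ^+ 2).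
  have b1 : 4 * b * M * expR (- l) <= 4 * b * M * expR (- l * d ^+ 2).
    by rewrite ler_wpM2l// !mulr_ge0// ltW.
  have b2 : M * expR (- l * d ^+ 2) * (x - d / 2 - (x - A)) +
     M * expR (- l * d ^+ 2) * (x + A - (x + d / 2)) <=
     M * expR (- l * d ^+ 2) * (2 * A).
    by rewrite -mulrDr ler_wpM2l ?mulr_ge0 ?expR_ge0//; clear -dgt0; lra.
  have -> : K * expR (- l * d ^+ 2) = M * expR (- l * d ^+ 2) * (2 * A) +
     4 * b * M * expR (- l * d ^+ 2) by rewrite /K; ring.
  move: J1 J2 J3 top_le b1 b2.
  set E1 := expR (- l * d ^+ 2); set E2 := expR (- l * (d / 2) ^+ 2).
  have -> : x + d / 2 - (x - d / 2) = d by field.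
  by clear -E1; lra.
have -> : - l * (d / 2) ^+ 2 = - l * d ^+ 2 + 2 * K / d.
  by rewrite /l; field; rewrite gt_eqF.
rewrite expRD mulrCA [K * _]mulrC ler_pM2l// => bad.
have := expR_ge1Dx (2 * K / d).
rewrite -(ler_pM2l (_ : 0 < d / 2)) ?divr_gt0// => /le_trans/(_ bad).
have -> : d / 2 * (1 + 2 * K / d) = d / 2 + K by field; rewrite gt_eqF.
by clear -dgt0; lra.
Qed.

(** The lower half of the strip is the upper half for w |-> H (- w). *)
Lemma strip_eq0 H (r : R) : (forall w, `|Im w| < r -> derivable H w 1) ->
  (forall t : R, H t%:C = 0) -> forall w, `|Im w| < r -> H w = 0.
Proof.
move=> dH H0 [x y] /= yr.
have [y0|y0|->] := ltgtP y 0; last exact: H0.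
  have -> : (x +i* y : C) = - ((- x) +i* (- y)) by complex_ring.
  apply: (@upper_strip_eq0 (fun w => H (- w))); first by rewrite oppr_gt0.
    move=> w /andP[w0 wy].
    apply: (@cdiff_comp _ (fun w : C => - w)); first by apply: cdiffN; exact: cdiff_id.
    apply: dH; apply: le_lt_trans yr; rewrite raddfN/= normrN ger0_norm//.
    by rewrite ltr0_norm.
  by move=> t; rewrite -rmorphN; exact: H0.
apply: upper_strip_eq0 => // w /andP[w0 wy]; apply: dH; apply: le_lt_trans yr.
by rewrite !ger0_norm// ltW.
Qed.

End strip_identity.

(** * Continuation to the logarithm surface *)

Section continuation.
Context {R : realType}.
Local Notation C := (Cplx R).
Implicit Types (x y r : R) (w z : C) (f : R -> C) (F : R -> R -> C).

Lemma offcut_cexp w : `|Im w| < pi -> offcut (cexp w).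
Proof.
case: w => x y /= ypi; rewrite /offcut /cexp /=.
have [->|y0] := eqVneq y 0; first by left; rewrite cos0 mulr1 expR_gt0.
right; apply: mulf_neq0; first by rewrite gt_eqF ?expR_gt0.
have [yp|yn|y00] := ltgtP 0 y; last by rewrite -y00 eqxx in y0.
  by rewrite gt_eqF// sin_gt0_pi// yp /= -[y]gtr0_norm.
rewrite -oppr_eq0 -sinN gt_eqF// sin_gt0_pi// oppr_gt0 yn /=.
by rewrite -(ltr0_norm yn).
Qed.

Lemma continuation_stieltjes f F : Cintegrable `]0, +oo[ f ->
  log_surface_analytic F ->
  (forall x, 0 < x -> F x 0 = 1 + stieltjes f x%:C) ->
  forall w, `|Im w| < pi -> F (expR (Re w)) (Im w) = 1 + stieltjes f (cexp w).
Proof.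
move=> fi dF F0 w wpi; apply/eqP; rewrite -subr_eq0; apply/eqP.
pose H w : C := F (expR (Re w)) (Im w) - (1 + stieltjes f (cexp w)).
apply: (@strip_eq0 _ H pi) => // [v vpi|t]; last first.
  by rewrite /H cexp_real /= F0 ?expR_gt0// subrr.
apply: cdiffB; first exact: dF.
apply: cdiffD; first exact: cdiff_cst.
apply: (@cdiff_comp _ cexp); first exact: derivable_cexp.
by apply: derivable_stieltjes => //; exact: offcut_cexp.
Qed.

End continuation.

(** * Extracting the pole next to the cut *)

Section principal_value.
Context {R : realType}.
Local Notation C := (Cplx R).
Local Notation mu := (@lebesgue_measure R).
Implicit Types (x y r a b d t : R) (w z : C) (f : R -> C).

(** A real factor rather than a change of domain, so that f minus its value at a on the window is a
    single integrand on ]0, +oo[. *)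
Definition window a d t : R := if (a - d <= t <= a + d) then 1 else 0.

Lemma window_patch a d (p : R -> R) :
  (fun t => window a d t * p t) = p \_ `[a - d, a + d].
Proof.
apply/funext => t; rewrite /window patchE mem_setE in_itv /=.
by case: ifP => _; rewrite ?mul1r ?mul0r.
Qed.

Lemma measurable_window a d (D : set R) : measurable D ->
  measurable_fun D (window a d).
Proof.
move=> mD; have -> : window a d = \1_(`[a - d, a + d] : set R).
  by apply/funext => t; rewrite indicE mem_setE in_itv /window; case: ifP.
exact: measurable_indic.
Qed.

Lemma Rintegral_window a d (p : R -> R) : d < a ->
  \int[mu]_(t in `]0, +oo[) (window a d t * p t) =
  \int[mu]_(t in `[a - d, a + d]) p t.
Proof.
move=> da; rewrite window_patch -Rintegral_mkcondr; congr (Rintegral _ _ _).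
apply/seteqP; split=> t /=; first by case.
rewrite !in_itv /= andbT => /andP[ta ta']; rewrite ta ta'; split => //.
by apply: lt_le_trans ta; rewrite subr_gt0.
Qed.

Lemma integrable_window a d (p : R -> R) : d < a ->
  mu.-integrable `[a - d, a + d] (EFin \o p) ->
  mu.-integrable `]0, +oo[ (EFin \o (fun t => window a d t * p t)).
Proof.
move=> da ip; rewrite window_patch -restrict_EFin; apply/integrable_restrict => //.
rewrite (_ : _ `&` _ = `[a - d, a + d]%classic)//.
apply/seteqP; split=> t /=; first by case.
rewrite !in_itv /= andbT => /andP[ta ta']; rewrite ta ta'; split => //.
by apply: lt_le_trans ta; rewrite subr_gt0.
Qed.

Lemma Rintegral_FTC (F p : R -> R) a b : a < b ->
  (forall t, a <= t <= b -> is_derive t 1 F (p t)) ->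
  {within `[a, b], continuous p} ->
  \int[mu]_(t in `[a, b]) p t = F b - F a.
Proof.
move=> ab dF cp.
have cF t : a <= t <= b -> {for t, continuous F}.
  by move=> /dF[dFt _]; apply: differentiable_continuous; exact/derivable1_diffP.
rewrite /Rintegral (@continuous_FTC2 _ p F)//.
- split.
  + by move=> t; rewrite in_itv /= => /andP[at_ tb]; have [] := dF t; rewrite ?ltW.
  + by apply: cvg_at_right_filter; apply: cF; rewrite lexx ltW.
  + by apply: cvg_at_left_filter; apply: cF; rewrite lexx ltW.
- move=> t; rewrite in_itv /= => /andP[at_ tb].
  by rewrite derive1E; have [] := dF t; rewrite ?ltW.
Qed.

Lemma sqr_shift_gt0 a b t : b != 0 -> 0 < (t - a) ^+ 2 + b ^+ 2.
Proof. by move=> b0; rewrite ltr_wpDl ?sqr_ge0// exprn_even_gt0. Qed.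

Lemma is_derive_atan_shift a b t : b != 0 ->
  is_derive t (1 : R) (fun t => atan ((t - a) / b)) (b / ((t - a) ^+ 2 + b ^+ 2)).
Proof.
move=> b0; have D : is_derive t (1 : R) (fun t : R => (t - a) / b) (b^-1).
  rewrite (_ : (fun t : R => (t - a) / b) = b^-1 *: (fun t : R => t - a)); last first.
    by apply/funext => s; rewrite [RHS]/= /GRing.scale/= mulrC.
  by apply: is_derive_eq; rewrite subr0 /GRing.scale/= mulr1.
apply: is_derive_eq; rewrite /GRing.scale /=.
by have := sqr_shift_gt0 a t b0 => ?; field; rewrite b0 !gt_eqF.
Qed.

Lemma is_derive_ln_shift a b t : b != 0 ->
  is_derive t (1 : R) (fun t => ln ((t - a) ^+ 2 + b ^+ 2) / 2)
    ((t - a) / ((t - a) ^+ 2 + b ^+ 2)).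
Proof.
move=> b0; have p0 := sqr_shift_gt0 a t b0.
have Dln := is_derive1_ln p0.
have D : is_derive t (1 : R) (fun t : R => (t - a) ^+ 2 + b ^+ 2) (2 * (t - a)).
  rewrite (_ : (fun t : R => _) = (fun t : R => t - a) ^+ 2 + cst (b ^+ 2)); last first.
    by apply/funext => s; rewrite /= expr2.
  by apply: is_derive_eq; rewrite addr0 subr0 /GRing.scale/= expr1; ring.
rewrite (_ : (fun t : R => _) = 2^-1 *: (@ln R \o (fun t : R => (t - a) ^+ 2 + b ^+ 2))); last first.
  by apply/funext => s; rewrite [RHS]/= /GRing.scale/= mulrC.
apply: is_derive_eq; rewrite /GRing.scale /=.
by field; rewrite gt_eqF.
Qed.

Lemma continuous_sqr_shift a b t : {for t, continuous (fun t => (t - a) ^+ 2 + b ^+ 2)}.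
Proof.
apply: cvgD; last exact: cvg_cst.
by apply: cvgM; apply: cvgB; [exact: cvg_id|exact: cvg_cst|exact: cvg_id|exact: cvg_cst].
Qed.

(** The real part is odd about a, so the logarithms at the two ends cancel. The imaginary part tends
    to -pi or pi as b tends to 0 from above or from below: this is the origin of the jump. *)
Lemma integral_pole a b d : 0 < d -> b != 0 ->
  Cintegral `[a - d, a + d] (fun t => (t%:C + ((- a) +i* b))^-1) =
  0 +i* (- (2 * atan (d / b))).
Proof.
move=> d0 b0; have lt_ad : a - d < a + d by lra.
have E1 : a + d - a = d by rewrite addrAC subrr add0r.
have E2 : a - d - a = - d by rewrite addrAC subrr add0r.
have pV (t : R) : ((t%:C + ((- a) +i* b))^-1 : C) =
    ((t - a) / ((t - a) ^+ 2 + b ^+ 2)) +i* (- b / ((t - a) ^+ 2 + b ^+ 2)).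
  by apply/eqP; rewrite eq_complex /= add0r mulNr !eqxx.
rewrite /Cintegral; under eq_Rintegral do rewrite pV /=.
under [X in _ +i* X]eq_Rintegral do rewrite pV /=.
have cV t : {for t, continuous (fun t => ((t - a) ^+ 2 + b ^+ 2)^-1)}.
  by apply: cvgV; [rewrite gt_eqF ?sqr_shift_gt0|exact: continuous_sqr_shift].
congr (_ +i* _).
  rewrite (Rintegral_FTC lt_ad (fun t _ => is_derive_ln_shift a t b0)).
    by rewrite E1 E2 sqrrN subrr.
  apply: continuous_subspaceT => t; apply: cvgM; last exact: cV.
  by apply: cvgB; [exact: cvg_id|exact: cvg_cst].
rewrite (_ : (fun t => _) = (fun t => (-1) * (b / ((t - a) ^+ 2 + b ^+ 2)))); last first.
  by apply/funext => t; rewrite mulN1r mulNr.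
have cb : {within `[a - d, a + d], continuous (fun t => b / ((t - a) ^+ 2 + b ^+ 2))}.
  by apply: continuous_subspaceT => t; apply: cvgM; [exact: cvg_cst|exact: cV].
rewrite RintegralZl//; last first.
  by apply: continuous_compact_integrable => //; exact: segment_compact.
rewrite (Rintegral_FTC lt_ad (fun t _ => is_derive_atan_shift a t b0))//.
by rewrite E1 E2 [- d / b]mulNr atanN opprK mulN1r -mulr2n mulr_natl.
Qed.

(** At z = -a + ib the two pieces are integrable separately because |t + z| >= |b|, and the one with
    the pole is known exactly from [integral_pole]. *)
Lemma stieltjes_window f a b d : Cintegrable `]0, +oo[ f -> 0 < d -> d < a -> b != 0 ->
  stieltjes f ((- a) +i* b) =
  Cintegral `]0, +oo[ (fun t => (f t - (window a d t)%:C * f a) / (t%:C + ((- a) +i* b)))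
  + f a * (0 +i* (- (2 * atan (d / b)))).
Proof.
move=> fi d0 da b0; rewrite -(@integral_pole a)//.
set z : C := (- a) +i* b.
have zc : offcut z by right.
have iz := Cintegrable_stieltjes fi zc.
have imz t : Im (t%:C + z) = b by rewrite /z /= add0r.
have iw : Cintegrable `]0, +oo[ (fun t => (window a d t)%:C * (f a / (t%:C + z))).
  have : mu.-integrable `]0, +oo[ (EFin \o (fun t => window a d t * (normc (f a) / `|b|))).
    by apply: integrable_window => //; exact: integrable_itv_cst.
  apply: Cintegrable_le => //.
    apply: CmeasurableM; first by apply: Cmeasurable_real; exact: measurable_window.
    by apply: CmeasurableM; [exact: Cmeasurable_cst|exact: Cmeasurable_inv_shift].
  move=> t _; rewrite normcM normc_Cr normc_divr ger0_norm; last first.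
    by rewrite /window; case: ifP.
  rewrite ler_wpM2l//; first by rewrite /window; case: ifP.
  rewrite ler_wpM2l ?normc_ge0// lef_pV2 ?posrE ?normr_gt0//.
    by have := Im_le_normc (t%:C + z); rewrite imz.
  have := Im_le_normc (t%:C + z); rewrite imz; apply: lt_le_trans.
  by rewrite normr_gt0.
have -> : f a * Cintegral `[a - d, a + d] (fun t => (t%:C + z)^-1) =
    Cintegral `]0, +oo[ (fun t => (window a d t)%:C * (f a / (t%:C + z))).
  have ip : Cintegrable `[a - d, a + d] (fun t => (t%:C + z)^-1).
    apply: Cintegrable_le (integrable_itv_cst _ _ (`|b|^-1)) => //.
      exact: Cmeasurable_inv_shift.
    move=> t _; rewrite normcV lef_pV2 ?posrE ?normr_gt0//.
      by have := Im_le_normc (t%:C + z); rewrite imz.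
    have := Im_le_normc (t%:C + z); rewrite imz; apply: lt_le_trans.
    by rewrite normr_gt0.
  rewrite -CintegralZl// /Cintegral -!(Rintegral_window _ da); congr (_ +i* _);
    apply: eq_Rintegral => t _; rewrite /window; case: ifP => _;
    by rewrite ?mul1r ?mul0r.
rewrite -CintegralD//.
  apply: eq_Cintegral => t _; set v := (_ + z)^-1; ring.
apply: (eq_Cintegrable _ _ (CintegrableB _ iz iw)) => // t _ /=.
set v := (_ + z)^-1; ring.
Qed.

End principal_value.

(** * Bounds and jump of the Stieltjes transform *)

Section stieltjes_bounds.
Context {R : realType}.
Local Notation C := (Cplx R).
Local Notation mu := (@lebesgue_measure R).
Variables (k : R -> R) (u : R -> C) (Ck : R).
Let f (t : R) : C := (k t)%:C * u t.
Hypothesis Ck0 : 0 < Ck.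
Hypothesis k_le : forall t, 0 < t -> `|k t| <= Ck / (1 + t).
Hypothesis k_lip : forall a t, 0 < a -> a / 2 <= t <= a + a / 2 ->
  `|k t - k a| <= Ck * `|t - a| / (a * (1 + a)).
Hypothesis fi : Cintegrable `]0, +oo[ f.
Hypothesis uE : forall x, 0 < x -> u x = 1 + stieltjes f x%:C.
Implicit Types (a b d r s t x : R) (z : C).

Definition potential r := \int[mu]_(t in `]0, +oo[) (normc (f t) / (t + r)).
Local Notation B := potential.

Definition l1norm := \int[mu]_(t in `]0, +oo[) normc (f t).

Lemma normf_integrable : mu.-integrable `]0, +oo[ (EFin \o (fun t => normc (f t))).
Proof. exact: integrable_normc. Qed.

Lemma potential_integrable r : 0 < r ->
  mu.-integrable `]0, +oo[ (EFin \o (fun t => normc (f t) / (t + r))).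
Proof.
move=> r0; have := integrableZR r^-1 measurable_itv0y normf_integrable.
apply: le_integrableR => //.
  apply: measurable_funM.
    by apply: measurable_normc; exact: Cintegrable_measurable.
  have := measurable_normc (Cmeasurable_inv_shift `]0, +oo[ r%:C).
  apply: eq_measurable_fun => t /set_mem/itv0yP t0.
  by rewrite normcV -rmorphD normc_Cr gtr0_norm ?addr_gt0.
move=> t /itv0yP t0; rewrite ger0_norm; last by rewrite divr_ge0 ?normc_ge0// addr_ge0// ltW.
rewrite mulrC ler_wpM2r ?normc_ge0// lef_pV2 ?posrE ?addr_gt0//.
by rewrite lerDr ltW.
Qed.

Lemma potential_ge0 r : 0 < r -> 0 <= B r.
Proof.
move=> r0; apply: Rintegral_ge0 => t /itv0yP t0.
by rewrite divr_ge0 ?normc_ge0// addr_ge0// ltW.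
Qed.

Lemma potential_mono r s : 0 < r -> r <= s -> B s <= B r.
Proof.
move=> r0 rs; have s0 := lt_le_trans r0 rs.
apply: le_Rintegral => //; [exact: potential_integrable|exact: potential_integrable|].
move=> t /itv0yP t0; rewrite ler_wpM2l ?normc_ge0// lef_pV2 ?posrE ?addr_gt0//.
by rewrite lerD2l.
Qed.

Lemma potential_le r : 0 < r -> B r <= r^-1 * l1norm.
Proof.
move=> r0; rewrite -RintegralZl//; last exact: normf_integrable.
apply: le_Rintegral => //; first exact: potential_integrable.
  by apply: integrableZR => //; exact: normf_integrable.
move=> t /itv0yP t0; rewrite mulrC ler_wpM2r ?normc_ge0//.
by rewrite lef_pV2 ?posrE ?addr_gt0// lerDr ltW.
Qed.

Lemma normc_stieltjes_far z c r : 0 < c -> 0 < r ->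
  (forall t, 0 < t -> c * (t + r) <= normc (t%:C + z)) ->
  normc (stieltjes f z) <= 2 * (c^-1 * B r).
Proof.
move=> c0 r0 H; rewrite -RintegralZl//; last exact: potential_integrable.
apply: normc_Cintegral => //.
- by apply: Cmeasurable_stieltjes; exact: Cintegrable_measurable.
- move=> t /itv0yP t0; rewrite normc_divr mulrCA ler_wpM2l ?normc_ge0// -invfM.
  have tr0 : 0 < c * (t + r) by rewrite mulr_gt0// addr_gt0.
  by rewrite lef_pV2 ?posrE ?H// (lt_le_trans tr0)// H.
- by apply: integrableZR => //; exact: potential_integrable.
Qed.

Lemma normc_addr t x : 0 < t -> 0 < x -> normc (t%:C + x%:C : C) = t + x.
Proof. by move=> t0 x0; rewrite -rmorphD normc_Cr gtr0_norm ?addr_gt0. Qed.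

Lemma normc_solution a : 0 < a -> normc (u a) <= 1 + 2 * B a.
Proof.
move=> a0; rewrite uE//; apply: le_trans (normcD_le _ _) _; rewrite normc1 lerD2l.
have := @normc_stieltjes_far a%:C 1 a ltr01 a0; rewrite invr1 mul1r; apply.
by move=> t t0; rewrite mul1r normc_addr.
Qed.

Lemma offcut_pos a : 0 < a -> offcut (a%:C : C).
Proof. by left. Qed.

(* The resolvent identity 1/(s+t) - 1/(s+a) = (a-t)/((s+t)(s+a)) gives regularity
   of the solution without differentiating it. *)
Lemma solution_lip a t : 0 < a -> 0 < t ->
  normc (u t - u a) <= 2 * (`|t - a| / t * B a).
Proof.
move=> a0 t0; rewrite !uE// opprD addrACA subrr add0r.
have nz s x : 0 < s -> 0 < x -> (s%:C + x%:C : C) != 0.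
  by move=> s0 x0; rewrite -normc_gt0 normc_addr// addr_gt0.
rewrite -CintegralB//; [|exact/Cintegrable_stieltjes/offcut_pos|exact/Cintegrable_stieltjes/offcut_pos].
rewrite (@eq_Cintegral _ _ _ (fun s => (a - t)%:C * (f s / ((s%:C + t%:C) * (s%:C + a%:C))))); last first.
  move=> s /set_mem/itv0yP s0; rewrite rmorphB /=; field.
  by rewrite !nz.
rewrite -RintegralZl//; last exact: potential_integrable.
apply: normc_Cintegral => //.
- apply: CmeasurableM; first exact: Cmeasurable_cst.
  apply: CmeasurableM; first exact: Cintegrable_measurable.
  rewrite (_ : (fun s => _) = (fun s => (s%:C + t%:C)^-1 * (s%:C + a%:C)^-1)).
    by apply: CmeasurableM; exact: Cmeasurable_inv_shift.
  by apply/funext => s; rewrite -invfM.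
- move=> s /itv0yP s0; rewrite normcM normc_Cr distrC normc_divr (normcM (s%:C + t%:C)) !normc_addr//.
  rewrite -mulrA ler_wpM2l//.
  rewrite mulrCA ler_wpM2l ?normc_ge0// -invfM.
  rewrite lef_pV2 ?posrE ?mulr_gt0 ?addr_gt0//.
  by apply: ler_wpM2r; [rewrite addr_ge0// ltW|rewrite lerDr ltW].
- by apply: integrableZR => //; exact: potential_integrable.
Qed.

(** Per relative displacement |t - a| / a: the first term is the variation of k against |u a| <= 1 +
    2 B a; the second is |k| <= Ck against the variation of u from [solution_lip], where t >= a / 2
    turns 2 into 4. *)
Definition density_lipc a := Ck * ((1 + 2 * B a) / (1 + a) + 4 * B a).

Lemma density_lipc_ge0 a : 0 < a -> 0 <= density_lipc a.
Proof.
move=> a0; have := potential_ge0 a0 => Ba.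
have a1 : 0 < 1 + a by lra.
by rewrite mulr_ge0 ?ltW// ltr_wpDr ?mulr_ge0// divr_gt0//; lra.
Qed.

Lemma density_lip a t : 0 < a -> a / 2 <= t <= a + a / 2 ->
  normc (f t - f a) <= `|t - a| * (density_lipc a / a).
Proof.
move=> a0 ta; have /andP[t1 t2] := ta; have t0 : 0 < t by lra.
have -> : f t - f a = (k t - k a)%:C * u a + (k t)%:C * (u t - u a).
  by rewrite /f rmorphB; ring.
apply: le_trans (normcD_le _ _) _; rewrite !normcM !normc_Cr.
have Ba := potential_ge0 a0.
have a1 : 0 < 1 + a by lra.
have p1 : `|k t - k a| * normc (u a) <=
    (Ck * `|t - a| / (a * (1 + a))) * (1 + 2 * B a).
  by apply: ler_pM; rewrite ?normc_ge0//; [exact: k_lip|exact: normc_solution].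
have p2 : `|k t| * normc (u t - u a) <= Ck * (2 * (`|t - a| / (a / 2) * B a)).
  apply: ler_pM; rewrite ?normc_ge0//.
    apply: le_trans (k_le t0) _; rewrite ler_pdivrMr ?ler_peMr ?ltW//; lra.
  apply: le_trans (solution_lip a0 t0) _.
  rewrite ler_pM2l// ler_wpM2r// ler_wpM2l// lef_pV2 ?posrE//; lra.
apply: le_trans (lerD p1 p2) _.
by rewrite le_eqVlt; apply/orP; left; apply/eqP; rewrite /density_lipc; field; rewrite !gt_eqF.
Qed.

Lemma density_le a : 0 < a -> normc (f a) <= Ck * ((1 + 2 * B a) / (1 + a)).
Proof.
move=> a0; rewrite /f normcM normc_Cr mulrCA.
have -> : (1 + 2 * B a) * (Ck / (1 + a)) = Ck / (1 + a) * (1 + 2 * B a) by ring.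
by apply: ler_pM; rewrite ?normc_ge0//; [exact: k_le|exact: normc_solution].
Qed.

Lemma Rintegral_window_cst a d x : 0 <= d -> d < a ->
  \int[mu]_(t in `]0, +oo[) (window a d t * x) = x * (2 * d).
Proof.
move=> d0 da; rewrite Rintegral_window// Rintegral_itv_cst; first by ring.
by lra.
Qed.

Lemma integrable_window_cst a d x : d < a ->
  mu.-integrable `]0, +oo[ (EFin \o (fun t => window a d t * x)).
Proof. by move=> da; apply: integrable_window => //; exact: integrable_itv_cst. Qed.

Lemma normc_shift_ge a b t : `|t - a| <= normc (t%:C + ((- a) +i* b) : C) /\
  `|b| <= normc (t%:C + ((- a) +i* b) : C).
Proof.
split; first by have := Re_le_normc (t%:C + ((- a) +i* b)).
by have := Im_le_normc (t%:C + ((- a) +i* b)); rewrite /= add0r.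
Qed.

Lemma Cmeasurable_window a d z :
  Cmeasurable `]0, +oo[ (fun t => (f t - (window a d t)%:C * f a) / (t%:C + z)).
Proof.
apply: CmeasurableM; last exact: Cmeasurable_inv_shift.
rewrite (_ : (fun t => _) = (fun t => f t + (window a d t)%:C * (- f a))).
  apply: CmeasurableD; first exact: Cintegrable_measurable.
  apply: CmeasurableM; last exact: Cmeasurable_cst.
  by apply: Cmeasurable_real; exact: measurable_window.
by apply/funext => t; rewrite mulrN.
Qed.

Lemma Cintegrable_window a b d : d < a -> b != 0 ->
  Cintegrable `]0, +oo[
    (fun t => (f t - (window a d t)%:C * f a) / (t%:C + ((- a) +i* b))).
Proof.
move=> da b0.
have := integrableDR measurable_itv0y (integrableZR (`|b|^-1) measurable_itv0y normf_integrable)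
  (integrable_window_cst (normc (f a) / `|b|) da).
apply: Cintegrable_le => //; first exact: Cmeasurable_window.
move=> t _; have [_ tb] := normc_shift_ge a b t.
have nb0 : 0 < `|b| by rewrite normr_gt0.
rewrite normc_divr.
apply: (@le_trans _ _ ((normc (f t) + window a d t * normc (f a)) / `|b|)); last first.
  by rewrite le_eqVlt; apply/orP; left; apply/eqP; ring.
apply: ler_pM; rewrite ?normc_ge0 ?invr_ge0 ?normc_ge0//.
  apply: le_trans (normcD_le _ _) _; rewrite lerD2l normcN normcM normc_Cr.
  by rewrite ger0_norm// /window; case: ifP.
by rewrite lef_pV2 ?posrE// (lt_le_trans nb0).
Qed.

(* Subtracting f a on the symmetric window [a / 2, 3 a / 2] leaves an integrand
   that is bounded because f is Lipschitz there, and the subtracted pole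
   integrates to a bounded arctangent. *)
Lemma normc_stieltjes_near a b : 0 < a -> b != 0 ->
  normc (stieltjes f ((- a) +i* b)) <=
  2 * (5 * B a + density_lipc a) + 4 * (Ck * ((1 + 2 * B a) / (1 + a))).
Proof.
move=> a0 b0; have d0 : 0 < a / 2 by rewrite divr_gt0.
have da : a / 2 < a by lra.
rewrite (stieltjes_window fi d0 da b0); apply: le_trans (normcD_le _ _) _.
apply: lerD; last first.
  rewrite normcM mulrC; apply: ler_pM; rewrite ?normc_ge0//; last exact: density_le.
  (* The factor of [f a] has modulus 2 |atan| < pi < 4, whatever b is. *)
  rewrite /normc expr0n add0r sqrtr_sqr normrN normrM ger0_norm//.
  have := atan_ltpi2 (a / 2 / b); have := atan_gtNpi2 (a / 2 / b).
  have := pihalf_lt2 R.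
  by move=> *; rewrite -[X in _ <= X]/(4 : R) -ler_pdivlMl// ler_norml; apply/andP; split; lra.
have -> : 5 * B a + density_lipc a = 5 * B a + density_lipc a / a * (2 * (a / 2)).
  by field; rewrite gt_eqF.
rewrite -(Rintegral_window_cst _ (ltW d0) da) -RintegralZl//; last exact: potential_integrable.
have i1 := integrableZR 5 measurable_itv0y (potential_integrable a0).
have i2 := integrable_window_cst (density_lipc a / a) da.
rewrite -RintegralD//.
apply: normc_Cintegral => //; [exact: Cmeasurable_window| |exact: integrableDR].
move=> t /itv0yP t0; rewrite normc_divr.
have [ta tb] := normc_shift_ge a b t.
set N := normc (_ + _) in ta tb *.
have N0 : 0 < N by apply: lt_le_trans tb; rewrite normr_gt0.
have f0 : 0 <= normc (f t) / (t + a) by rewrite divr_ge0 ?normc_ge0// addr_ge0// ltW.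
rewrite ler_pdivrMr// /window; case: ifPn => [tw|tw].
  rewrite !mul1r; have := density_lip a0 (_ : a / 2 <= t <= a + a / 2).
  have la := density_lipc_ge0 a0.
  have la' : 0 <= density_lipc a / a by rewrite divr_ge0// ltW.
  move=> H; apply: le_trans (H _) _; first by move: tw => /andP[? ?]; apply/andP; split; lra.
  by rewrite mulrC; apply: ler_pM => //; rewrite lerDr mulr_ge0.
rewrite !mul0r subr0 addr0.
(* Outside the window |t - a| > a / 2; the extreme case is t = 3 a / 2, where t + a = 5 |t - a|. *)
have taN : t + a <= 5 * N.
  apply: (@le_trans _ _ (5 * `|t - a|)); last by rewrite ler_pM2l.
  move: tw; rewrite negb_and -!ltNge => /orP[?|?].
    by rewrite distrC; have := ler_norm (a - t); lra.
  by have := ler_norm (t - a); lra.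
have -> : 5 * (normc (f t) / (t + a)) * N = normc (f t) * ((5 * N) / (t + a)) by ring.
by rewrite ler_peMr ?normc_ge0// ler_pdivlMr ?mul1r// addr_gt0.
Qed.

Lemma offcut_neq0 z : offcut z -> z != 0.
Proof.
move=> zc; apply/eqP => z0; case: zc; rewrite z0 /=; last by rewrite eqxx.
by rewrite ltxx.
Qed.

(** Three regions. For Re z >= 0, and for |Im z| > - Re z > 0, the modulus |t + z| is comparable to
    t + r, with c = 1/2 and c = 1/4. In the remaining sector around the cut a = - Re z is at least r
    / 2 and the window estimate applies; since B decreases, its value at r / 2 serves in all three
    cases. *)
Lemma normc_stieltjes z : offcut z -> normc (stieltjes f z) <= (10 + 24 * Ck) *
  (B (normc z / 2) + (1 + B (normc z / 2)) / (1 + normc z)).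
Proof.
move=> zc; have r0 : 0 < normc z by rewrite normc_gt0 offcut_neq0.
set r := normc z in r0 *; have r20 : 0 < r / 2 by rewrite divr_gt0.
have Br := potential_ge0 r20; set b := B (r / 2) in Br *.
have Bb s : r / 2 <= s -> B s <= b by exact: potential_mono.
have q0 : 0 <= (1 + b) / (1 + r) by rewrite divr_ge0//; lra.
have far c : 0 < c -> c^-1 <= 4 -> (forall t, 0 < t -> c * (t + r) <= normc (t%:C + z)) ->
    normc (stieltjes f z) <= (10 + 24 * Ck) * (b + (1 + b) / (1 + r)).
  move=> c0 c4 H; apply: le_trans (normc_stieltjes_far c0 r0 H) _.
  have rr : B r <= b by apply: Bb; lra.
  have : c^-1 * B r <= 4 * b.
    by apply: ler_pM => //; [rewrite invr_ge0 ltW|exact: potential_ge0].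
  have : 0 <= Ck * b by rewrite mulr_ge0// ltW.
  have : 0 <= Ck * ((1 + b) / (1 + r)) by rewrite mulr_ge0// ltW.
  lra.
have rE : r ^+ 2 = Re z ^+ 2 + Im z ^+ 2 by exact: normc_sqr.
have [x0|x0] := leP 0 (Re z).
  apply: (far 2^-1); rewrite ?invr_gt0// ?invrK; first by lra.
  move=> t t0; rewrite -(@ler_pXn2r _ 2)// ?nnegrE ?normc_ge0//; last first.
    by apply: mulr_ge0; rewrite ?invr_ge0//; apply: addr_ge0; exact: ltW.
  rewrite normc_sqr ReD ImD /= add0r.
  have : 0 <= t * Re z by rewrite mulr_ge0// ltW.
  have := sqr_ge0 (t - r); nra.
set a := - Re z; have a0 : 0 < a by rewrite oppr_gt0.
have b0 : Im z != 0 by case: zc => // x1; move: (lt_trans x0 x1); rewrite ltxx.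
have zE : z = (- a) +i* Im z by rewrite opprK; case: (z).
have ra : r <= a + `|Im z|.
  by apply: le_trans (normc_le_ReIm z) _; rewrite lerD2r ltr0_norm.
have [ba|ab] := leP `|Im z| a; last first.
  apply: (far 4^-1); rewrite ?invr_gt0// ?invrK; first by lra.
  move=> t t0; rewrite ler_pdivrMl//.
  have [ta tb] := normc_shift_ge a (Im z) t; rewrite -zE in ta tb.
  have := ler_norm (t - a); lra.
have a_r : r / 2 <= a by lra.
have := normc_stieltjes_near a0 b0; rewrite -zE => /le_trans; apply.
have Ba := potential_ge0 a0; have Bab := Bb _ a_r.
have qa : (1 + 2 * B a) / (1 + a) <= 4 * ((1 + b) / (1 + r)).
  have -> : 4 * ((1 + b) / (1 + r)) = (2 * (1 + b)) * (2 / (1 + r)) by ring.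
  apply: ler_pM; [lra|rewrite invr_ge0; lra|lra|].
  rewrite -invf_div lef_pV2 ?posrE//; lra.
rewrite /density_lipc.
have c1 : Ck * ((1 + 2 * B a) / (1 + a)) <= Ck * (4 * ((1 + b) / (1 + r))).
  by rewrite ler_pM2l.
have c2 : Ck * B a <= Ck * b by rewrite ler_pM2l.
have : 0 <= Ck * b by rewrite mulr_ge0// ltW.
lra.
Qed.

(* The difference of the two boundary values is a convolution with the Poisson
   kernel 2 b / ((t - a)^2 + b^2). *)
Lemma stieltjes_jump a e : 0 < a -> 0 < e -> exists2 b0, 0 < b0 &
  forall b, 0 < b < b0 ->
  normc (stieltjes f ((- a) +i* b) - stieltjes f ((- a) +i* (- b)) +
         2 * pi%:C * 'i%C * f a) < e.
Proof.
move=> a0 e0.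
pose la := density_lipc a / a; have la0 : 0 <= la by rewrite divr_ge0 ?density_lipc_ge0// ltW.
(* The window is fixed before b: its Lipschitz part, 4 d la in the end, is then at most e/4. *)
pose d := Num.min (a / 2) (e / (16 * (la + 1))).
have la1 : 0 < la + 1 by lra.
have d0 : 0 < d by rewrite lt_min !divr_gt0// mulr_gt0.
have da2 : d <= a / 2 by rewrite ge_min lexx.
have da : d < a by lra.
have dla : d * la <= e / 16.
  apply: (@le_trans _ _ (e / (16 * (la + 1)) * la)).
    by rewrite ler_wpM2r// ge_min lexx orbT.
  have -> : e / (16 * (la + 1)) * la = e / 16 * (la / (la + 1)).
    by field; rewrite gt_eqF.
  rewrite ler_piMr//; first by rewrite divr_ge0// ltW.
  by rewrite ler_pdivrMr// mul1r lerDl.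
pose F := normc (f a); have F0 : 0 <= F by exact: normc_ge0.
pose th := e / (16 * (F + 1)); have th0 : 0 < th by rewrite divr_gt0// mulr_gt0// ltr_wpDl.
have [X X0 HX] : exists2 X : R, 0 < X & forall x, X <= x -> pi / 2 - th < atan x.
  have /cvgrPdist_lt/(_ th th0)[X [_ HX]] := @cvgy_atan R.
  exists (`|X| + 1); first by rewrite ltr_wpDl.
  move=> x xX; have Xx : X < x by have := ler_norm X; lra.
  by have /ltr_normlP[_] := HX x Xx; lra.
have N0 : 0 <= l1norm by apply: Rintegral_ge0 => t _; exact: normc_ge0.
have d2 : 0 < d ^+ 2 by rewrite exprn_gt0.
(* The first entry puts d / b beyond X, so that 2 pi - 4 atan (d / b) is small; the second makes the
   part outside the window, of weight 2 b / d^2, at most e/4 in the end. *)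
pose b0 := Num.min (d / X) (d ^+ 2 * e / (16 * (l1norm + 1))).
exists b0; first by rewrite lt_min !(divr_gt0, mulr_gt0)//; lra.
move=> b /andP[bgt0]; rewrite lt_min => /andP[bX bN].
have bn0 : b != 0 by rewrite gt_eqF.
have nbn0 : - b != 0 by rewrite oppr_eq0.
rewrite (stieltjes_window fi d0 da bn0) (stieltjes_window fi d0 da nbn0).
rewrite invrN mulrN atanN.
set z : C := (- a) +i* b; set z' : C := (- a) +i* (- b).
set T := atan (d / b).
have -> : Cintegral `]0, +oo[ (fun t => (f t - (window a d t)%:C * f a) / (t%:C + z)) +
      f a * (0 +i* (- (2 * T))) -
      (Cintegral `]0, +oo[ (fun t => (f t - (window a d t)%:C * f a) / (t%:C + z')) +
      f a * (0 +i* (- (2 * - T)))) + 2 * pi%:C * 'i%C * f a =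
    Cintegral `]0, +oo[ (fun t => (f t - (window a d t)%:C * f a) / (t%:C + z) -
      (f t - (window a d t)%:C * f a) / (t%:C + z')) + f a * (0 +i* (2 * pi - 4 * T)).
  rewrite CintegralB//; [|exact: Cintegrable_window|exact: Cintegrable_window].
  have -> : (2 * pi%:C * 'i%C : C) = 0 +i* (2 * pi) by complex_ring.
  have -> : (0 +i* (2 * pi - 4 * T) : C) =
     (0 +i* (- (2 * T))) - (0 +i* (- (2 * - T))) + (0 +i* (2 * pi)) by complex_ring.
  by ring.
have i1 := integrableZR (2 * b / d ^+ 2) measurable_itv0y normf_integrable.
have i2 := integrable_window_cst la da.
have main : normc (Cintegral `]0, +oo[ (fun t =>
      (f t - (window a d t)%:C * f a) / (t%:C + z) -
      (f t - (window a d t)%:C * f a) / (t%:C + z'))) <=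
    2 * (2 * b / d ^+ 2 * l1norm + la * (2 * d)).
  rewrite -(Rintegral_window_cst _ (ltW d0) da) -RintegralZl//; last exact: normf_integrable.
  rewrite -RintegralD//.
  apply: normc_Cintegral => //; last exact: integrableDR.
    apply: Cintegrable_measurable; apply: CintegrableB => //; exact: Cintegrable_window.
  move=> t /itv0yP t0.
  have tz0 : t%:C + z != 0.
    by have [_ tb] := normc_shift_ge a b t; rewrite -normc_gt0 (lt_le_trans _ tb)// normr_gt0.
  have tz'0 : t%:C + z' != 0.
    by have [_ tb] := normc_shift_ge a (- b) t; rewrite -normc_gt0 (lt_le_trans _ tb)// normr_gt0.
  have q0 : 0 < (t - a) ^+ 2 + b ^+ 2 := sqr_shift_gt0 a t bn0.
  have prodE : (t%:C + z) * (t%:C + z') = ((t - a) ^+ 2 + b ^+ 2)%:C by rewrite /z /z'; complex_ring.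
  set g := f t - _.
  have -> : g / (t%:C + z) - g / (t%:C + z') = g * (0 +i* (- (2 * b))) / ((t - a) ^+ 2 + b ^+ 2)%:C.
    have -> : (0 +i* (- (2 * b)) : C) = (t%:C + z') - (t%:C + z) by rewrite /z /z'; complex_ring.
    by rewrite -prodE; field; rewrite tz0 tz'0.
  rewrite normc_divr normcM normc_Cr gtr0_norm//.
  have -> : normc (0 +i* (- (2 * b)) : C) = 2 * b.
    by rewrite /normc expr0n add0r sqrtr_sqr normrN ger0_norm// mulr_ge0// ltW.
  rewrite ler_pdivrMr//.
  have ff0 : 0 <= 2 * b / d ^+ 2 * normc (f t).
    by rewrite mulr_ge0 ?normc_ge0// divr_ge0 ?mulr_ge0 ?ltW.
  rewrite /g /window; case: ifPn => tw.
    rewrite !mul1r.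
    have tw' : a / 2 <= t <= a + a / 2.
      by move: tw => /andP[? ?]; apply/andP; split; lra.
    have := density_lip a0 tw'; rewrite -/la => H.
    (* Since 2 b |t - a| <= (t - a)^2 + b^2, the Poisson kernel times the Lipschitz bound is at most
       la, uniformly in b. *)
    apply: (@le_trans _ _ (`|t - a| * la * (2 * b))).
      by rewrite ler_wpM2r// mulr_ge0// ltW.
    apply: (@le_trans _ _ (la * ((t - a) ^+ 2 + b ^+ 2))); last first.
      by rewrite ler_wpM2r ?lerDr// ltW.
    rewrite -mulrA mulrCA ler_wpM2l// -[in leRHS](real_normK (num_real (t - a))).
    have := sqr_ge0 (`|t - a| - b); nra.
  rewrite !mul0r subr0 addr0.
  have dt : d <= `|t - a|.
    move: tw; rewrite negb_and -!ltNge => /orP[?|?].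
      by rewrite distrC; have := ler_norm (a - t); lra.
    by have := ler_norm (t - a); lra.
  have -> : 2 * b / d ^+ 2 * normc (f t) * ((t - a) ^+ 2 + b ^+ 2) =
    normc (f t) * (2 * b) * (((t - a) ^+ 2 + b ^+ 2) / d ^+ 2) by ring.
  rewrite ler_peMr//.
    by apply: mulr_ge0; [exact: normc_ge0|rewrite mulr_ge0// ltW].
  rewrite ler_pdivlMr// mul1r.
  rewrite -(real_normK (num_real (t - a))).
  have : d ^+ 2 <= `|t - a| ^+ 2 by rewrite ler_pXn2r ?nnegrE// ltW.
  have := sqr_ge0 b; lra.
apply: le_lt_trans (normcD_le _ _) _.
have s1 : 2 * b / d ^+ 2 * l1norm <= e / 8.
  move: bN; rewrite ltr_pdivlMr; last by rewrite mulr_gt0// ltr_wpDl.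
  move=> bN; have -> : 2 * b / d ^+ 2 * l1norm = (2 * b * l1norm) / d ^+ 2 by ring.
  rewrite ler_pdivrMr//; move: bN; clear -bgt0 N0; nra.
have s2 : normc (f a * (0 +i* (2 * pi - 4 * T))) <= e / 4.
  rewrite normcM -/F /normc expr0n add0r sqrtr_sqr.
  have XT : pi / 2 - th < T by apply: HX; rewrite ler_pdivlMr// -ler_pdivlMl// mulrC ltW.
  have Tpi : T < pi / 2 := atan_ltpi2 _.
  have : `|2 * pi - 4 * T| <= 4 * th by rewrite ger0_norm; lra.
  move=> /(ler_wpM2l F0)/le_trans; apply.
  have -> : F * (4 * th) = e / 4 * (F / (F + 1)).
    by rewrite /th; field; rewrite gt_eqF// ltr_wpDl.
  rewrite ler_piMr//; first by rewrite divr_ge0// ltW.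
  by rewrite ler_pdivrMr ?mul1r ?lerDl// ltr_wpDl.
move: main s1 s2 dla e0; clear; lra.
Qed.

End stieltjes_bounds.

(** * The kernel *)

Section kernel_estimates.
Context {R : realType}.
Implicit Types (a b t x y s c : R).

Lemma derive_bound_lip (p dp : R -> R) (l h M : R) :
  (forall x, l <= x <= h -> is_derive x 1 p (dp x)) ->
  (forall x, l <= x <= h -> `|dp x| <= M) ->
  forall x y, l <= x <= h -> l <= y <= h -> `|p x - p y| <= M * `|x - y|.
Proof.
move=> dpP dpM.
have H x y : l <= y -> x <= h -> y <= x -> `|p x - p y| <= M * `|x - y|.
  move=> ly xh yx.
  have inI z : z \in `[y, x]%R -> l <= z <= h.
    by rewrite in_itv /= => /andP[yz zx]; rewrite (le_trans ly) ?(le_trans zx).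
  have [||z zI ->] := @MVT_segment _ p dp y x yx.
  - by move=> z /subset_itv_oo_cc/inI; exact: dpP.
  - apply: continuous_in_subspaceT => z /set_mem/inI/dpP[dz _].
    exact/differentiable_continuous/derivable1_diffP.
  by rewrite normrM ler_wpM2r// dpM// inI.
move=> x y /andP[lx xh] /andP[ly yh].
have [yx|xy] := leP y x; first exact: H.
by rewrite distrC [`|x - y|]distrC; apply: H => //; exact: ltW.
Qed.

Lemma normr_sin_le x : `|sin x| <= `|x|.
Proof.
have := @derive_bound_lip (@sin R) (@cos R) (- `|x|) `|x| 1.
have a1 : - `|x| <= x <= `|x| by rewrite -ler_norml.
have a2 : - `|x| <= 0 <= `|x| by rewrite oppr_le0 normr_ge0.
move=> /(_ _ _ x 0 a1 a2); rewrite sin0 !subr0 mul1r; apply => y _.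
exact: cos_max.
Qed.

(** For t > 1, exp y >= y^N / N! with b N >= 2 produces a factor t^2. For t <= 1 the bound (1 + t)^2
    <= 4 is enough. *)
Lemma expRN_powR_le b s : 0 < b -> 0 < s -> exists2 C : R, 0 < C &
  forall t, 0 < t -> expR (- (t `^ b * s)) <= C / (1 + t) ^+ 2.
Proof.
move=> b0 s0.
pose N := (Num.truncn (2 / b)).+1.
have Nb : 2 <= b * N%:R.
  by rewrite -ler_pdivrMl// mulrC ltW// truncnS_gt.
pose K : R := N`!%:R / s ^+ N.
have K0 : 0 < K by rewrite divr_gt0 ?exprn_gt0// ltr0n fact_gt0.
exists (4 * (1 + K)); first by rewrite mulr_gt0// addr_gt0.
move=> t t0; rewrite ler_pdivlMr ?exprn_gt0 ?addr_gt0//.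
have e0 := expR_gt0 (- (t `^ b * s)).
have [t1|t1] := leP t 1.
  have e1 : expR (- (t `^ b * s)) <= 1.
    by rewrite expR_le1 oppr_le0 mulr_ge0 ?powR_ge0// ltW.
  apply: (@le_trans _ _ (1 * 2 ^+ 2)); last by lra.
  apply: ler_pM; [exact: ltW e0|exact: sqr_ge0|exact: e1|].
  by rewrite ler_pXn2r ?nnegrE//; lra.
have tb : t ^+ 2 <= (t `^ b) ^+ N.
  rewrite -(powR_mulrn N (powR_ge0 t b)) -powRrM -(powR_mulrn 2 (ltW t0)).
  by apply: ler_powR => //; exact: ltW.
have y0 : 0 <= t `^ b * s by rewrite mulr_ge0 ?powR_ge0// ltW.
have := expR_ge1Dxn N.-1 y0; rewrite prednK// => eN.
have : t ^+ 2 / K <= expR (t `^ b * s).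
  apply: le_trans eN; rewrite exprMn /K invf_div mulrA.
  apply: (@le_trans _ _ ((t `^ b) ^+ N * s ^+ N / N`!%:R)); last by rewrite lerDr.
  by rewrite ler_wpM2r ?invr_ge0// ler_wpM2r ?exprn_ge0// ltW.
rewrite ler_pdivrMr// => tK.
apply: (@le_trans _ _ (expR (- (t `^ b * s)) * (4 * t ^+ 2))).
  by rewrite ler_pM2l//; clear -t1; nra.
apply: (@le_trans _ _ (expR (- (t `^ b * s)) * (4 * (expR (t `^ b * s) * K)))).
  by rewrite ler_pM2l// ler_pM2l.
have -> : expR (- (t `^ b * s)) * (4 * (expR (t `^ b * s) * K)) =
    expR (t `^ b * s) * expR (- (t `^ b * s)) * (4 * K) by ring.
by rewrite expRxMexpNx_1 mul1r ler_pM2l// lerDr.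
Qed.

Section fixed_beta.
Variable beta : R.
Hypothesis hbeta : 0 < beta < 1.
Let s := sin (pi * beta / 2).
Let c := cos (pi * beta / 2).
Local Notation K := (kernelK beta).

Lemma kernel_angle : 0 < pi * beta / 2 < pi / 2.
Proof.
have := @pi_gt0 R; move: hbeta => /andP[b0 b1] p0.
by rewrite divr_gt0 ?mulr_gt0//= ltr_pM2r// gtr_pMr.
Qed.

Lemma kernel_sin_gt0 : 0 < s. Proof. exact/sin_gt0_pihalf/kernel_angle. Qed.

Lemma kernel_cos_le1 : `|c| <= 1. Proof. exact: cos_max. Qed.

Lemma pi_inv_le : 0 < (pi : R)^-1 <= 1.
Proof.
rewrite invr_gt0 pi_gt0 /= invf_le1 ?pi_gt0//.
by apply: le_trans (@pi_ge2 R); lra.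
Qed.

Lemma measurable_kernelK (D : set R) : measurable_fun D K.
Proof.
have mp : measurable_fun D (fun t => t `^ beta).
  by apply: (measurable_funS measurableT) => //; exact: measurable_powR.
apply: measurable_funM => //; apply: measurable_funM.
  apply: (measurableT_comp (@measurable_expR R)).
  by apply: measurable_funN; apply: measurable_funM.
apply: (measurableT_comp (continuous_measurable_fun (@continuous_sin R))).
by apply: measurable_funM.
Qed.

(** The decay serves integrability and the behaviour at infinity; the order t^beta, from |sin x| <=
    |x|, serves the growth at the origin; the Lipschitz bound at scale a serves points close to the
    cut. *)
Lemma kernelK_bound : exists C : R, [/\ 0 < C,
  forall t, 0 < t -> `|K t| <= C / (1 + t) ^+ 2,
  forall t, 0 < t -> `|K t| <= C * t `^ beta &
  forall a t, 0 < a -> a / 2 <= t <= a + a / 2 ->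
    `|K t - K a| <= C * `|t - a| / (a * (1 + a))].
Proof.
have /andP[b0 b1] := hbeta; have s0 := kernel_sin_gt0.
have /andP[p0 p1] := pi_inv_le.
have [C1 C10 H1] := expRN_powR_le b0 s0.
have s20 : 0 < s / 2 by rewrite divr_gt0.
(* In the derivative, half of the exponent absorbs the factor x = t^beta through x exp(- x s / 2) <=
   2 / s, and the other half supplies the decay. The remaining 2 in M bounds the trigonometric
   factor. *)
have [C2 C20 H2] := expRN_powR_le b0 s20.
pose M := 4 / s * C2.
have M0 : 0 < M by rewrite mulr_gt0// divr_gt0.
exists (C1 + 1 + 4 * M); split; first by lra.
- move=> t t0; apply: (@le_trans _ _ (C1 / (1 + t) ^+ 2)); last first.
    rewrite ler_wpM2r ?invr_ge0 ?sqr_ge0//; lra.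
  apply: le_trans (H1 t t0); rewrite /kernelK -/s -/c !normrM.
  rewrite gtr0_norm// (ger0_norm (expR_ge0 _)).
  apply: (@le_trans _ _ (1 * (expR (- (t `^ beta * s)) * 1))); last by rewrite mul1r mulr1.
  apply: ler_pM; [exact: ltW|by rewrite mulr_ge0 ?expR_ge0|exact: p1|].
  by rewrite ler_wpM2l ?expR_ge0// sin_max.
- move=> t t0; apply: (@le_trans _ _ (1 * t `^ beta)); last first.
    rewrite ler_wpM2r ?powR_ge0//; lra.
  rewrite /kernelK -/s -/c !normrM gtr0_norm// (ger0_norm (expR_ge0 _)).
  apply: ler_pM; [exact: ltW|by rewrite mulr_ge0 ?expR_ge0|exact: p1|].
  rewrite -[leRHS]mul1r; apply: ler_pM; [exact: expR_ge0|exact: normr_ge0| |].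
    by rewrite expR_le1 oppr_le0 mulr_ge0 ?powR_ge0// ltW.
  apply: le_trans (normr_sin_le _) _; rewrite normrM ger0_norm ?powR_ge0//.
  by rewrite ler_piMr ?powR_ge0// kernel_cos_le1.
pose dK t := pi^-1 * (beta * t `^ (beta - 1) * (expR (- (t `^ beta * s)) *
   (c * cos (t `^ beta * c) - s * sin (t `^ beta * c)))).
have dKP t : 0 < t -> is_derive t (1 : R) K (dK t).
  move=> t0; have D := is_derive1_powR beta t0.
  have D1 : is_derive t (1 : R) (fun t => - (t `^ beta * s)) (- (beta * t `^ (beta - 1) * s)).
    rewrite (_ : (fun t => _) = - (s *: (fun t : R => t `^ beta))).
      by apply: is_derive_eq; rewrite /GRing.scale /= mulrC.
    by apply/funext => x; rewrite /= /GRing.scale /= mulrC.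
  have D2 : is_derive t (1 : R) (fun t => t `^ beta * c) (beta * t `^ (beta - 1) * c).
    rewrite (_ : (fun t => _) = c *: (fun t : R => t `^ beta)).
      by apply: is_derive_eq; rewrite /GRing.scale /= mulrC.
    by apply/funext => x; rewrite /= /GRing.scale /= mulrC.
  have D3 : is_derive t (1 : R) (fun t => expR (- (t `^ beta * s)))
      (expR (- (t `^ beta * s)) * - (beta * t `^ (beta - 1) * s)).
    exact: (is_derive1_comp (is_derive_expR _) D1).
  have D4 : is_derive t (1 : R) (fun t => sin (t `^ beta * c))
      (cos (t `^ beta * c) * (beta * t `^ (beta - 1) * c)).
    exact: (is_derive1_comp (is_derive_sin _) D2).
  rewrite /kernelK -/s -/c.
  rewrite (_ : (fun t => _) = pi^-1 *: ((fun t => expR (- (t `^ beta * s))) *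
     (fun t => sin (t `^ beta * c)))); last by apply/funext.
  by apply: is_derive_eq; rewrite /dK /GRing.scale /=; ring.
have dKM t : 0 < t -> `|dK t| <= M / (t * (1 + t) ^+ 2).
  move=> t0; pose x := t `^ beta; have x0 : 0 < x by exact: powR_gt0.
  have tb : t `^ (beta - 1) = x / t.
    rewrite powRB; last by rewrite (gt_eqF t0) implybT.
    by rewrite powRr1// ltW.
  rewrite /dK tb -/x !normrM (ger0_norm (expR_ge0 _)) (gtr0_norm p0) (gtr0_norm b0).
  rewrite (gtr0_norm x0) normfV (gtr0_norm t0).
  have trig : `|c * cos (x * c) - s * sin (x * c)| <= 2.
    apply: le_trans (ler_normB _ _) _; rewrite !normrM (_ : 2 = 1 * 1 + 1 * 1); last by ring.
    apply: lerD; apply: ler_pM => //; [exact: kernel_cos_le1|exact: cos_max|exact: sin_max|exact: sin_max].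
  have xe : x * expR (- (x * s)) <= 2 / s * (C2 / (1 + t) ^+ 2).
    have -> : - (x * s) = - (x * (s / 2)) + - (x * (s / 2)) by field.
    rewrite expRD mulrA; apply: ler_pM; [|exact: expR_ge0| |exact: H2].
      by rewrite mulr_ge0 ?expR_ge0// ltW.
    rewrite expRN ler_pdivrMr ?expR_gt0//.
    have := expR_ge1Dx (x * (s / 2)) => e1.
    rewrite mulrAC ler_pdivlMr//; move: e1; set E := expR _; lra.
  apply: (@le_trans _ _ (1 * (1 * (x / t) * (expR (- (x * s)) * 2)))).
    have xt0 : 0 <= x / t by rewrite divr_ge0// ltW.
    have be0 : 0 <= beta * (x / t) by rewrite mulr_ge0// ltW.
    apply: ler_pM.
    - exact: ltW.
    - by rewrite mulr_ge0// mulr_ge0 ?expR_ge0.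
    - exact: p1.
    apply: ler_pM.
    - exact: be0.
    - by rewrite mulr_ge0 ?expR_ge0.
    - by rewrite ler_wpM2r// ltW.
    - by rewrite ler_wpM2l ?expR_ge0.
  have -> : 1 * (1 * (x / t) * (expR (- (x * s)) * 2)) = (x * expR (- (x * s))) * (2 / t).
    by ring.
  have -> : M / (t * (1 + t) ^+ 2) = 2 / s * (C2 / (1 + t) ^+ 2) * (2 / t).
    by rewrite /M; field; rewrite !gt_eqF// addr_gt0.
  by rewrite ler_pM2r// divr_gt0.
move=> a t a0 ta.
have aa : a / 2 <= a <= a + a / 2 by apply/andP; split; lra.
have x0 x : a / 2 <= x <= a + a / 2 -> 0 < x by move=> /andP[? _]; lra.
(* Mean value inequality; the 4 comes from a <= 2 x and 1 + a <= 2 (1 + x)^2 for x >= a / 2. *)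
apply: (@le_trans _ _ (4 * M / (a * (1 + a)) * `|t - a|)).
  apply: (@derive_bound_lip K dK (a / 2) (a + a / 2)) => // x xa.
    by apply: dKP; exact: x0.
  apply: le_trans (dKM _ (x0 _ xa)) _.
  have aa0 : 0 < a * (1 + a) by rewrite mulr_gt0// addr_gt0.
  have -> : 4 * M / (a * (1 + a)) = M / (a * (1 + a) / 4).
    by field; rewrite !gt_eqF// addr_gt0.
  rewrite ler_pM2l// lef_pV2 ?posrE; last 2 first.
  - by rewrite mulr_gt0 ?exprn_gt0 ?addr_gt0// x0.
  - by rewrite divr_gt0.
  rewrite ler_pdivrMr//; have xx := x0 _ xa; move: xa => /andP[xa _].
  apply: (@le_trans _ _ ((2 * x) * (2 * (1 + x) ^+ 2))); last by lra.
  by apply: ler_pM; [lra|lra|lra|nra].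
have -> : (C1 + 1 + 4 * M) * `|t - a| / (a * (1 + a)) =
   (C1 + 1 + 4 * M) / (a * (1 + a)) * `|t - a| by ring.
rewrite ler_wpM2r// ler_wpM2r ?invr_ge0 ?mulr_ge0//; lra.
Qed.

End fixed_beta.
End kernel_estimates.

(** * Growth at the origin *)

Section potential_near_0.
Context {R : realType}.
Local Notation C := (Cplx R).
Local Notation mu := (@lebesgue_measure R).
Implicit Types (a b d r t x p : R).

Lemma integrable_inv_sqr :
  mu.-integrable `]0, +oo[ (EFin \o (fun t : R => (1 + t) ^- 2)).
Proof.
have cV t : 0 <= t -> {for t, continuous (fun t : R => (1 + t) ^- 2)}.
  move=> t0; apply: cvgV; first by rewrite gt_eqF// exprn_gt0// ltr_wpDr.
  by apply: cvgM; apply: cvgD; [exact: cvg_cst|exact: cvg_id|exact: cvg_cst|exact: cvg_id].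
have dF t : 0 <= t -> is_derive t (1 : R) (fun t : R => - (1 + t)^-1) ((1 + t) ^- 2).
  move=> t0; have t1 : 1 + t != 0 by rewrite gt_eqF// ltr_wpDr.
  have D : is_derive t (1 : R) (fun t : R => 1 + t) 1.
    by apply: is_derive_eq; rewrite add0r mulr1.
  have DV := is_deriveV t1 D.
  rewrite (_ : (fun t : R => _) = - (fun t : R => (1 + t)^-1)); last by apply/funext.
  by apply: is_derive_eq; rewrite /GRing.scale/= mulr1 opprK.
have itvsub : (`]0, +oo[%classic : set R) `<=` `[0, +oo[%classic.
  by move=> t /=; rewrite !in_itv /= !andbT => /ltW.
suff H : mu.-integrable `[0, +oo[ (EFin \o (fun t : R => (1 + t) ^- 2)).
  exact: integrableS H.
have cw : {within `[0, +oo[, continuous (fun t : R => (1 + t) ^- 2)}.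
  apply: continuous_in_subspaceT => t; rewrite mem_setE in_itv /= andbT; exact: cV.
apply/integrableP; split.
  apply/measurable_EFinP; apply: subspace_continuous_measurable_fun => //.
under eq_integral.
  move=> t _; rewrite /= ger0_norm; last by rewrite invr_ge0 sqr_ge0.
  over.
rewrite (@ge0_continuous_FTC2y _ _ (fun t : R => - (1 + t)^-1) 0 0) ?ltry//.
- by move=> x _; rewrite invr_ge0 sqr_ge0.
- apply/cvgrPdist_lt => e e0; exists (e^-1); split; first exact: num_real.
  move=> x ex; have x0 : 0 < x by apply: lt_trans ex; rewrite invr_gt0.
  rewrite sub0r opprK gtr0_norm ?invr_gt0 ?addr_gt0//.
  by rewrite -[e]invrK ltf_pV2 ?posrE ?invr_gt0 ?addr_gt0// ltr_wpDl.
- by move=> x x0; have [] := dF x (ltW x0).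
- apply: cvg_at_right_filter.
  have [d0 _] := dF 0 (lexx _).
  exact: (differentiable_continuous ((derivable1_diffP _ _).1 d0)).
- move=> x; rewrite in_itv /= andbT => x0.
  by rewrite derive1E; have [_ ->] := dF x (ltW x0).
Qed.

(** The model integrals: p = beta - 1 bounds the contribution of the constant 1 in u, and p = 2 beta
    - 2 that of u - 1. The latter exponent is -1 exactly for beta = 1/2, whence the logarithm. *)
Definition powint p r := \int[mu]_(t in `[0, 1]) ((t + r) `^ p).

Lemma is_derive_powR_shift p r t : 0 < t + r ->
  is_derive t (1 : R) (fun t => (t + r) `^ p) (p * (t + r) `^ (p - 1)).
Proof.
move=> tr; have D : is_derive t (1 : R) (fun t : R => t + r) 1.
  by apply: is_derive_eq; rewrite addr0 ?mulr1.
have := @is_derive1_comp _ (@powR R ^~ p) (fun t => t + r) t _ _ (is_derive1_powR p tr) D.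
by rewrite mulr1.
Qed.

Lemma continuous_powR_shift p r t : 0 < t + r ->
  {for t, continuous (fun t => (t + r) `^ p)}.
Proof.
move=> tr; have [d _] := is_derive_powR_shift p tr.
exact: (differentiable_continuous ((derivable1_diffP _ _).1 d)).
Qed.

Lemma within_powR_shift p r : 0 < r ->
  {within `[0, 1], continuous (fun t => (t + r) `^ p)}.
Proof.
move=> r0; apply: continuous_in_subspaceT => t; rewrite mem_setE in_itv /=.
by move=> /andP[t0 _]; apply: continuous_powR_shift; rewrite ltr_wpDl.
Qed.

Lemma integrable_powR_shift p r : 0 < r ->
  mu.-integrable `[0, 1] (EFin \o (fun t => (t + r) `^ p)).
Proof.
move=> r0; apply: continuous_compact_integrable; first exact: segment_compact.
exact: within_powR_shift.
Qed.

Lemma powintE p r : p + 1 != 0 -> 0 < r ->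
  powint p r = ((1 + r) `^ (p + 1) - r `^ (p + 1)) / (p + 1).
Proof.
move=> p1 r0.
have dF t : 0 <= t <= 1 ->
    is_derive t (1 : R) (fun t => (p + 1)^-1 * (t + r) `^ (p + 1)) ((t + r) `^ p).
  move=> /andP[t0 _]; have D := is_derive_powR_shift (p + 1) (ltr_wpDl t0 r0).
  rewrite (_ : (fun t => _) = (p + 1)^-1 *: (fun t => (t + r) `^ (p + 1))); last by apply/funext.
  by apply: is_derive_eq; rewrite /GRing.scale /= addrK mulrA mulVf// mul1r.
rewrite /powint (Rintegral_FTC ltr01 dF); last exact: within_powR_shift.
by rewrite add0r -mulrBr mulrC.
Qed.

Lemma powint_N1 r : 0 < r -> powint (- 1) r = ln (1 + r) - ln r.
Proof.
move=> r0.
have dF t : 0 <= t <= 1 -> is_derive t (1 : R) (fun t => ln (t + r)) ((t + r) `^ (- 1)).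
  move=> /andP[t0 _]; have tr := ltr_wpDl t0 r0.
  have D : is_derive t (1 : R) (fun t : R => t + r) 1.
    by apply: is_derive_eq; rewrite addr0 ?mulr1.
  have := @is_derive1_comp _ (@ln R) (fun t => t + r) t _ _ (is_derive1_ln tr) D.
  by rewrite mulr1 powR_inv1// ltW.
rewrite /powint (Rintegral_FTC ltr01 dF); last exact: within_powR_shift.
by rewrite add0r.
Qed.

Variables (beta : R) (k : R -> R) (u : R -> C) (Ck : R).
Hypothesis hbeta : 0 < beta < 1.
Hypothesis Ck0 : 0 < Ck.
Hypothesis mk : measurable_fun (`]0, +oo[ : set R) k.
Hypothesis k_dec : forall t, 0 < t -> `|k t| <= Ck / (1 + t) ^+ 2.
Hypothesis k_0 : forall t, 0 < t -> `|k t| <= Ck * t `^ beta.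
Hypothesis u2 : in_L2 `[0, +oo[ (fun t => u t - 1).
Let f (t : R) : C := (k t)%:C * u t.

Lemma L2_half (q : R -> R) : q \_ `[0, +oo[ \in Lfun mu 2%:E ->
  measurable_fun (`]0, +oo[ : set R) q /\
  mu.-integrable `]0, +oo[ (EFin \o (fun t => q t ^+ 2)).
Proof.
move=> q2.
have qE : {in `]0, +oo[%classic, q \_ `[0, +oo[ =1 q}.
  move=> t /set_mem/itv0yP t0; rewrite patchE mem_setE in_itv /= andbT.
  by rewrite ltW.
split.
  have : measurable_fun setT (q \_ `[0, +oo[) by have := sub_Lfun_mfun q2; rewrite inE.
  move=> m1; apply: (eq_measurable_fun _ qE).
  by apply: measurable_funS m1.
have i1 : mu.-integrable `]0, +oo[ (EFin \o (fun t => (q \_ `[0, +oo[) t ^+ 2)).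
  by apply: integrableS (Lfun2_integrable_sqr q2).
by apply: eq_integrable i1 => // t /qE /= ->.
Qed.

Lemma L2_measurable : Cmeasurable `]0, +oo[ u.
Proof.
have [m1 _] := L2_half u2.1; have [m2 _] := L2_half u2.2.
have -> : u = (fun t => (u t - 1) + 1) by apply/funext => t; rewrite subrK.
by apply: CmeasurableD; [split|exact: Cmeasurable_cst].
Qed.

Lemma L2_integrable_sqr :
  mu.-integrable `]0, +oo[ (EFin \o (fun t => normc (u t - 1) ^+ 2)).
Proof.
have [_ i1] := L2_half u2.1; have [_ i2] := L2_half u2.2.
have := integrableDR measurable_itv0y i1 i2; apply: eq_integrable => // t _ /=.
by rewrite normc_sqr.
Qed.

Lemma Cmeasurable_density : Cmeasurable `]0, +oo[ f.
Proof. by apply: CmeasurableM; [exact: Cmeasurable_real|exact: L2_measurable]. Qed.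

(* AM-GM with a free weight l replaces the Cauchy-Schwarz inequality; near the
   origin l = r^(beta - 1/2) is the right choice when beta < 1/2. *)
Lemma density_amgm (l x y : R) t : 0 < l -> 0 <= y -> `|k t| * y <= x ->
  normc (f t) * y <= x + 2^-1 * (l * normc (u t - 1) ^+ 2 + l^-1 * x ^+ 2).
Proof.
move=> l0 y0 kx; rewrite /f normcM normc_Cr.
have x0 : 0 <= x by apply: le_trans kx; rewrite mulr_ge0.
set v := normc (u t - 1); have v0 : 0 <= v by exact: normc_ge0.
have uv : normc (u t) <= 1 + v.
  by rewrite -[u t](subrK 1) addrC; apply: le_trans (normcD_le _ _) _; rewrite normc1.
apply: (@le_trans _ _ (x * (1 + v))).
  rewrite mulrAC; apply: ler_pM => //; rewrite ?normc_ge0//.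
  by rewrite mulr_ge0.
rewrite mulrDr mulr1 lerD2l.
have -> : 2^-1 * (l * v ^+ 2 + l^-1 * x ^+ 2) = x * v + 2^-1 * l^-1 * (l * v - x) ^+ 2.
  by field; rewrite gt_eqF.
by rewrite lerDl mulr_ge0 ?sqr_ge0// mulr_ge0 ?invr_ge0// ltW.
Qed.

(** The bound on k is integrable together with its square, and u is 1 plus an L_2 function; AM-GM
    with weight 1 handles the product. *)
Lemma density_integrable : Cintegrable `]0, +oo[ f.
Proof.
have i2 := integrableZR 1 measurable_itv0y L2_integrable_sqr.
have i1 := integrableZR Ck measurable_itv0y integrable_inv_sqr.
have i3 := integrableZR (Ck ^+ 2) measurable_itv0y integrable_inv_sqr.
have i4 := integrableZR 2^-1 measurable_itv0y (integrableDR measurable_itv0y i2 i3).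
apply: Cintegrable_le (integrableDR measurable_itv0y i1 i4) => //; first exact: Cmeasurable_density.
move=> t /itv0yP t0.
have kt := k_dec t0.
have := @density_amgm 1 (Ck / (1 + t) ^+ 2) 1 t ltr01 ler01; rewrite !mulr1 => /(_ kt).
move/le_trans; apply; rewrite lerD2l ler_pM2l ?invr_gt0// lerD2l invr1 mul1r.
rewrite exprMn ler_wpM2l ?sqr_ge0// expr2 ler_piMl ?invr_ge0 ?sqr_ge0//.
by rewrite invf_le1 ?exprn_gt0 ?addr_gt0// exprn_ege1// lerDl ltW.
Qed.

(** Beyond t = 1 the weight 1 / (t + r) is at most 1. On ]0, 1], t^beta <= (t + r)^beta lets
    [density_amgm] run with x = Ck (t + r)^(beta - 1). The weight l stays free because its best
    value depends on beta. *)
Lemma potential_split r (l : R) : 0 < r -> 0 < l ->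
  potential k u r <= l1norm k u +
    (Ck * powint (beta - 1) r + 2^-1 * (l * (\int[mu]_(t in `]0, +oo[) (normc (u t - 1) ^+ 2)) +
       l^-1 * (Ck ^+ 2 * powint (2 * beta - 2) r))).
Proof.
move=> r0 l0.
have /andP[b0 b1] := hbeta.
have i01 : (`]0, 1]%classic : set R) `<=` `]0, +oo[%classic.
  by move=> t /=; rewrite !in_itv /= andbT => /andP[].
have i1y : (`]1, +oo[%classic : set R) `<=` `]0, +oo[%classic.
  by move=> t /=; rewrite !in_itv /= !andbT; apply: lt_trans.
have pint := potential_integrable density_integrable r0.
have := @Rintegral_itvB _ _ (BRight 0) +oo%O 1 pint.
rewrite !bnd_simp => /(_ ler01 erefl) /eqP; rewrite subr_eq => /eqP.
rewrite /potential => ->.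
apply: lerD.
  rewrite /l1norm.
  have nint := normf_integrable density_integrable.
  have := @Rintegral_itvB _ _ (BRight 0) +oo%O 1 nint.
  rewrite !bnd_simp => /(_ ler01 erefl) /eqP; rewrite subr_eq => /eqP ->.
  apply: (@le_trans _ _ (\int[mu]_(t in `]1, +oo[) normc (f t))); last first.
    by rewrite lerDl; apply: Rintegral_ge0 => t _; exact: normc_ge0.
  apply: le_Rintegral => //.
  - exact: integrableS pint.
  - exact: integrableS nint.
  move=> t; rewrite /= in_itv /= andbT => t1; rewrite ler_pdivrMr; last by lra.
  by rewrite ler_peMr ?normc_ge0//; lra.
have sub01 : (`]0, 1]%classic : set R) `<=` `[0, 1]%classic.
  by move=> t /=; rewrite !in_itv /= => /andP[/ltW-> ->].
have mo1 : measurable (`]0, 1]%classic : set R) by exact: measurable_itv.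
have sp p : mu.-integrable `]0, 1] (EFin \o (fun t => (t + r) `^ p)).
  by apply: integrableS (integrable_powR_shift p r0).
have su : mu.-integrable `]0, 1] (EFin \o (fun t => normc (u t - 1) ^+ 2)).
  by apply: integrableS L2_integrable_sqr.
have j1 := integrableZR Ck mo1 (sp (beta - 1)).
have j2 := integrableZR l mo1 su.
have j3' := integrableZR (Ck ^+ 2) mo1 (sp (2 * beta - 2)).
have j3 := integrableZR l^-1 mo1 j3'.
have j4 := integrableZR 2^-1 mo1 (integrableDR mo1 j2 j3).
apply: (@le_trans _ _ (\int[mu]_(t in `]0, 1]) (Ck * (t + r) `^ (beta - 1) +
   2^-1 * (l * normc (u t - 1) ^+ 2 + l^-1 * (Ck ^+ 2 * (t + r) `^ (2 * beta - 2)))))).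
  apply: le_Rintegral => //.
  - exact: integrableS pint.
  - exact: integrableDR.
  move=> t; rewrite /= in_itv /= => /andP[t0 _].
  have tr0 : 0 < t + r by rewrite addr_gt0.
  have tr1 : (t + r) `^ (beta - 1) = (t + r) `^ beta / (t + r).
    by rewrite powRB ?powRr1 ?ltW//; rewrite (gt_eqF tr0) implybT.
  have := @density_amgm l (Ck * (t + r) `^ (beta - 1)) (t + r)^-1 t l0.
  have -> : (Ck * (t + r) `^ (beta - 1)) ^+ 2 = Ck ^+ 2 * (t + r) `^ (2 * beta - 2).
    rewrite exprMn -(powR_mulrn 2 (powR_ge0 _ _)) -powRrM.
    by congr (_ * _ `^ _); ring.
  apply; first by rewrite invr_ge0 ltW.
  rewrite tr1 mulrA; apply: ler_wpM2r; first by rewrite invr_ge0 ltW.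
  apply: le_trans (k_0 t0) _; rewrite ler_pM2l//.
  by apply: ge0_ler_powR; rewrite ?nnegrE; lra.
have pE p : \int[mu]_(t in `]0, 1]) ((t + r) `^ p) = powint p r.
  by rewrite Rintegral_itv_obnd_cbnd.
have uu : \int[mu]_(t in `]0, 1]) (normc (u t - 1) ^+ 2) <=
    \int[mu]_(t in `]0, +oo[) (normc (u t - 1) ^+ 2).
  have := @Rintegral_itvB _ _ (BRight 0) +oo%O 1 L2_integrable_sqr.
  rewrite !bnd_simp => /(_ ler01 erefl) /eqP; rewrite subr_eq => /eqP ->.
  by rewrite lerDr; apply: Rintegral_ge0 => t _; rewrite sqr_ge0.
have j5 := integrableDR mo1 j2 j3.
rewrite RintegralD// RintegralZl// RintegralZl// RintegralD// !RintegralZl//.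
by rewrite !pE lerD2l ler_pM2l ?invr_gt0// lerD2r ler_pM2l.
Qed.

(** [epsbeta] as a function of the modulus alone; the two are convertible. *)
Definition epsilon_beta (b r : R) : R :=
  if 2^-1 < b then 1 else if b == 2^-1 then ln r else r `^ (b - 2^-1).

(** For beta > 1/2 the integral [powint (2 * beta - 2)] stays bounded and for beta = 1/2 it is a
    logarithm, so l = 1 suffices in both cases. For beta < 1/2 it blows up and l has to follow r. *)
Lemma potential_bound : exists2 M : R, 0 < M & exists2 r0 : R, 0 < r0 <= 1 &
  forall r, 0 < r -> r < r0 -> 1 + potential k u (r / 2) <= M * `|epsilon_beta beta r|.
Proof.
have /andP[b0 b1] := hbeta.
pose N := l1norm k u; pose V := \int[mu]_(t in `]0, +oo[) (normc (u t - 1) ^+ 2).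
have N0 : 0 <= N by apply: Rintegral_ge0 => t _; exact: normc_ge0.
have V0 : 0 <= V by apply: Rintegral_ge0 => t _; exact: sqr_ge0.
have pb r : 0 < r -> r <= 1 -> powint (beta - 1) r <= 2 / beta.
  move=> r0 r1; rewrite powintE// subrK ?gt_eqF// ler_pM2r ?invr_gt0//.
  have : (1 + r) `^ beta <= 2.
    apply: (@le_trans _ _ (2 `^ beta)).
      by apply: ge0_ler_powR; rewrite ?nnegrE; lra.
    by apply: ler1_powR; lra.
  have := powR_ge0 r beta; lra.
(* The sum of all the constants, so that each coefficient in [potential_split] is at most A. *)
pose A := 1 + N + Ck * (2 / beta) + V + Ck ^+ 2.
have A1 : 1 <= A.
  have : 0 <= Ck * (2 / beta) by rewrite mulr_ge0 ?divr_ge0 ?ltW.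
  have := sqr_ge0 Ck; rewrite /A; lra.
have gen r l : 0 < r -> r <= 1 -> 0 < l ->
    1 + potential k u r <= A * (1 + l + l^-1 * powint (2 * beta - 2) r).
  move=> r0 r1 l0; have := potential_split r0 l0; rewrite -/V -/N.
  have := pb r r0 r1; rewrite -(ler_pM2l Ck0).
  have : 0 <= powint (2 * beta - 2) r by apply: Rintegral_ge0 => t _; exact: powR_ge0.
  move: (powint (2 * beta - 2) r) (powint (beta - 1) r) => P P1 P0.
  have : 0 <= l^-1 * P by rewrite mulr_ge0 ?invr_ge0// ltW.
  rewrite [l^-1 * (_ * P)]mulrCA; move: (l^-1 * P) => Q Q0 h1 h2.
  have hc : 0 <= Ck * (2 / beta) by rewrite mulr_ge0 ?divr_ge0 ?ltW.
  have c2 := sqr_ge0 Ck.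
  have m1 : 0 <= V * Q by rewrite mulr_ge0.
  have m2 : 0 <= N * Q by rewrite mulr_ge0.
  have m3 : 0 <= Ck * (2 / beta) * Q by rewrite mulr_ge0.
  have m4 : 0 <= Ck ^+ 2 * Q by rewrite mulr_ge0.
  have m5 : 0 <= l * N by rewrite mulr_ge0// ltW.
  have m6 : 0 <= l * (Ck * (2 / beta)) by rewrite mulr_ge0// ltW.
  have m7 : 0 <= l * Ck ^+ 2 by rewrite mulr_ge0// ltW.
  have m8 : 0 <= l * V by rewrite mulr_ge0// ltW.
  rewrite /A; move: h1 h2 hc c2 m1 m2 m3 m4 m5 m6 m7 m8 l0 Q0 N0 V0.
  move: (Ck * (2 / beta)) (Ck ^+ 2) => c1 c2; clear; lra.
have A0 : 0 < A by lra.
rewrite /epsilon_beta; have [bh|bh] := ltP 2^-1 beta.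
  pose D := 2 / (2 * beta - 1); have d0 : 0 < 2 * beta - 1 by lra.
  exists (A * (2 + D)); first by rewrite mulr_gt0// addr_gt0// divr_gt0.
  exists 1; first by rewrite ltr01 lexx.
  move=> r r0 r1; rewrite normr1 mulr1.
  have r20 : 0 < r / 2 by rewrite divr_gt0.
  have r21 : r / 2 <= 1 by lra.
  apply: le_trans (gen _ 1 r20 r21 ltr01) _.
  rewrite ler_pM2l// invr1 mul1r lerD//.
  have e1 : 2 * beta - 2 + 1 = 2 * beta - 1 by ring.
  rewrite powintE ?e1 ?gt_eqF// /D ler_pM2r ?invr_gt0//.
  have : (1 + r / 2) `^ (2 * beta - 1) <= 2.
    apply: (@le_trans _ _ (2 `^ (2 * beta - 1))).
      by apply: ge0_ler_powR; rewrite ?nnegrE; lra.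
    by apply: ler1_powR; lra.
  have := powR_ge0 (r / 2) (2 * beta - 1); lra.
have [be|bn] := eqVneq beta 2^-1.
  (* Below exp(-1) one has |ln r| > 1. The bound is A times at most 2 + ln (1 + r / 2) + ln 2 - ln
     r, and both positive logarithms are at most 1, which gives 4 + |ln r| <= 5 |ln r|. *)
  exists (A * 5); first by rewrite mulr_gt0.
  exists (expR (-1)); first by rewrite expR_gt0 expR_le1 lerN10.
  move=> r r0 rl.
  have lr : ln r < -1 by rewrite -(expRK (-1)) ltr_ln ?posrE ?expR_gt0.
  have r1 : r <= 1 by apply: ltW; apply: lt_le_trans rl _; rewrite expR_le1 lerN10.
  have r20 : 0 < r / 2 by rewrite divr_gt0.
  have r21 : r / 2 <= 1 by lra.
  apply: le_trans (gen _ 1 r20 r21 ltr01) _.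
  rewrite -mulrA ler_pM2l// invr1 mul1r.
  have -> : 2 * beta - 2 = -1 by rewrite be; field.
  rewrite powint_N1// ltr0_norm; last by apply: lt_trans lr _; rewrite ltrN10.
  have h1 : ln (1 + r / 2) <= 1.
    rewrite -[leRHS](expRK 1).
    rewrite ler_ln ?posrE ?expR_gt0//; last by lra.
    by have := expR_ge1Dx (1 : R); lra.
  have h2 : ln 2 <= 1 :> R.
    rewrite -[leRHS](expRK 1).
    by rewrite ler_ln ?posrE ?expR_gt0//; have := expR_ge1Dx (1 : R); lra.
  rewrite ln_div ?posrE//; lra.
have bl : beta < 2^-1 by rewrite lt_neqAle bn.
pose D := 2 / (1 - 2 * beta); have d0 : 0 < 1 - 2 * beta by lra.
have D0 : 0 < D by rewrite divr_gt0.
exists (A * (2 + D)); first by rewrite mulr_gt0// addr_gt0.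
exists 1; first by rewrite ltr01 lexx.
move=> r r0 r1.
have r20 : 0 < r / 2 by rewrite divr_gt0.
have r21 : r / 2 <= 1 by lra.
(* This weight balances the two terms: [powint (2 * beta - 2) (r / 2)] is at most D l^2, so l^-1
   times it is again of order l. *)
pose l := r `^ (beta - 2^-1); have l0 : 0 < l by exact: powR_gt0.
have l1 : 1 <= l.
  by rewrite -(powRr0 r); apply: ger_powR; [rewrite r0 ltW|lra].
rewrite ger0_norm ?powR_ge0// -/l.
apply: le_trans (gen _ l r20 r21 l0) _; rewrite -mulrA ler_pM2l//.
have e1 : 2 * beta - 2 + 1 = 2 * beta - 1 by ring.
have q0 : 2 * beta - 1 != 0 by rewrite lt_eqF//; lra.
have : powint (2 * beta - 2) (r / 2) <= D * l ^+ 2.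
  rewrite powintE ?e1//.
  have -> : ((1 + r / 2) `^ (2 * beta - 1) - (r / 2) `^ (2 * beta - 1)) / (2 * beta - 1) =
    ((r / 2) `^ (2 * beta - 1) - (1 + r / 2) `^ (2 * beta - 1)) / (1 - 2 * beta).
    by field; rewrite q0 gt_eqF.
  rewrite /D mulrAC ler_pM2r ?invr_gt0//.
  have := powR_ge0 (1 + r / 2) (2 * beta - 1).
  have -> : (r / 2) `^ (2 * beta - 1) = 2 `^ (1 - 2 * beta) * l ^+ 2.
    rewrite powRM ?invr_ge0 ?(ltW r0)// mulrC; congr (_ * _).
      by rewrite -powR_inv1// -powRrM; congr (_ `^ _); ring.
    by rewrite -(powR_mulrn 2 (ltW l0)) -powRrM; congr (_ `^ _); field.
  have : 2 `^ (1 - 2 * beta) <= 2 :> R by apply: ler1_powR; lra.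
  have := sqr_ge0 l; nra.
have li : 0 < l^-1 by rewrite invr_gt0.
move=> /(ler_wpM2l (ltW li)).
have -> : l^-1 * (D * l ^+ 2) = D * l by field; rewrite gt_eqF.
lra.
Qed.

End potential_near_0.

(** * Polar coordinates near the real axis *)

Section polar_coordinates.
Context {R : realType}.
Local Notation C := (Cplx R).
Implicit Types (a b d e r s x y q : R) (z w : C).

Lemma cvg_mx (T : Type) (F : set_system T) {FF : Filter F} m n
    (g : T -> 'M[C]_(m, n)) (l : 'M[C]_(m, n)) :
  (forall i j, g t i j @[t --> F] --> l i j) -> g t @[t --> F] --> l.
Proof.
move=> gl A [P lP PA].
have sub : (fun t => forall ij : 'I_m * 'I_n, P ij.1 ij.2 (g t ij.1 ij.2)) `<=` g @^-1` A.
  by move=> t Pt; apply: PA => i j; exact: (Pt (i, j)).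
apply: (filterS sub).
apply: (@filter_forall _ _ (fun (ij : 'I_m * 'I_n) t => P ij.1 ij.2 (g t ij.1 ij.2))).
by move=> [i j]; exact: (gl i j _ (lP i j)).
Qed.

Lemma cvg_withinC (D : set C) z (g : C -> C) l : (forall e, 0 < e ->
    exists2 d, 0 < d & forall w, D w -> normc (w - z) < d -> normc (g w - l) < e) ->
  g w @[w --> within D (nbhs z)] --> l.
Proof.
move=> H A /nbhsCP[e e0 eA]; have [d d0 Hd] := H e e0.
by apply/nbhsCP; exists d => // w wz Dw; apply: eA; exact: Hd.
Qed.

Lemma cos_Arg z : z != 0 -> Re z / normc z = cos (Arg z).
Proof.
move=> z0; have n0 : normc z != 0 by rewrite normc_eq0.
have /= -> := congr1 (@complex.Re R) (ArgE z0).
by rewrite mulrC mulKf.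
Qed.

Lemma Re_div_normc z : -1 <= Re z / normc z <= 1.
Proof.
have [->|z0] := eqVneq z 0; first by rewrite /= mul0r lerN10 ler01.
by rewrite cos_Arg// cos_geN1 cos_le1.
Qed.

Lemma Arg_ge0 z : 0 <= Im z -> 0 <= Arg z <= pi.
Proof.
move=> z0; rewrite /Arg z0.
by rewrite acos_ge0 ?acos_lepi ?Re_div_normc.
Qed.

Lemma Arg_le0 z : Im z < 0 -> - pi <= Arg z <= 0.
Proof.
move=> z0; rewrite /Arg [0 <= Im z]leNgt z0 /= lerN2 oppr_le0.
by rewrite acos_ge0 ?acos_lepi ?Re_div_normc.
Qed.

Lemma Im_sin_Arg z : z != 0 -> Im z = normc z * sin (Arg z).
Proof. by move=> z0; have /= -> := congr1 (@complex.Im R) (ArgE z0). Qed.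

Lemma Arg_upper z : 0 < Im z -> 0 < Arg z < pi.
Proof.
move=> z0; have /andP[A0 Api] := Arg_ge0 (ltW z0).
have zn0 : z != 0 by apply: contraTneq z0 => ->; rewrite /= ltxx.
rewrite !lt_neqAle A0 Api !andbT; apply/andP; split; apply/eqP => E.
  by have := Im_sin_Arg zn0; rewrite -E sin0 mulr0 => E'; rewrite E' ltxx in z0.
by have := Im_sin_Arg zn0; rewrite E sinpi mulr0 => E'; rewrite E' ltxx in z0.
Qed.

Lemma Arg_lower z : Im z < 0 -> - pi < Arg z < 0.
Proof.
move=> z0; have /andP[A0 Api] := Arg_le0 z0.
have zn0 : z != 0 by apply: contraTneq z0 => ->; rewrite /= ltxx.
rewrite !lt_neqAle A0 Api !andbT; apply/andP; split; apply/eqP => E.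
  by have := Im_sin_Arg zn0; rewrite -E sinN sinpi oppr0 mulr0 => E'; rewrite E' ltxx in z0.
by have := Im_sin_Arg zn0; rewrite E sin0 mulr0 => E'; rewrite E' ltxx in z0.
Qed.

Lemma cexp_polar z th : z != 0 ->
  cexp ((ln (normc z)) +i* (Arg z + th)) = z * ((cos th) +i* (sin th)) :> C.
Proof.
move=> z0; rewrite /cexp /= lnK ?posrE ?normc_gt0// cosD sinD.
have -> : z * ((cos th) +i* (sin th)) = ((normc z * cos (Arg z)) +i* (normc z * sin (Arg z))) *
    ((cos th) +i* (sin th)) by rewrite -ArgE.
complex_ring.
Qed.

Lemma cos_near1 s q : 0 < s -> q < 1 -> exists2 d, 0 < d &
  forall z, normc (z - s%:C) < d -> q < Re z / normc z.
Proof.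
move=> s0 q1; pose d := Num.min (s / 2) (s * (1 - q) / 4).
exists d; first by rewrite lt_min !divr_gt0// mulr_gt0// subr_gt0.
move=> z; rewrite lt_min => /andP[h1 h2].
have := Re_le_normc (z - s%:C); have := Im_le_normc (z - s%:C).
rewrite ReB ImB /= subr0 => hi hr.
have x0 : s / 2 < Re z.
  by have := ler_norm (s - Re z); rewrite distrC; lra.
have i2 : `|Im z| < s * (1 - q) / 4 by lra.
have zle := normc_le_ReIm z; rewrite (gtr0_norm (lt_trans _ x0)) ?divr_gt0// in zle.
have z0 : 0 < normc z by have := Re_le_normc z; have := ler_norm (Re z); lra.
rewrite ltr_pdivlMr//.
have [q0|q0] := leP q 0.
  by apply: le_lt_trans (_ : 0 < Re z); [rewrite mulr_le0_ge0// ltW|lra].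
apply: le_lt_trans (_ : q * (Re z + `|Im z|) < Re z); first by rewrite ler_pM2l.
have : s / 2 * (1 - q) < Re z * (1 - q) by rewrite ltr_pM2r ?subr_gt0.
have : q * `|Im z| <= `|Im z| by rewrite ler_piMl// ltW.
have : 0 < s * (1 - q) by rewrite mulr_gt0// subr_gt0.
lra.
Qed.

Lemma acos_lt x e : -1 <= x <= 1 -> 0 <= e <= pi -> cos e < x -> acos x < e.
Proof.
move=> x1 epi ex; rewrite -ltr_cos ?acosK ?in_itv//=.
by rewrite acos_ge0// acos_lepi.
Qed.

Lemma Arg_near_pos s e : 0 < s -> 0 < e -> exists2 d, 0 < d &
  forall z, normc (z - s%:C) < d -> `|Arg z| < e.
Proof.
move=> s0 e0; pose e1 := Num.min e 1.
have p2 := @pi_ge2 R.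
have e10 : 0 < e1 by rewrite lt_min e0 ltr01.
have e1pi : e1 <= pi.
  by apply: (@le_trans _ _ 1); [rewrite ge_min lexx orbT|lra].
have c1 : cos e1 < 1.
  by rewrite -(@cos0 R) ltr_cos ?in_itv/= ?lexx ?pi_ge0 ?(ltW e10).
have [d d0 Hd] := cos_near1 s0 c1; exists d => // z /Hd zq.
apply: (@lt_le_trans _ _ e1); last by rewrite ge_min lexx.
have -> : `|Arg z| = acos (Re z / normc z).
  have a0 := acos_ge0 (Re_div_normc z).
  by rewrite /Arg; case: ifP => _; rewrite ?normrN ger0_norm.
by apply: acos_lt => //; rewrite ?Re_div_normc// (ltW e10).
Qed.

(** The shift in the second column of [Lmx] is thus the passage from z to - z, throughout both half
    planes. *)
Lemma Arg_oppE z : Im z != 0 -> Arg (- z) = if 0 < Im z then Arg z - pi else Arg z + pi.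
Proof.
move=> z0; rewrite /Arg normcN.
have -> : Re (- z) / normc z = - (Re z / normc z) by rewrite raddfN/= mulNr.
have -> : Im (- z) = - Im z by rewrite raddfN.
rewrite oppr_ge0 acosN ?Re_div_normc//.
have [zp|zn|ze] := ltgtP 0 (Im z); last by rewrite -ze eqxx in z0.
  by rewrite opprB.
by rewrite addrC.
Qed.

End polar_coordinates.

(** * Boundary values of the continued solutions *)

Section boundary_values.
Context {R : realType}.
Local Notation C := (Cplx R).
Implicit Types (a b d e r s x y th : R) (z w : C) (F : R -> R -> C).

(** Read in the chart ln r + i theta; the argument is not confined to one sheet, so arguments +-pi
    are ordinary points. *)
Lemma log_surface_continuous F r th : log_surface_analytic F -> 0 < r ->
  forall e, 0 < e -> exists2 d, 0 < d & forall r' th', 0 < r' ->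
    `|r' - r| < d -> `|th' - th| < d -> normc (F r' th' - F r th) < e.
Proof.
move=> dF r0 e e0.
have /continuousCP/(_ e e0)[d d0 Hd] := cdiff_continuous (dF ((ln r) +i* th) I).
have d20 : 0 < d / 2 by rewrite divr_gt0.
have /cvgrPdist_lt/(_ _ d20)[d1 /= d10 Hd1] := continuous_ln r0.
exists (Num.min d1 (d / 2)); first by rewrite lt_min d10.
move=> r' th' r'0; rewrite !lt_min => /andP[rr _] /andP[_ tt].
have := Hd ((ln r') +i* th'); rewrite /= !lnK ?posrE//; apply.
apply: le_lt_trans (normc_le_ReIm _) _; rewrite /=.
have := Hd1 r'; rewrite /= distrC => /(_ rr); rewrite distrC => lnr.
by rewrite (splitr d) ltrD.
Qed.

Lemma boundary_pos F s th : log_surface_analytic F -> 0 < s ->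
  forall e, 0 < e -> exists2 d, 0 < d & forall z, z != 0 -> normc (z - s%:C) < d ->
    normc (F (normc z) (Arg z + th) - F s th) < e.
Proof.
move=> dF s0 e e0; have [d d0 Hd] := log_surface_continuous th dF s0 e0.
have [d1 d10 Hd1] := Arg_near_pos s0 d0.
exists (Num.min d d1); first by rewrite lt_min d0.
move=> z z0; rewrite lt_min => /andP[zd zd1].
apply: Hd; [by rewrite normc_gt0| |by rewrite addrK; exact: Hd1].
by apply: le_lt_trans zd; have := normc_lip z s%:C; rewrite normc_Cr (gtr0_norm s0).
Qed.

(** The principal argument jumps across the negative axis, so the point - z, close to s > 0, is used
    instead: there [Arg] is continuous, and [Arg_oppE] restores the shift by +-pi. *)
Lemma boundary_neg F s th : log_surface_analytic F -> 0 < s ->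
  forall e, 0 < e -> exists2 d, 0 < d & forall z, Im z != 0 -> normc (z - (- s)%:C) < d ->
    normc (F (normc z) (Arg z + th) - F s ((if 0 < Im z then pi else - pi) + th)) < e.
Proof.
move=> dF s0 e e0.
have [d1 d10 H1] := boundary_pos (pi + th) dF s0 e0.
have [d2 d20 H2] := boundary_pos (- pi + th) dF s0 e0.
exists (Num.min d1 d2); first by rewrite lt_min d10.
move=> z z0; rewrite lt_min => /andP[zd1 zd2].
have zn0 : - z != 0.
  by rewrite oppr_eq0; apply: contraNneq z0 => ->.
have nE : normc (- z - s%:C) = normc (z - (- s)%:C).
  by rewrite -[LHS]normcN opprB rmorphN !opprK addrC.
have := Arg_oppE z0; case: ifP => zp AE.
  by have := H1 _ zn0; rewrite nE normcN AE addrA subrK; exact.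
by have := H2 _ zn0; rewrite nE normcN AE addrA addrK; exact.
Qed.

End boundary_values.

(** * One integral equation with an abstract kernel *)

Section solution.
Context {R : realType}.
Local Notation C := (Cplx R).
Local Notation mu := (@lebesgue_measure R).
Implicit Types (a b d e r s x y th : R) (z w : C).

Variables (beta : R) (k : R -> R) (u : R -> C) (F : R -> R -> C) (Ck : R).
Hypothesis hbeta : 0 < beta < 1.
Hypothesis Ck0 : 0 < Ck.
Hypothesis mk : measurable_fun (`]0, +oo[ : set R) k.
Hypothesis k_dec : forall t, 0 < t -> `|k t| <= Ck / (1 + t) ^+ 2.
Hypothesis k_0 : forall t, 0 < t -> `|k t| <= Ck * t `^ beta.
Hypothesis k_lip : forall a t, 0 < a -> a / 2 <= t <= a + a / 2 ->
  `|k t - k a| <= Ck * `|t - a| / (a * (1 + a)).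
Hypothesis u2 : in_L2 `[0, +oo[ (fun t => u t - 1).
Hypothesis uE : forall x, 0 < x -> u x =
  1 + Cintegral `]0, +oo[ (fun t => (k t)%:C * u t / (t + x)%:C).
Hypothesis Fu : analytic_continuation u F.

Let f (t : R) : C := (k t)%:C * u t.
Local Notation S := (stieltjes f).

Lemma density_Cintegrable : Cintegrable `]0, +oo[ f.
Proof. exact: (density_integrable mk k_dec u2). Qed.
Let fi := density_Cintegrable.

Lemma solutionE x : 0 < x -> u x = 1 + S x%:C.
Proof.
move=> x0; rewrite uE//; congr (_ + _); apply: eq_Cintegral => t _.
by rewrite rmorphD.
Qed.

Lemma k_dec1 t : 0 < t -> `|k t| <= Ck / (1 + t).
Proof.
move=> t0; apply: le_trans (k_dec t0) _; have t1 : 0 < 1 + t by lra.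
rewrite ler_pM2l// lef_pV2 ?posrE ?exprn_gt0//.
by rewrite expr2 ler_peMr//; lra.
Qed.

Lemma continuation_polar z th : z != 0 -> `|Arg z + th| < pi ->
  F (normc z) (Arg z + th) = 1 + S (z * ((cos th) +i* (sin th))).
Proof.
move=> z0 zth; have [dF F0] := Fu.
have := @continuation_stieltjes _ f F fi dF _ ((ln (normc z)) +i* (Arg z + th)).
rewrite /= lnK ?posrE ?normc_gt0// cexp_polar//; apply => //.
by move=> x x0; rewrite F0// solutionE.
Qed.

Lemma continuationE z : Im z != 0 -> F (normc z) (Arg z) = 1 + S z.
Proof.
move=> z0; have zn0 : z != 0 by apply: contraNneq z0 => ->.
have := @continuation_polar z 0 zn0.
have -> : (cos 0 +i* sin 0 : C) = 1 by rewrite cos0 sin0.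
rewrite addr0 mulr1; apply.
move: z0; rewrite neq_lt ltr_norml => /orP[/Arg_lower|/Arg_upper] /andP[].
  by move=> -> /lt_trans -> //; exact: pi_gt0.
move=> A0 ->; rewrite andbT; apply: lt_trans A0; rewrite oppr_lt0; exact: pi_gt0.
Qed.

Lemma continuation_opp z : Im z != 0 ->
  F (normc z) (Arg z + (if 0 < Im z then - pi else pi)) = 1 + S (- z).
Proof.
move=> z0; have nz0 : Im (- z) != 0 by rewrite raddfN oppr_eq0.
by rewrite -continuationE// normcN Arg_oppE//; case: ifP.
Qed.

(** Both boundary values are limits of 1 + S at - s +- ib, by continuity of the continuation, and
    their difference is known from [stieltjes_jump]. A single height b brings each of the three
    errors below e/3. *)
Lemma solution_jump s : 0 < s ->
  F s (- pi) - F s pi = 2 * pi%:C * 'i%C * (k s)%:C * F s 0.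
Proof.
move=> s0; have [dF F0] := Fu; rewrite F0// -mulrA -/(f s).
apply/eqP; rewrite -subr_eq0 -oppr_eq0 -normc_eq0 eq_le normc_ge0 andbT.
apply/ler_addgt0Pl => e e0; rewrite addr0.
have e3 : 0 < e / 3 by rewrite divr_gt0.
have [d d0 Hd] := boundary_neg 0 dF s0 e3.
have [b0 b00 Hb] := stieltjes_jump Ck0 k_dec1 k_lip fi solutionE s0 e3.
pose b := Num.min (b0 / 2) (d / 2).
have bgt0 : 0 < b by rewrite lt_min !divr_gt0.
have bb0 : 0 < b < b0.
  by rewrite bgt0 /=; apply: (@le_lt_trans _ _ (b0 / 2)); [rewrite ge_min lexx|lra].
have bd : b < d.
  by apply: (@le_lt_trans _ _ (d / 2)); [rewrite ge_min lexx orbT|lra].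
have nb (c : R) : normc ((((- s) +i* c) : C) - (- s)%:C) = `|c|.
  rewrite (_ : _ - _ = 0 +i* c); last by complex_ring.
  by rewrite /normc expr0n add0r sqrtr_sqr.
have H1 := Hd ((- s) +i* b); have H2 := Hd ((- s) +i* (- b)).
move: H1 H2; rewrite /= !addr0 oppr_eq0 gt_eqF// oppr_gt0 bgt0 (lt_gtF bgt0) !nb normrN gtr0_norm//.
move=> /(_ isT bd) H1 /(_ isT bd) H2.
rewrite continuationE in H1; last by rewrite /= gt_eqF.
rewrite continuationE in H2; last by rewrite /= oppr_eq0 gt_eqF.
have H3 := Hb b bb0.
set z := (- s) +i* b in H1 H3; set z' := (- s) +i* (- b) in H2 H3.
have -> : - (F s (- pi) - F s pi - 2 * pi%:C * 'i%C * f s) =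
   - (1 + S z - F s pi) + (1 + S z' - F s (- pi)) +
   (S z - S z' + 2 * pi%:C * 'i%C * f s) by ring.
apply: le_trans (normcD_le _ _) _.
apply: le_trans (lerD (normcD_le _ _) (lexx _)) _.
rewrite normcN; move: H1 H2 H3; lra.
Qed.

(** The [1 +] is kept so that the identity part of L is absorbed as well. *)
Lemma solution_near0 : exists2 M : R, 0 < M & exists2 r0 : R, 0 < r0 &
  forall z, offcut z -> normc z < r0 -> 1 + normc (S z) <= M * `|epsilon_beta beta (normc z)|.
Proof.
have C0 : 0 < Ck := Ck0.
have [M M0 [r0 /andP[r00 r01] Hr]] := potential_bound hbeta Ck0 mk k_dec k_0 u2.
(* With c = 10 + 24 Ck, [normc_stieltjes] gives 1 + |S| <= 1 + 2 c (1 + B) <= (1 + 2 c) (1 + B). *)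
exists ((21 + 48 * Ck) * M); first by rewrite mulr_gt0//; lra.
exists r0 => // z zc zr.
have z0 : 0 < normc z by rewrite normc_gt0 offcut_neq0.
have := normc_stieltjes Ck0 k_dec1 k_lip fi solutionE zc.
have := Hr _ z0 zr; set B := potential _ _ _.
have B0 : 0 <= B by apply: potential_ge0; rewrite divr_gt0.
have q1 : (1 + B) / (1 + normc z) <= 1 + B.
  by rewrite ler_pdivrMr ?ler_peMr//; lra.
move=> h1 h2.
have : (10 + 24 * Ck) * (B + (1 + B) / (1 + normc z)) <= (10 + 24 * Ck) * (2 * (1 + B)).
  by rewrite ler_pM2l; lra.
have : (21 + 48 * Ck) * (1 + B) <= (21 + 48 * Ck) * (M * `|epsilon_beta beta (normc z)|).
  by rewrite ler_pM2l//; lra.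
rewrite -mulrA; move: h2 B0; lra.
Qed.

Lemma solution_infty e : 0 < e -> exists M : R, forall z, offcut z ->
  M < normc z -> normc (S z) < e.
Proof.
have C0 : 0 < Ck := Ck0.
move=> e0; pose N := l1norm k u.
have N0 : 0 <= N by apply: Rintegral_ge0 => t _; exact: normc_ge0.
have c0 : 0 < 10 + 24 * Ck by lra.
(* From B <= 2 N / |z| and (1 + B) / (1 + |z|) <= (1 + 2 N) / |z|; the latter uses |z| > 1, hence
   the [1 +] in the witness below. *)
pose D := (10 + 24 * Ck) * (1 + 4 * N).
have D0 : 0 < D by rewrite mulr_gt0//; lra.
exists (1 + D / e) => z zc zM; have De : 0 < D / e by rewrite divr_gt0.
have z1 : 1 < normc z by lra.
have z0 : 0 < normc z by lra.
have z20 : 0 < normc z / 2 by rewrite divr_gt0.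
apply: le_lt_trans (normc_stieltjes Ck0 k_dec1 k_lip fi solutionE zc) _.
have := potential_le fi z20; rewrite -/N invf_div.
have := potential_ge0 k u z20; set B := potential _ _ _ => B0 BN.
apply: (@le_lt_trans _ _ (D / normc z)); last first.
  by rewrite ltr_pdivrMr// -ltr_pdivrMl// mulrC; lra.
have BN1 : B <= 2 * N / normc z by apply: le_trans BN _; rewrite mulrAC.
have BN2 : B <= 2 * N.
  by apply: le_trans BN1 _; rewrite ler_pdivrMr// ler_peMr ?mulr_ge0// ltW.
rewrite /D -mulrA ler_pM2l//.
have -> : (1 + 4 * N) / normc z = 2 * N / normc z + (1 + 2 * N) / normc z by ring.
apply: lerD => //; apply: ler_pM; [lra|rewrite invr_ge0; lra|lra|].
by rewrite lef_pV2 ?posrE//; lra.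
Qed.

End solution.

(** * The Riemann-Hilbert problem *)

Section riemann_hilbert.
Context {R : realType}.
Local Notation C := (Cplx R).
Implicit Types (a b d e r s x y th : R) (z w : C) (u v : R -> R -> C).

Lemma Lmx_upper n u v z : 0 < Im z -> Lmx n u v z =
  mx22 (Lbeta u v (normc z) (Arg z)) ((-1) ^+ n * Ubeta u v (normc z) (Arg z - pi))
    ((-1) ^+ n * Ubeta u v (normc z) (Arg z)) (Lbeta u v (normc z) (Arg z - pi)).
Proof. by rewrite /Lmx => ->. Qed.

Lemma Lmx_lower n u v z : Im z < 0 -> Lmx n u v z =
  mx22 (Lbeta u v (normc z) (Arg z)) ((-1) ^+ n * Ubeta u v (normc z) (Arg z + pi))
    ((-1) ^+ n * Ubeta u v (normc z) (Arg z)) (Lbeta u v (normc z) (Arg z + pi)).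
Proof. by rewrite /Lmx => /lt_gtF ->. Qed.

Lemma log_surface_Lbeta u v : log_surface_analytic u -> log_surface_analytic v ->
  log_surface_analytic (Lbeta u v).
Proof.
move=> du dv w _; apply: cdiffM; first exact: cdiff_cst.
by apply: cdiffD; [exact: du|exact: dv].
Qed.

Lemma log_surface_Ubeta n u v : log_surface_analytic u -> log_surface_analytic v ->
  log_surface_analytic (fun r th => (-1) ^+ n * Ubeta u v r th).
Proof.
move=> du dv w _; apply: cdiffM; first exact: cdiff_cst.
apply: cdiffM; first exact: cdiff_cst.
by apply: cdiffB; [exact: du|exact: dv].
Qed.

(** One statement for four situations (half plane and sign of s): p is the shift of the second
    column, th the limit of [Arg] inside D. Each entry is a single function analytic on the surface,
    so [HF] applies to it. *)
Lemma Lmx_boundary n u v (D : set C) s r th p :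
  log_surface_analytic u -> log_surface_analytic v ->
  (forall z, D z -> Lmx n u v z =
    mx22 (Lbeta u v (normc z) (Arg z)) ((-1) ^+ n * Ubeta u v (normc z) (Arg z + p))
      ((-1) ^+ n * Ubeta u v (normc z) (Arg z)) (Lbeta u v (normc z) (Arg z + p))) ->
  (forall F q, log_surface_analytic F -> forall e, 0 < e -> exists2 d, 0 < d &
    forall z, D z -> normc (z - s%:C) < d ->
      normc (F (normc z) (Arg z + q) - F r (th + q)) < e) ->
  Lmx n u v z @[z --> within D (nbhs (s%:C : C))] -->
    mx22 (Lbeta u v r th) ((-1) ^+ n * Ubeta u v r (th + p))
      ((-1) ^+ n * Ubeta u v r th) (Lbeta u v r (th + p)).
Proof.
move=> du dv LE HF; have dL := log_surface_Lbeta du dv.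
have dU := @log_surface_Ubeta n u v du dv.
have HF0 F : log_surface_analytic F -> forall e, 0 < e -> exists2 d, 0 < d &
    forall z, D z -> normc (z - s%:C) < d -> normc (F (normc z) (Arg z) - F r th) < e.
  move=> dF e e0; have [d d0 Hd] := HF F 0 dF e e0; exists d => // z Dz zs.
  by have := Hd z Dz zs; rewrite !addr0.
apply: cvg_mx => i j; apply: cvg_withinC => e e0.
have [d1 d10 H1] := HF0 _ dL e e0; have [d2 d20 H2] := HF _ p dU e e0.
have [d3 d30 H3] := HF0 _ dU e e0; have [d4 d40 H4] := HF _ p dL e e0.
exists (Num.min (Num.min d1 d2) (Num.min d3 d4)); first by rewrite !lt_min d10 d20 d30.
move=> z Dz; rewrite !lt_min => /andP[/andP[z1 z2] /andP[z3 z4]].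
rewrite LE// /mx22 !mxE; case: ifP => _; case: ifP => _.
- exact: H1.
- exact: H2.
- exact: H3.
- exact: H4.
Qed.

Lemma Cinfty_nbhs_filter : Filter (Cinfty_nbhs R).
Proof.
split.
- by exists 0.
- move=> P Q [M1 H1] [M2 H2]; exists (Num.max M1 M2) => z.
  by rewrite gt_max => /andP[/H1 ? /H2].
- by move=> P Q PQ [M H]; exists M => z /H /PQ.
Qed.

Lemma ord2_case (P : 'I_2 -> Prop) : P ord0 -> P ord_max -> forall i, P i.
Proof.
by move=> P0 P1 [[|[|//]] hi]; [move: P0|move: P1]; congr P; exact: val_inj.
Qed.

Lemma normc_sign n : normc ((-1) ^+ n : C) = 1.
Proof. by elim: n => [|n IH]; rewrite ?expr0 ?normc1// exprS normcM IH normcN normc1 mul1r. Qed.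

Lemma mx22_mul (a b c d a' b' c' d' : C) : mx22 a b c d *m mx22 a' b' c' d' =
  mx22 (a * a' + b * c') (a * b' + b * d') (c * a' + d * c') (c * b' + d * d').
Proof.
apply/matrixP; elim/ord2_case; elim/ord2_case;
  by rewrite mxE !big_ord_recl big_ord0 addr0 /mx22 !mxE.
Qed.

Lemma etaL_pos (b : R) n s : 0 < s ->
  etaL b n s = - ((-1) ^+ n * (2 * pi%:C * 'i%C * (kernelK b s)%:C)).
Proof.
move=> s0; rewrite /etaL (gtr0_norm s0) indicE mem_setE in_itv /= (ltW s0) mulr1.
have -> : expR (- (s `^ b * sin (pi * b / 2))) * sin (s `^ b * cos (pi * b / 2)) =
    pi * kernelK b s.
  by rewrite /kernelK mulrA divff ?mul1r// gt_eqF// pi_gt0.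
by rewrite rmorphM exprS; ring.
Qed.

Lemma etaL_neg (b : R) n s : s < 0 -> etaL b n s = 0.
Proof.
move=> s0; rewrite /etaL indicE mem_setE in_itv /= leNgt s0 /=.
by rewrite mulr0 mulr0.
Qed.

(** Only the second column jumps. The kernels of u and v have opposite signs, so half-sum and
    half-difference are exchanged: L(-pi) = L(pi) + c K U(0) and U(-pi) = U(pi) + c K L(0). On the
    diagonal the two factors (-1)^n cancel. *)
Lemma jump_relation_pos (b : R) n u v s : 0 < s ->
  u s (- pi) - u s pi = 2 * pi%:C * 'i%C * (kernelK b s)%:C * u s 0 ->
  v s (- pi) - v s pi = 2 * pi%:C * 'i%C * (- kernelK b s)%:C * v s 0 ->
  mx22 (Lbeta u v s 0) ((-1) ^+ n * Ubeta u v s (- pi))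
    ((-1) ^+ n * Ubeta u v s 0) (Lbeta u v s (- pi)) =
  mx22 (Lbeta u v s 0) ((-1) ^+ n * Ubeta u v s pi)
    ((-1) ^+ n * Ubeta u v s 0) (Lbeta u v s pi) *m jumpL b n s.
Proof.
move=> s0; rewrite /jumpL etaL_pos// etaL_neg ?oppr_lt0// opprK mx22_mul rmorphN /=.
set c := 2 * pi%:C * 'i%C; set K := (kernelK b s)%:C => /eqP + /eqP.
rewrite !subr_eq => /eqP ju /eqP jv.
have sg : (-1) ^+ n * (-1) ^+ n = 1 :> C by rewrite -expr2 sqrr_sign.
have n2 : (2 : C) != 0 by rewrite pnatr_eq0.
rewrite /Lbeta /Ubeta ju jv; congr mx22.
- by ring.
- by ring.
- by ring.
transitivity ((-1) ^+ n * (-1) ^+ n * (c * K) * (2^-1 * (u s 0 - v s 0)) +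
  2^-1 * (u s pi + v s pi)); last by ring.
by rewrite sg; ring.
Qed.

(** Only the first column jumps, at modulus - s: its argument is pi from above and -pi from below,
    while the second column is at argument 0 from both sides. *)
Lemma jump_relation_neg (b : R) n u v s : s < 0 ->
  u (- s) (- pi) - u (- s) pi = 2 * pi%:C * 'i%C * (kernelK b (- s))%:C * u (- s) 0 ->
  v (- s) (- pi) - v (- s) pi = 2 * pi%:C * 'i%C * (- kernelK b (- s))%:C * v (- s) 0 ->
  mx22 (Lbeta u v (- s) pi) ((-1) ^+ n * Ubeta u v (- s) 0)
    ((-1) ^+ n * Ubeta u v (- s) pi) (Lbeta u v (- s) 0) =
  mx22 (Lbeta u v (- s) (- pi)) ((-1) ^+ n * Ubeta u v (- s) 0)
    ((-1) ^+ n * Ubeta u v (- s) (- pi)) (Lbeta u v (- s) 0) *m jumpL b n s.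
Proof.
move=> s0; rewrite /jumpL etaL_neg// etaL_pos ?oppr_gt0// oppr0 mx22_mul rmorphN /=.
set c := 2 * pi%:C * 'i%C; set K := (kernelK b (- s))%:C => /eqP + /eqP.
rewrite !subr_eq => /eqP ju /eqP jv.
have sg : (-1) ^+ n * (-1) ^+ n = 1 :> C by rewrite -expr2 sqrr_sign.
rewrite /Lbeta /Ubeta ju jv; congr mx22.
- transitivity (2^-1 * (c * K * u (- s) 0 + u (- s) pi + (c * - K * v (- s) 0 + v (- s) pi)) -
    (-1) ^+ n * (-1) ^+ n * (c * K) * (2^-1 * (u (- s) 0 - v (- s) 0))); last by ring.
  by rewrite sg; ring.
- by ring.
- by ring.
- by ring.
Qed.

(** Reduces growth at 0 and convergence at infinity to the four values of S at z and - z, for u and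
    v; eps is the sign (-1)^n. *)
Lemma mx22_near_id (a b a' b' eps : C) i j : normc eps = 1 ->
  normc (mx22 (1 + (a + b) / 2) (eps * ((a' - b') / 2)) (eps * ((a - b) / 2))
    (1 + (a' + b') / 2) i j - (1%:M : 'M[C]_2) i j) <=
  (normc a + normc b + normc a' + normc b') / 2.
Proof.
move=> e1; have n2 : normc (2^-1 : C) = 2^-1.
  rewrite normcV; congr (_^-1); rewrite (_ : 2 = (2 : R)%:C :> C) ?normc_Cr ?ger0_norm//.
  by rewrite rmorph_nat.
have half (x y : C) : normc ((x + y) / 2) <= (normc x + normc y) / 2.
  by rewrite normcM n2 ler_pM2r ?invr_gt0//; exact: normcD_le.
have halfN (x y : C) : normc (eps * ((x - y) / 2)) <= (normc x + normc y) / 2.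
  by rewrite normcM e1 mul1r -(normcN y); exact: half.
have h1 := half a b; have h2 := half a' b'.
have h3 := halfN a b; have h4 := halfN a' b'.
have a0 := normc_ge0 a; have b0 := normc_ge0 b.
have a'0 := normc_ge0 a'; have b'0 := normc_ge0 b'.
have addK1 (x : C) : 1 + x - 1 = x by rewrite addrC addKr.
elim/ord2_case: i; elim/ord2_case: j; rewrite /mx22 2!mxE /=.
- rewrite mulr1n addK1; apply: le_trans h1 _; lra.
- rewrite mulr0n subr0; apply: le_trans h4 _; lra.
- rewrite mulr0n subr0; apply: le_trans h3 _; lra.
- rewrite mulr1n addK1; apply: le_trans h2 _; lra.
Qed.

End riemann_hilbert.

Unset Implicit Arguments.

Theorem theorem1 (R : realType) (beta : R) (n : nat)
    (u v : R -> Cplx R) (uc vc : R -> R -> Cplx R)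
    (hbeta : 0 < beta < 1)
    (hu : forall x, 0 < x -> u x =
       1 + Cintegral `]0, +oo[ (fun t => (kernelK beta t)%:C * u t / (t + x)%:C))
    (hv : forall x, 0 < x -> v x =
       1 - Cintegral `]0, +oo[ (fun t => (kernelK beta t)%:C * v t / (t + x)%:C))
    (hu2 : in_L2 `[0, +oo[ (fun t => u t - 1))
    (hv2 : in_L2 `[0, +oo[ (fun t => v t - 1))
    (huc : analytic_continuation u uc)
    (hvc : analytic_continuation v vc) :
  let L := Lmx n uc vc in
  [/\ forall i j, holomorphic_on (nonreal R) (fun s => L s i j),
      forall s : R, s != 0 -> exists Lp Lm : 'M[Cplx R]_2,
        [/\ L z @[z --> within (upper_half R) (nbhs (s%:C : Cplx R))] --> Lp,
            L z @[z --> within (lower_half R) (nbhs (s%:C : Cplx R))] --> Lm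
          & Lp = Lm *m jumpL beta n s],
      forall i j, exists2 M : R, 0 < M &
        \forall s \near within (nonreal R) (nbhs (0 : Cplx R)),
          `|L s i j| <= (M * `|epsbeta beta s|)%:C
    & L s @[s --> within (nonreal R) (Cinfty_nbhs R)] --> (1%:M : 'M[Cplx R]_2)].
Proof.
move=> L.
have [Ck [Ck0 k1 k2 k3]] := kernelK_bound hbeta.
have mk := @measurable_kernelK R beta (`]0, +oo[ : set R).
(* From here on v is a solution of the equation of u for the kernel -K, with the same constant
   [Ck]. *)
have mk' : measurable_fun (`]0, +oo[ : set R) (fun t => - kernelK beta t).
  exact: measurable_funN.
have k1' t : 0 < t -> `|- kernelK beta t| <= Ck / (1 + t) ^+ 2.
  by rewrite normrN; exact: k1.
have k2' t : 0 < t -> `|- kernelK beta t| <= Ck * t `^ beta.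
  by rewrite normrN; exact: k2.
have k3' a t : 0 < a -> a / 2 <= t <= a + a / 2 ->
    `|- kernelK beta t - - kernelK beta a| <= Ck * `|t - a| / (a * (1 + a)).
  by rewrite -opprD normrN; exact: k3.
have hv' x : 0 < x -> v x =
    1 + Cintegral `]0, +oo[ (fun t => (- kernelK beta t)%:C * v t / (t + x)%:C).
  move=> x0; rewrite hv//; congr (_ + _).
  have vi := Cintegrable_stieltjes (density_integrable mk k1 hv2) (offcut_pos x0).
  rewrite -mulN1r (@eq_Cintegral _ _ _
    (fun t => (kernelK beta t)%:C * v t / (t%:C + x%:C))); last first.
    by move=> t _; rewrite rmorphD.
  rewrite -CintegralZl//; apply: eq_Cintegral => t _.
  by rewrite mulN1r rmorphN rmorphD !mulNr.
pose Su := stieltjes (fun t => (kernelK beta t)%:C * u t).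
pose Sv := stieltjes (fun t => (- kernelK beta t)%:C * v t).
have offc (z : Cplx R) : Im z != 0 -> offcut z /\ offcut (- z).
  by move=> z0; split; right => //; rewrite raddfN oppr_eq0.
(* The two cases of [Lmx] merge: off the real axis one formula in S(z) and S(-z) covers both half
   planes. *)
have LE z : Im z != 0 -> L z =
    mx22 (1 + (Su z + Sv z) / 2) ((-1) ^+ n * ((Su (- z) - Sv (- z)) / 2))
      ((-1) ^+ n * ((Su z - Sv z) / 2)) (1 + (Su (- z) + Sv (- z)) / 2).
  move=> z0.
  have uE := continuationE mk k1 hu2 hu huc z0.
  have vE := continuationE mk' k1' hv2 hv' hvc z0.
  have uN := continuation_opp mk k1 hu2 hu huc z0.
  have vN := continuation_opp mk' k1' hv2 hv' hvc z0.
  rewrite -/(Su _) in uE uN; rewrite -/(Sv _) in vE vN.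
  have n2 : (2 : Cplx R) != 0 by rewrite pnatr_eq0.
  have half (x y : Cplx R) : 2^-1 * (1 + x + (1 + y)) = 1 + (x + y) / 2 by field.
  have halfN (x y : Cplx R) : 2^-1 * (1 + x - (1 + y)) = (x - y) / 2 by field.
  have [zp|zn] : 0 < Im z \/ Im z < 0 by apply/orP; rewrite -neq_lt eq_sym.
    rewrite zp in uN vN; rewrite /L Lmx_upper// /Lbeta /Ubeta uE vE uN vN.
    by rewrite !half !halfN.
  rewrite (lt_gtF zn) in uN vN; rewrite /L Lmx_lower// /Lbeta /Ubeta uE vE uN vN.
  by rewrite !half !halfN.
have near1 z i j : Im z != 0 -> normc (L z i j - (1%:M : 'M[Cplx R]_2) i j) <=
    (normc (Su z) + normc (Sv z) + normc (Su (- z)) + normc (Sv (- z))) / 2.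
  by move=> z0; rewrite LE//; apply: mx22_near_id; exact: normc_sign.
have [[duc _] [dvc _]] := (huc, hvc).
split.
- move=> i j z z0; have nz : 0 < `|Im z| by rewrite normr_gt0.
  (* The formula holds only off the real axis, so derivability is transferred within the disc of
     radius |Im z| about z. *)
  have transfer i' j' (g : Cplx R -> Cplx R) : (forall w, Im w != 0 -> L w i' j' = g w) ->
      derivable g z 1 -> derivable (fun w => L w i' j') z 1.
    move=> Lg; apply: cdiff_near; apply/nbhsCP; exists `|Im z| => // w wz; rewrite Lg.
      by [].
    apply/eqP => w0; move: (Im_le_normc (w - z)).
    by rewrite ImB w0 sub0r normrN leNgt wz.
  have [zc zNc] := offc z z0.
  have dSu := derivable_stieltjes (density_integrable mk k1 hu2).
  have dSv := derivable_stieltjes (density_integrable mk' k1' hv2).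
  have d1 := dSu _ zc; have d2 := dSv _ zc.
  have dN : derivable (fun w : Cplx R => - w) z 1 by apply: cdiffN; exact: cdiff_id.
  have d3 := cdiff_comp dN (dSu _ zNc); have d4 := cdiff_comp dN (dSv _ zNc).
  have dc c : derivable (fun=> c : Cplx R) z 1 by exact: cdiff_cst.
  elim/ord2_case: i; elim/ord2_case: j.
  + apply: (transfer _ _ (fun w => 1 + (Su w + Sv w) * 2^-1)).
      by move=> w w0; rewrite (LE _ w0) /mx22 mxE.
    exact: cdiffD (dc _) (cdiffM (cdiffD d1 d2) (dc _)).
  + apply: (transfer _ _ (fun w => (-1) ^+ n * ((Su (- w) - Sv (- w)) * 2^-1))).
      by move=> w w0; rewrite (LE _ w0) /mx22 mxE.
    exact: cdiffM (dc _) (cdiffM (cdiffB d3 d4) (dc _)).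
  + apply: (transfer _ _ (fun w => (-1) ^+ n * ((Su w - Sv w) * 2^-1))).
      by move=> w w0; rewrite (LE _ w0) /mx22 mxE.
    exact: cdiffM (dc _) (cdiffM (cdiffB d1 d2) (dc _)).
  + apply: (transfer _ _ (fun w => 1 + (Su (- w) + Sv (- w)) * 2^-1)).
      by move=> w w0; rewrite (LE _ w0) /mx22 mxE.
    exact: cdiffD (dc _) (cdiffM (cdiffD d3 d4) (dc _)).
- move=> s s0; have [sp|sn] : 0 < s \/ s < 0 by apply/orP; rewrite -neq_lt eq_sym.
    (* At s > 0, [Arg] tends to 0 from both sides, and the second column to argument -pi from above
       and pi from below. *)
    exists (mx22 (Lbeta uc vc s 0) ((-1) ^+ n * Ubeta uc vc s (0 - pi))
      ((-1) ^+ n * Ubeta uc vc s 0) (Lbeta uc vc s (0 - pi))).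
    exists (mx22 (Lbeta uc vc s 0) ((-1) ^+ n * Ubeta uc vc s (0 + pi))
      ((-1) ^+ n * Ubeta uc vc s 0) (Lbeta uc vc s (0 + pi))).
    split.
    + apply: (Lmx_boundary duc dvc); first by move=> z; exact: Lmx_upper.
      move=> F q dF e e0; have [d d0 Hd] := boundary_pos q dF sp e0.
      exists d => // z zp; rewrite add0r; apply: Hd.
      by apply/eqP => z0; rewrite /upper_half /= z0 ltxx in zp.
    + apply: (Lmx_boundary duc dvc); first by move=> z; exact: Lmx_lower.
      move=> F q dF e e0; have [d d0 Hd] := boundary_pos q dF sp e0.
      exists d => // z zn; rewrite add0r; apply: Hd.
      by apply/eqP => z0; rewrite /lower_half /= z0 ltxx in zn.
    have ju := solution_jump Ck0 mk k1 k3 hu2 hu huc sp.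
    have jv := solution_jump Ck0 mk' k1' k3' hv2 hv' hvc sp.
    rewrite sub0r add0r; exact: jump_relation_pos sp ju jv.
  have rp : 0 < - s by rewrite oppr_gt0.
  exists (mx22 (Lbeta uc vc (- s) pi) ((-1) ^+ n * Ubeta uc vc (- s) (pi - pi))
    ((-1) ^+ n * Ubeta uc vc (- s) pi) (Lbeta uc vc (- s) (pi - pi))).
  exists (mx22 (Lbeta uc vc (- s) (- pi)) ((-1) ^+ n * Ubeta uc vc (- s) (- pi + pi))
    ((-1) ^+ n * Ubeta uc vc (- s) (- pi)) (Lbeta uc vc (- s) (- pi + pi))).
  split.
  + apply: (Lmx_boundary duc dvc); first by move=> z; exact: Lmx_upper.
    move=> F q dF e e0; have [d d0 Hd] := boundary_neg q dF rp e0.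
    exists d => // z zp; have := Hd z; rewrite opprK zp; apply.
    by rewrite gt_eqF.
  + apply: (Lmx_boundary duc dvc); first by move=> z; exact: Lmx_lower.
    move=> F q dF e e0; have [d d0 Hd] := boundary_neg q dF rp e0.
    exists d => // z zn; have := Hd z; rewrite opprK (lt_gtF zn); apply.
    by rewrite lt_eqF.
  have ju := solution_jump Ck0 mk k1 k3 hu2 hu huc rp.
  have jv := solution_jump Ck0 mk' k1' k3' hv2 hv' hvc rp.
  rewrite subrr addNr; exact: jump_relation_neg sn ju jv.
- move=> i j.
  have [M1 M10 [r1 r10 H1]] := solution_near0 hbeta Ck0 mk k1 k2 k3 hu2 hu.
  have [M2 M20 [r2 r20 H2]] := solution_near0 hbeta Ck0 mk' k1' k2' k3' hv2 hv'.
  (* Half the sum of four bounds, two with M1 and two with M2; their [1 +] terms add up to 2 after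
     halving and absorb the entry of the identity. *)
  exists (M1 + M2); first exact: addr_gt0.
  apply/nbhsCP; exists (Num.min r1 r2); first by rewrite lt_min r10.
  move=> z; rewrite subr0 lt_min => /andP[z1 z2] z0; have [zc zNc] := offc z z0.
  rewrite normrE lecR.
  have K1 := H1 z zc z1; have K2 := H2 z zc z2.
  have K3 := H1 (- z) zNc; rewrite normcN in K3; have {}K3 := K3 z1.
  have K4 := H2 (- z) zNc; rewrite normcN in K4; have {}K4 := K4 z2.
  have K5 := near1 z i j z0.
  have n1 : normc ((1%:M : 'M[Cplx R]_2) i j) <= 1.
    by rewrite mxE; case: (i == j); rewrite ?mulr1n ?mulr0n ?normc1 ?normc0.
  rewrite -/(epsilon_beta beta (normc z)) mulrDl.
  rewrite -[L z i j](subrK ((1%:M : 'M[Cplx R]_2) i j)).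
  apply: le_trans (normcD_le _ _) _.
  rewrite -/(Su _) in K1 K3; rewrite -/(Sv _) in K2 K4.
  move: K1 K2 K3 K4 K5 n1; lra.
- have FF := Cinfty_nbhs_filter.
  apply: cvg_mx => i j A /nbhsCP[e e0 eA].
  have e2 : 0 < e / 2 by rewrite divr_gt0.
  have [M1 H1] := solution_infty Ck0 mk k1 k3 hu2 hu e2.
  have [M2 H2] := solution_infty Ck0 mk' k1' k3' hv2 hv' e2.
  exists (Num.max M1 M2) => z; rewrite gt_max => /andP[z1 z2] z0; apply: eA.
  have [zc zNc] := offc z z0.
  have K1 := H1 z zc z1; have K2 := H2 z zc z2.
  have K3 := H1 (- z) zNc; rewrite normcN in K3; have {}K3 := K3 z1.
  have K4 := H2 (- z) zNc; rewrite normcN in K4; have {}K4 := K4 z2.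
  rewrite -/(Su _) in K1 K3; rewrite -/(Sv _) in K2 K4.
  have K5 := near1 z i j z0.
  by apply: le_lt_trans K5 _; move: K1 K2 K3 K4; lra.
Qed.
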